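(* Let $\mathcal{W},\mathcal{V}$ be closed subspaces of $L^2(\mathbb{R})$ with $L^2(\mathbb{R})=\mathcal{W}\oplus\mathcal{V}^{\perp}$. Let $\phi,\phi_1\in L^2(\mathbb{R})$ be such that $\{T_k\phi\}_{k\in\mathbb{Z}}$ and $\{T_k\phi_1\}_{k\in\mathbb{Z}}$ are frames for $\mathcal{W}$ and $\mathcal{V}$, respectively. Let $\widetilde{\phi}\in\mathcal{V}$ be such that $\widehat{\widetilde{\phi}}=\widetilde{H}\,\widehat{\phi_1}$, where $\widetilde{H}\in\mathcal{C}^{2}_{\mathrm{per}}$. Let $\epsilon\ge0$. If $\{T_k\phi\}_{k\in\mathbb{Z}}$ and $\{T_k\widetilde{\phi}\}_{k\in\mathbb{Z}}$ are $\epsilon$-approximate oblique dual frames, then $$\big|\overline{\widetilde{H}}(\gamma)[\widehat{\phi},\widehat{\phi_1}](\gamma)-1\big|\le\epsilon$$ for a.e. $\gamma\in N(\Phi)^{c}$.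
   Context: $T_kf(x)=f(x-k)$ for $k\in\mathbb{Z}$. The Fourier transform is $\widehat{f}(\gamma)=\int_{\mathbb{R}}f(x)e^{-2\pi i x\gamma}\,dx$, extended to a unitary operator of $L^2(\mathbb{R})$. $\mathcal{C}^{p}_{\mathrm{per}}$ is the class of 1-periodic functions on $\mathbb{R}$ whose restriction to $[0,1)$ belongs to $L^p(0,1)$. For $\phi,\psi\in L^2(\mathbb{R})$, the 1-periodic bracket is $[\widehat{\phi},\widehat{\psi}](\gamma)=\sum_{k\in\mathbb{Z}}\widehat{\phi}(\gamma+k)\overline{\widehat{\psi}(\gamma+k)}$ (a.e. defined, complex valued); $\Phi(\gamma)=\sum_{k\in\mathbb{Z}}|\widehat{\phi}(\gamma+k)|^2$, $N(\Phi)=\{\gamma:\Phi(\gamma)=0\}$; $A^c$ is the complement of $A$ in $\mathbb{R}$. The direct sum $\mathcal{H}=\mathcal{W}\oplus\mathcal{V}^{\perp}$ ($\mathcal{H}=L^2(\mathbb{R})$; equivalently $\mathcal{H}=\mathcal{V}\oplus\mathcal{W}^{\perp}$) is not assumed orthogonal; $\pi_{\mathcal{W}\mathcal{V}^{\perp}}$ is the oblique projection onto $\mathcal{W}$ along $\mathcal{V}^{\perp}$ and $\pi_{\mathcal{V}\mathcal{W}^{\perp}}$ that onto $\mathcal{V}$ along $\mathcal{W}^{\perp}$. A family $\{f_k\}\subset\mathcal{W}$ is a frame for $\mathcal{W}$ if there are $0<\alpha\le\beta<\infty$ with $\alpha\|f\|^2\le\sum_k|\langle f,f_k\rangle|^2\le\beta\|f\|^2$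 for all $f\in\mathcal{W}$. For such $\mathcal{F}=\{f_k\}$, $T_{\mathcal{F}}\{c_k\}=\sum_kc_kf_k$ (synthesis operator on $\ell^2$) and $T_{\mathcal{F}}^{*}f=\{\langle f,f_k\rangle\}_k$. Frames $\mathcal{F}$ for $\mathcal{W}$ and $\mathcal{G}$ for $\mathcal{V}$ are $\epsilon$-approximate oblique dual frames if $\|\pi_{\mathcal{W}\mathcal{V}^{\perp}}-T_{\mathcal{F}}T_{\mathcal{G}}^{*}\|\le\epsilon$ or, equivalently, $\|\pi_{\mathcal{V}\mathcal{W}^{\perp}}-T_{\mathcal{G}}T_{\mathcal{F}}^{*}\|\le\epsilon$. *)

(* Defs.v *)
From HB Require Import structures.
From mathcomp Require Import all_boot all_order all_algebra.
From mathcomp Require Import all_classical all_reals all_analysis.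
From mathcomp.real_closed Require Export complex.

Set Implicit Arguments.
Unset Strict Implicit.
Unset Printing Implicit Defensive.

Import Order.TTheory GRing.Theory Num.Theory.
Import numFieldNormedType.Exports.

Local Open Scope classical_set_scope.
Local Open Scope ring_scope.

(* L^2(R) is represented by square-integrable functions R -> R[i]; equality in
   L^2(R) is equality almost everywhere, and changing representatives alters
   the notions below at most on a null set. *)

Section L2.
Context {R : realType}.
Local Notation mu := (@lebesgue_measure R).
Implicit Types (f g : R -> R[i]) (p : \bar R).

Definition cnorm (z : R[i]) : R := ComplexField.Normc.normc z.

Definition memLp p f : Prop :=
  ((fun x => complex.Re (f x)) \in Lfun mu p) /\
  ((fun x => complex.Im (f x)) \in Lfun mu p).

Definition L1 : set (R -> R[i]) := [set f | memLp 1%:E f].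
Definition L2 : set (R -> R[i]) := [set f | memLp 2%:E f].

Definition norm2 f : \bar R := Lnorm mu 2%:E (fun x => (cnorm (f x))%:E).

Definition cvgL2 (u : nat -> R -> R[i]) f : Prop :=
  norm2 (u n \- f) @[n --> \oo] --> 0%E.

Definition cintegral f : R[i] :=
  Complex (\int[mu]_(x in setT) complex.Re (f x))
          (\int[mu]_(x in setT) complex.Im (f x)).

Definition inner f g : R[i] := cintegral (fun x => f x * conjc (g x)).

End L2.

Section Fourier.
Context {R : realType}.
Implicit Types (f g : R -> R[i]).

(* exp(i t) *)
Definition cexp (t : R) : R[i] := Complex (cos t) (sin t).

Definition fourier_integral f (xi : R) : R[i] :=
  cintegral (fun x => f x * cexp (- (2 * pi * x * xi))).

(* Graph of the extension by continuity to L^2 of the Fourier integral on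
   L^1 `&` L^2: the closure of its graph in L^2 x L^2. *)
Definition is_fourier f g : Prop :=
  [/\ L2 f, L2 g &
      exists u : nat -> R -> R[i],
        [/\ forall n, (L1 `&` L2) (u n),
            cvgL2 u f &
            cvgL2 (fun n => fourier_integral (u n)) g]].

(* A representative of the Fourier transform of f in L^2(R). *)
Definition fourier f : R -> R[i] := xget (fun=> 0) [set g | is_fourier f g].

End Fourier.

Section Series.
Context {R : realType}.

(* Sums over the integers are limits of symmetric partial sums; those used
   below converge absolutely, resp. unconditionally in L^2. *)
Definition csum (u : int -> R[i]) : R[i] :=
  Complex
    (limn (fun n => \sum_(j < n.*2.+1) complex.Re (u (j%:Z - n%:Z))))
    (limn (fun n => \sum_(j < n.*2.+1) complex.Im (u (j%:Z - n%:Z)))).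

(* The class C^p_per, the restriction to [0, 1) being extended by 0. *)
Definition Cper (p : \bar R) (H : R -> R[i]) : Prop :=
  (forall x, H (x + 1) = H x) /\
  memLp p (fun x => (\1_(`[0, 1[) x)%:C%C * H x).

Definition bracket (f g : R -> R[i]) (xi : R) : R[i] :=
  csum (fun k => f (xi + k%:~R) * conjc (g (xi + k%:~R))).

(* Phi, as a function of the Fourier transform. *)
Definition periodization (f : R -> R[i]) (xi : R) : \bar R :=
  (\esum_(k in [set: int]) ((cnorm (f (xi + k%:~R))) ^+ 2)%:E)%E.

Definition zero_set (h : R -> \bar R) : set R := [set xi | h xi = 0%E].

End Series.

Section Hilbert.
Context {R : realType}.
Implicit Types (W V : set (R -> R[i])) (F G : int -> R -> R[i]).

(* The last clause makes W stable under equality almost everywhere (take u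
   constant). *)
Definition closed_subspace W : Prop :=
  [/\ W `<=` L2, W (fun=> 0),
      forall (a : R[i]) f g, W f -> W g -> W (fun x => a * f x + g x) &
      forall u f, (forall n, W (u n)) -> L2 f -> cvgL2 u f -> W f].

Definition orthocompl V : set (R -> R[i]) :=
  [set f | L2 f /\ forall g, V g -> inner f g = 0].

(* L^2(R) is the algebraic, not necessarily orthogonal, direct sum of W and
   U. *)
Definition direct_sum W U : Prop :=
  (forall f, L2 f -> exists2 w, W w & U (f \- w)) /\
  (forall f, W f -> U f -> {ae lebesgue_measure, forall x, f x = 0}).

(* A representative of the projection of f onto W along U. *)
Definition projection W U (f : R -> R[i]) : R -> R[i] :=
  xget (fun=> 0) [set w | W w /\ U (f \- w)].

Definition translate (k : int) (f : R -> R[i]) : R -> R[i] :=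
  fun x => f (x - k%:~R).

Definition translates (f : R -> R[i]) : int -> R -> R[i] :=
  fun k => translate k f.

Definition frame_for W F : Prop :=
  (forall k, W (F k)) /\
  exists alpha beta : R,
    [/\ 0 < alpha, alpha <= beta &
        forall f, W f ->
          (alpha%:E * norm2 f ^+ 2 <=
             \esum_(k in [set: int]) ((cnorm (inner f (F k))) ^+ 2)%:E)%E /\
          (\esum_(k in [set: int]) ((cnorm (inner f (F k))) ^+ 2)%:E <=
             beta%:E * norm2 f ^+ 2)%E].

Definition analysis F (f : R -> R[i]) : int -> R[i] := fun k => inner f (F k).

(* A representative of the sum of the c k * F k in L^2(R). *)
Definition synthesis F (c : int -> R[i]) : R -> R[i] :=
  xget (fun=> 0)
    [set g | L2 g /\
       cvgL2 (fun n x =>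
         \sum_(j < n.*2.+1) c (j%:Z - n%:Z) * F (j%:Z - n%:Z) x) g].

Definition op_norm_le (A : (R -> R[i]) -> R -> R[i]) (C : R) : Prop :=
  forall f, L2 f -> (norm2 (A f) <= C%:E * norm2 f)%E.

Definition approx_oblique_dual_frames W V F G (eps : R) : Prop :=
  [/\ frame_for W F, frame_for V G &
      op_norm_le (fun f => projection W (orthocompl V) f
                             \- synthesis F (analysis G f)) eps].

End Hilbert.

(* Main.v *)
Require Import Defs.
From mathcomp Require Import all_boot all_order all_algebra.
From mathcomp Require Import all_classical all_reals all_analysis.
From mathcomp Require Import measurable_realfun zify ring lra.
Set Implicit Arguments.
Unset Strict Implicit.
Unset Printing Implicit Defensive.
Import Order.TTheory GRing.Theory Num.Theory.
Import numFieldNormedType.Exports.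
Local Open Scope classical_set_scope.
Local Open Scope ring_scope.

(* The Fourier transform turns a combination of the translates [T_k phi] into
   [m * phihat], where [m] is a trigonometric polynomial of period 1, and its
   squared norm into [int_0^1 |m|^2 Phi].  The frame coefficients with respect to
   [T_k phit] are the Fourier coefficients of [m B], where [B] is the bracket of
   [phihat] and [phithat], that is [conj Ht] times the bracket of [phihat] and
   [phi1hat].  The upper frame bounds make [Phi] and [B] essentially bounded, so
   the synthesis converges to the function of symbol [m B] and the hypothesis
   reads [int_0^1 |m|^2 (eps^2 - |1 - B|^2) Phi >= 0] for every [m].  Since squares
   of trigonometric polynomials converge boundedly to indicators of arcs, the
   Lebesgue differentiation theorem gives [(eps^2 - |1 - B|^2) Phi >= 0] almost
   everywhere.

   The same test on squares gives the completeness of the exponentials, hence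
   Parseval's identity on any period.  Plancherel's theorem follows from it: for
   [u] supported in an interval of length [L], the sum over [k] of
   [|uhat (xi + k / L)|^2] is [L |u|^2] for every [xi], and integrating over an
   interval of length [1 / L] gives [|uhat|^2 = |u|^2]. *)

(** * Complex numbers and integrals *)

Section ComplexScalars.
Context {R : realType}.
Implicit Types (z w : R[i]) (a b t : R).
Local Notation Re := (@complex.Re R).
Local Notation Im := (@complex.Im R).

(** A priori [Phi] and the bracket are only integrable over a period, so the product [m B] need not
    be square integrable and its Fourier series need not converge in the mean. The upper frame
    bounds repair this, provided that recovering a function from square summable coefficients
    assumes nothing beyond integrability. Once [B] is bounded, [m B] has a convergent Fourier series
    on the period; once [Phi] is bounded, that convergence survives the weight [Phi] and so becomes
    convergence in L^2(R).

    Trigonometric polynomials serve as test symbols because the corresponding elements of [W] are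
    finite combinations of translates, obtained without any limit. The polynomials (1 - x^n)^(2^n)
    that approximate indicators are those of the Brosowski-Deutsch proof of the Stone-Weierstrass
    theorem.

    The transform, the projection and the synthesis are chosen representatives with a default value.
    Each must be shown to exist at the function considered before the hypothesis on the operator
    norm says anything about it. *)

Definition sqn z : R := Re z ^+ 2 + Im z ^+ 2.

Lemma complexP z w : Re z = Re w -> Im z = Im w -> z = w.
Proof. by case: z w => [a b] [c d] /= -> ->. Qed.

Lemma ReD z w : Re (z + w) = Re z + Re w. Proof. by case: z w => [a b] [c d]. Qed.
Lemma ImD z w : Im (z + w) = Im z + Im w. Proof. by case: z w => [a b] [c d]. Qed.
Lemma ReN z : Re (- z) = - Re z. Proof. by case: z. Qed.
Lemma ImN z : Im (- z) = - Im z. Proof. by case: z. Qed.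
Lemma ReM z w : Re (z * w) = Re z * Re w - Im z * Im w.
Proof. by case: z w => [a b] [c d]. Qed.
Lemma ImM z w : Im (z * w) = Re z * Im w + Im z * Re w.
Proof. by case: z w => [a b] [c d]. Qed.
Lemma ReZ t z : Re (t%:C%C * z) = t * Re z.
Proof. by rewrite ReM /= mul0r subr0. Qed.
Lemma ImZ t z : Im (t%:C%C * z) = t * Im z.
Proof. by rewrite ImM /= mul0r addr0. Qed.
Lemma ReJ z : Re (conjc z) = Re z. Proof. by case: z. Qed.
Lemma ImJ z : Im (conjc z) = - Im z. Proof. by case: z. Qed.
Lemma Re0 : Re 0 = 0. Proof. by []. Qed.
Lemma Im0 : Im 0 = 0. Proof. by []. Qed.
Lemma Re1 : Re 1 = 1. Proof. by []. Qed.
Lemma Im1 : Im 1 = 0. Proof. by []. Qed.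
Definition cE := (ReD, ImD, ReN, ImN, ReM, ImM, ReJ, ImJ, Re0, Im0, Re1, Im1).

Lemma conjcD z w : conjc (z + w) = conjc z + conjc w.
Proof. exact: rmorphD. Qed.
Lemma conjcM z w : conjc (z * w) = conjc z * conjc w.
Proof. exact: rmorphM. Qed.
Lemma conjc_sum I (s : seq I) (P : pred I) (F : I -> R[i]) :
  conjc (\sum_(i <- s | P i) F i) = \sum_(i <- s | P i) conjc (F i).
Proof. exact: rmorph_sum. Qed.

Lemma sqn_ge0 z : 0 <= sqn z. Proof. by rewrite addr_ge0 ?sqr_ge0. Qed.
Lemma sqnM z w : sqn (z * w) = sqn z * sqn w.
Proof. by rewrite /sqn !cE; ring. Qed.
Lemma sqnJ z : sqn (conjc z) = sqn z.
Proof. by rewrite /sqn !cE sqrrN. Qed.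
Lemma sqnN z : sqn (- z) = sqn z.
Proof. by rewrite /sqn !cE !sqrrN. Qed.
Lemma sqn0 : sqn 0 = 0. Proof. by rewrite /sqn !cE; ring. Qed.
Lemma sqn1 : sqn 1 = 1. Proof. by rewrite /sqn !cE; ring. Qed.
Lemma sqn_eq0 z : sqn z = 0 -> z = 0.
Proof.
move/eqP; rewrite paddr_eq0 ?sqr_ge0// !sqrf_eq0 => /andP[/eqP zr /eqP zi].
exact: complexP.
Qed.
Lemma mulJ_sqn z : z * conjc z = (sqn z)%:C%C.
Proof. by apply: complexP; rewrite /sqn !cE /=; ring. Qed.
Lemma sqnD_le z w : sqn (z + w) <= 2 * sqn z + 2 * sqn w.
Proof.
rewrite /sqn !cE.
have := sqr_ge0 (Re z - Re w); have := sqr_ge0 (Im z - Im w); nra.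
Qed.
Lemma ReE_le z : Re z ^+ 2 <= sqn z. Proof. by rewrite lerDl sqr_ge0. Qed.
Lemma ImE_le z : Im z ^+ 2 <= sqn z. Proof. by rewrite lerDr sqr_ge0. Qed.

Lemma cnormE z : cnorm z = Num.sqrt (sqn z). Proof. by case: z. Qed.
Lemma cnorm_ge0 z : 0 <= cnorm z. Proof. by rewrite cnormE sqrtr_ge0. Qed.
Lemma cnorm_sqr z : cnorm z ^+ 2 = sqn z.
Proof. by rewrite cnormE sqr_sqrtr// sqn_ge0. Qed.

Lemma sqn_cexp t : sqn (cexp t) = 1.
Proof. by rewrite /sqn /= cos2Dsin2. Qed.
Lemma cexpD s t : cexp (s + t) = cexp s * cexp t :> R[i].
Proof. by apply: complexP; rewrite !cE /= ?cosD ?sinD; ring. Qed.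
Lemma cexpN t : cexp (- t) = conjc (cexp t) :> R[i].
Proof. by apply: complexP; rewrite !cE /= ?cosN ?sinN. Qed.
Lemma cexp0 : cexp 0 = 1 :> R[i].
Proof. by apply: complexP; rewrite /= ?cos0 ?sin0. Qed.

Lemma cexp_2piz (k : int) : cexp (2 * pi * k%:~R) = 1 :> R[i].
Proof.
have nat_case (n : nat) : cexp (2 * pi * n%:R) = 1 :> R[i].
  elim: n => [|n IH]; first by rewrite mulr0 cexp0.
  rewrite -(natr1 n) mulrDr mulr1 cexpD IH mul1r.
  apply: complexP => /=; rewrite mulr_natl ?cos2pi// -[pi *+ 2]add0r.
  by rewrite mulr2n addrA sinDpi sinDpi sin0 opprK.
case: (intP k) => [|n|n]; first exact: (nat_case 0%N).
  exact: nat_case.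
by rewrite mulrNz mulrN cexpN nat_case conjc1.
Qed.

End ComplexScalars.

(** * Integrals of real functions over the line *)

Section RealIntegrals.
Context {R : realType}.
Local Notation mu := (@lebesgue_measure R).
Implicit Types (f g h : R -> R).

Lemma ae_imp (P Q : R -> Prop) : (forall x, P x -> Q x) ->
  {ae mu, forall x, P x} -> {ae mu, forall x, Q x}.
Proof. by move=> PQ; apply: filterS => //; exact: (ae_filter_ringOfSetsType mu). Qed.

Lemma ae_and (P Q : R -> Prop) : {ae mu, forall x, P x} ->
  {ae mu, forall x, Q x} -> {ae mu, forall x, P x /\ Q x}.
Proof. by apply: filterS2 => //; exact: (ae_filter_ringOfSetsType mu). Qed.

Lemma ae_all (P : R -> Prop) : (forall x, P x) -> {ae mu, forall x, P x}.
Proof. by move=> aP; exact: aeW. Qed.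

Definition rint f := mu.-integrable setT (EFin \o f).
Definition Rint f : R := \int[mu]_(x in setT) f x.

Lemma rint_meas f : rint f -> measurable_fun setT f.
Proof. by move=> /measurable_int/measurable_EFinP. Qed.

Lemma rintD f g : rint f -> rint g -> rint (fun x => f x + g x).
Proof. by move=> rf rg; exact: (integrableD measurableT rf rg). Qed.

Lemma rintZ a f : rint f -> rint (fun x => a * f x).
Proof. by move=> rf; apply: (integrableZl measurableT a rf). Qed.

Lemma rintN f : rint f -> rint (fun x => - f x).
Proof. by move=> /(rintZ (-1)); under eq_fun do rewrite mulN1r. Qed.

Lemma rintB f g : rint f -> rint g -> rint (fun x => f x - g x).
Proof. by move=> rf rg; apply/rintD/rintN. Qed.

Lemma rint0 : rint (fun=> 0).
Proof. exact: integrable0. Qed.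

Lemma rint_sum I (s : seq I) (P : pred I) (F : I -> R -> R) :
  (forall i, P i -> rint (F i)) -> rint (fun x => \sum_(i <- s | P i) F i x).
Proof.
move=> rF; elim: s => [|i s IH].
  by under eq_fun do rewrite big_nil; exact: rint0.
have -> : (fun x => \sum_(j <- i :: s | P j) F j x) = (fun x =>
    if P i then F i x + \sum_(j <- s | P j) F j x
    else \sum_(j <- s | P j) F j x).
  by apply/funext => x; rewrite big_cons.
by case Pi: (P i) => //; apply: rintD => //; apply: rF.
Qed.

Lemma rint_le f g : measurable_fun setT f -> rint g ->
  (forall x, `|f x| <= g x) -> rint f.
Proof.
move=> mf rg fg; apply: (le_integrable _ _ _ rg) => //.
- exact/measurable_EFinP.
- move=> x _ /=; rewrite lee_fin (le_trans (fg x))//.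
  by rewrite ler_norm.
Qed.

Lemma rint_norm f : rint f -> rint (fun x => `|f x|).
Proof. by move=> rf; apply: integrable_norm. Qed.

Lemma rint_bM C h f : measurable_fun setT h -> (forall x, `|h x| <= C) ->
  rint f -> rint (fun x => h x * f x).
Proof.
move=> mh hC rf.
apply: (@rint_le _ (fun x => C * `|f x|)).
- by apply: measurable_funM => //; exact: rint_meas.
- exact/rintZ/rint_norm.
- by move=> x; rewrite normrM ler_wpM2r.
Qed.

Lemma RintD f g : rint f -> rint g ->
  Rint (fun x => f x + g x) = Rint f + Rint g.
Proof. by move=> rf rg; apply: RintegralD. Qed.

Lemma RintZ a f : rint f -> Rint (fun x => a * f x) = a * Rint f.
Proof. by move=> rf; apply: RintegralZl. Qed.

Lemma RintN f : rint f -> Rint (fun x => - f x) = - Rint f.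
Proof.
by move=> /(RintZ (-1)); rewrite mulN1r; under eq_fun do rewrite mulN1r.
Qed.

Lemma RintB f g : rint f -> rint g ->
  Rint (fun x => f x - g x) = Rint f - Rint g.
Proof. by move=> rf rg; apply: RintegralB. Qed.

Lemma Rint0 : Rint (fun=> 0) = 0.
Proof. by rewrite /Rint Rintegral_cst// mul0r. Qed.

Lemma Rint_sum I (s : seq I) (P : pred I) (F : I -> R -> R) :
  (forall i, P i -> rint (F i)) ->
  Rint (fun x => \sum_(i <- s | P i) F i x) = \sum_(i <- s | P i) Rint (F i).
Proof.
move=> rF; elim: s => [|i s IH].
  by under eq_fun do rewrite big_nil; rewrite Rint0 big_nil.
rewrite big_cons.
have -> : (fun x => \sum_(j <- i :: s | P j) F j x) = (fun x =>
    if P i then F i x + \sum_(j <- s | P j) F j x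
    else \sum_(j <- s | P j) F j x).
  by apply/funext => x; rewrite big_cons.
by case Pi: (P i) => //; rewrite RintD ?IH//; [exact: rF|exact: rint_sum].
Qed.

Lemma le_Rint f g : rint f -> rint g -> (forall x, f x <= g x) ->
  Rint f <= Rint g.
Proof. by move=> rf rg fg; apply: le_Rintegral. Qed.

Lemma Rint_ge0 f : (forall x, 0 <= f x) -> 0 <= Rint f.
Proof. by move=> f0; apply: Rintegral_ge0. Qed.

Lemma RintE f : rint f -> (Rint f)%:E = (\int[mu]_x (f x)%:E)%E.
Proof. by move=> rf; rewrite /Rint /Rintegral fineK// integrable_fin_num. Qed.

Lemma ae_eq_rint f g : {ae mu, forall x, f x = g x} -> measurable_fun setT g ->
  rint f -> rint g.
Proof.
move=> fg mg rf; have mf := rint_meas rf.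
apply/integrableP; split; first exact/measurable_EFinP.
move/integrableP: rf => [_] /=.
suff -> : (\int[mu]_x `|(f x)%:E| = \int[mu]_x `|(g x)%:E|)%E by [].
apply: ae_eq_integral => //.
- by apply/measurable_EFinP/measurableT_comp.
- by apply/measurable_EFinP/measurableT_comp.
- by move: fg; apply: ae_imp => x fgx _ /=; rewrite fgx.
Qed.

Lemma ae_eq_Rint f g : {ae mu, forall x, f x = g x} -> measurable_fun setT g ->
  measurable_fun setT f -> Rint f = Rint g.
Proof.
move=> fg mg mf; congr fine; apply: ae_eq_integral => //.
- exact/measurable_EFinP.
- exact/measurable_EFinP.
- by move: fg; apply: ae_imp => x fgx _; rewrite fgx.
Qed.

Lemma ge0_rint f : measurable_fun setT f -> (forall x, 0 <= f x) ->
  (\int[mu]_x (f x)%:E < +oo)%E -> rint f.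
Proof.
move=> mf f0 fi; apply/integrableP; split; first exact/measurable_EFinP.
by under eq_integral => x _ do rewrite /= ger0_norm//.
Qed.

Lemma rint_lty f : rint f -> (\int[mu]_x (f x)%:E < +oo)%E.
Proof. by move=> rf; rewrite -RintE// ltry. Qed.

Lemma dominated_Rint (u : nat -> R -> R) f g :
  (forall n, rint (u n)) -> measurable_fun setT f ->
  {ae mu, forall x, u n x @[n --> \oo] --> f x} ->
  rint g -> {ae mu, forall x n, `|u n x| <= g x} ->
  rint f /\ Rint (u n) @[n --> \oo] --> Rint f.
Proof.
move=> ru mf uf rg ug.
have [] := @dominated_convergence _ _ _ mu setT measurableT
  (fun n => EFin \o u n) (EFin \o f) (EFin \o g).
- by move=> n; apply/measurable_EFinP; exact: rint_meas.
- by apply/measurable_EFinP; exact: mf.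
- by move: uf; apply: ae_imp => x ux _; apply: cvg_EFin => //; exact: nearW.
- exact: rg.
- by move: ug; apply: ae_imp => x ugx n _; rewrite lee_fin.
move=> rf _ cv; split => //.
have : EFin (Rint (u n)) @[n --> \oo] --> (Rint f)%:E.
  by rewrite RintE//; under eq_fun do rewrite RintE//.
by move=> /fine_cvg.
Qed.

End RealIntegrals.

(** * Square-integrable complex functions and their inner product *)

Section ComplexL2.
Context {R : realType}.
Local Notation mu := (@lebesgue_measure R).
Local Notation Re := (@complex.Re R).
Local Notation Im := (@complex.Im R).
Implicit Types (f g h : R -> R[i]) (a : R[i]).

Lemma rmeasN (f : R -> R) : measurable_fun setT f ->
  measurable_fun setT (fun x => - f x).
Proof. by move=> mf; exact: (measurableT_comp (@oppr_measurable R setT) mf). Qed.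

Definition cmeas f := measurable_fun setT (Re \o f) /\ measurable_fun setT (Im \o f).
Definition cint f := rint (Re \o f) /\ rint (Im \o f).
(** A real squared norm avoids the square root and the extended reals of [norm2]. An infinite
    integral is sent to 0 here, hence the [L2] side conditions throughout. *)
Definition nsq f : R := Rint (fun x => sqn (f x)).

Lemma L1E f : L1 f <-> cint f.
Proof. by split=> -[/Lfun1_integrable ? /Lfun1_integrable ?]. Qed.

Lemma Lfun2E (f : R -> R) : (f \in Lfun mu 2%:E) <->
  measurable_fun setT f /\ rint (fun x => f x ^+ 2).
Proof.
split=> [f2|[mf rf]].
  split; last exact: Lfun2_integrable_sqr.
  by move: f2; rewrite inE => /andP[/[!inE]].
rewrite inE; apply/andP; split; rewrite inE//=.
rewrite /finite_norm unlock /Lnorm poweR_lty//.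
under eq_integral => x _ do rewrite /= powR_mulrn// -normrX ger0_norm ?sqr_ge0//.
exact: rint_lty.
Qed.

Lemma measurable_sqn f : cmeas f -> measurable_fun setT (fun x => sqn (f x)).
Proof. by move=> [mr mi]; apply: measurable_funD; exact: measurable_funX. Qed.

Lemma L2E f : L2 f <-> cmeas f /\ rint (fun x => sqn (f x)).
Proof.
split=> [[/Lfun2E[mr rr] /Lfun2E[mi ri]]|[mf rf]].
  by split; [split|exact: rintD].
have [mr mi] := mf.
split; apply/Lfun2E; split=> //; apply: rint_le rf _ => [|x].
- exact: measurable_funX.
- by rewrite ger0_norm ?sqr_ge0//; exact: ReE_le.
- exact: measurable_funX.
- by rewrite ger0_norm ?sqr_ge0//; exact: ImE_le.
Qed.

Lemma L2_meas f : L2 f -> cmeas f. Proof. by case/L2E. Qed.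
Lemma L2_rint f : L2 f -> rint (fun x => sqn (f x)). Proof. by case/L2E. Qed.
Lemma cint_meas f : cint f -> cmeas f.
Proof. by move=> [/rint_meas ? /rint_meas ?]. Qed.

Lemma nsq_ge0 f : 0 <= nsq f.
Proof. by apply: Rint_ge0 => x; exact: sqn_ge0. Qed.

Lemma norm2E f : L2 f -> norm2 f = (Num.sqrt (nsq f))%:E.
Proof.
move=> /L2_rint rf; rewrite /norm2 unlock /Lnorm.
have E x : (`|(cnorm (f x))%:E| `^ 2 = (sqn (f x))%:E)%E.
  by rewrite /= ger0_norm ?cnorm_ge0// powR_mulrn ?cnorm_ge0// cnorm_sqr.
under eq_integral => x _ do rewrite E.
by rewrite -RintE//= powR12_sqrt// nsq_ge0.
Qed.

Lemma cmeas0 : cmeas (fun=> 0). Proof. by split; exact: measurable_cst. Qed.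

Lemma cmeas_cst a : cmeas (fun=> a). Proof. by split; exact: measurable_cst. Qed.

Lemma cmeasD f g : cmeas f -> cmeas g -> cmeas (fun x => f x + g x).
Proof.
move=> [? ?] [? ?]; split; rewrite /comp; under eq_fun do rewrite cE;
  exact: measurable_funD.
Qed.

Lemma cmeasM f g : cmeas f -> cmeas g -> cmeas (fun x => f x * g x).
Proof.
move=> [? ?] [? ?]; split; rewrite /comp; under eq_fun do rewrite cE.
  by apply: measurable_funB; exact: measurable_funM.
by apply: measurable_funD; exact: measurable_funM.
Qed.

Lemma cmeasJ f : cmeas f -> cmeas (fun x => conjc (f x)).
Proof.
move=> [? ?]; split; rewrite /comp; under eq_fun do rewrite cE; [by []|exact: rmeasN].
Qed.

Lemma cmeasN f : cmeas f -> cmeas (fun x => - f x).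
Proof.
by move=> [? ?]; split; rewrite /comp; under eq_fun do rewrite cE;
  exact: rmeasN.
Qed.

Lemma cmeasB f g : cmeas f -> cmeas g -> cmeas (fun x => f x - g x).
Proof. by move=> ? /cmeasN; exact: cmeasD. Qed.

Lemma cintD f g : cint f -> cint g -> cint (fun x => f x + g x).
Proof.
by move=> [? ?] [? ?]; split; rewrite /comp; under eq_fun do rewrite cE;
  exact: rintD.
Qed.

Lemma cintZ a f : cint f -> cint (fun x => a * f x).
Proof.
move=> [? ?]; split; rewrite /comp; under eq_fun do rewrite cE.
  by apply: rintB; exact: rintZ.
by apply: rintD; exact: rintZ.
Qed.

Lemma cint0 : cint (fun=> 0). Proof. by split; exact: rint0. Qed.

Lemma cint_le f (g : R -> R) : cmeas f -> rint g ->
  (forall x, cnorm (f x) <= g x) -> cint f.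
Proof.
move=> [mr mi] rg fg; split; apply: (rint_le _ rg) => // x /=;
  apply: le_trans (fg x); rewrite -ler_sqr ?nnegrE ?cnorm_ge0 ?normr_ge0//
  cnorm_sqr real_normK ?num_real//; [exact: ReE_le|exact: ImE_le].
Qed.

Lemma cint_norm f : cint f -> rint (fun x => cnorm (f x)).
Proof.
move=> cf; have [rr ri] := cf; apply: (@rint_le _ _ (fun x => `|Re (f x)| + `|Im (f x)|)).
- apply: (eq_measurable_fun (fun x => Num.sqrt (sqn (f x)))).
    by move=> x _; rewrite cnormE.
  have ms := continuous_measurable_fun (@sqrt_continuous R).
  exact: (measurableT_comp ms (measurable_sqn (cint_meas cf))).
- by apply: rintD; exact: rint_norm.
move=> x; rewrite ger0_norm ?cnorm_ge0//.
rewrite -ler_sqr ?nnegrE ?cnorm_ge0 ?addr_ge0// cnorm_sqr /sqn.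
rewrite sqrrD !real_normK ?num_real// lerD2r lerDl.
by rewrite mulrn_wge0// mulr_ge0.
Qed.

Lemma cint_bM C h f : cmeas h -> (forall x, sqn (h x) <= C) ->
  cint f -> cint (fun x => h x * f x).
Proof.
move=> mh hC cf; apply: (@cint_le _ (fun x => Num.sqrt C * cnorm (f x))).
- by apply: cmeasM => //; exact: cint_meas.
- exact/rintZ/cint_norm.
move=> x; rewrite !cnormE sqnM sqrtrM ?sqn_ge0// ler_wpM2r ?sqrtr_ge0//.
exact: ler_wsqrtr.
Qed.

Lemma cintegralD f g : cint f -> cint g ->
  cintegral (fun x => f x + g x) = cintegral f + cintegral g.
Proof.
move=> [? ?] [? ?]; apply: complexP; rewrite cE /=.
  by rewrite -RintD//; congr Rint; apply/funext => x; rewrite cE.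
by rewrite -RintD//; congr Rint; apply/funext => x; rewrite cE.
Qed.

Lemma cintegralZ a f : cint f ->
  cintegral (fun x => a * f x) = a * cintegral f.
Proof.
move=> [? ?]; apply: complexP; rewrite cE /=.
  rewrite -!RintZ// -RintB; [|exact: rintZ|exact: rintZ].
  by congr Rint; apply/funext => x; rewrite cE.
rewrite -!RintZ// -RintD; [|exact: rintZ|exact: rintZ].
by congr Rint; apply/funext => x; rewrite cE.
Qed.

Lemma cintegralJ f : cint f ->
  cintegral (fun x => conjc (f x)) = conjc (cintegral f).
Proof.
move=> [? ?]; apply: complexP; rewrite cE /=.
  by congr Rint; apply/funext => x; rewrite cE.
by rewrite -RintN//; congr Rint; apply/funext => x; rewrite cE.
Qed.

Lemma cintegral0 : cintegral (fun=> 0) = 0 :> R[i].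
Proof. by apply: complexP; exact: Rint0. Qed.

Lemma cintegral_real (f : R -> R) : cintegral (fun x => (f x)%:C%C) = (Rint f)%:C%C.
Proof. by apply: complexP => //=; exact: Rint0. Qed.

Lemma ae_eq_cintegral f g : {ae mu, forall x, f x = g x} -> cmeas f -> cmeas g ->
  cintegral f = cintegral g.
Proof.
move=> fg [mr mi] [mr' mi'].
by apply: complexP; apply: ae_eq_Rint => //; apply: ae_imp fg => x /= ->.
Qed.

Lemma ae_eq_L2 f g : {ae mu, forall x, f x = g x} -> cmeas g -> L2 f -> L2 g.
Proof.
move=> fg mg /L2E[mf rf]; apply/L2E; split=> //.
apply: ae_eq_rint _ (measurable_sqn mg) rf.
by apply: ae_imp fg => x /= ->.
Qed.

Lemma ae_eq_nsq f g : {ae mu, forall x, f x = g x} -> cmeas f -> cmeas g ->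
  nsq f = nsq g.
Proof.
move=> fg mf mg; apply: ae_eq_Rint (measurable_sqn mg) (measurable_sqn mf).
by apply: ae_imp fg => x /= ->.
Qed.

Lemma L2_0 : L2 (fun=> 0 : R[i]).
Proof.
apply/L2E; split; first exact: cmeas0.
by under eq_fun do rewrite sqn0; exact: rint0.
Qed.

Lemma L2D f g : L2 f -> L2 g -> L2 (fun x => f x + g x).
Proof.
move=> /L2E[mf rf] /L2E[mg rg]; apply/L2E; split; first exact: cmeasD.
apply: (@rint_le _ _ (fun x => 2 * sqn (f x) + 2 * sqn (g x))).
- exact: (measurable_sqn (cmeasD mf mg)).
- by apply: rintD; exact: rintZ.
by move=> x; rewrite ger0_norm ?sqn_ge0//; exact: sqnD_le.
Qed.

Lemma L2_bM C h f : cmeas h -> (forall x, sqn (h x) <= C) ->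
  L2 f -> L2 (fun x => h x * f x).
Proof.
move=> mh hC /L2E[mf rf]; apply/L2E; split; first exact: cmeasM.
apply: (rint_le (measurable_sqn (cmeasM mh mf)) (rintZ C rf)).
by move=> x; rewrite sqnM ger0_norm ?mulr_ge0 ?sqn_ge0// ler_wpM2r ?sqn_ge0.
Qed.

Lemma L2Z a f : L2 f -> L2 (fun x => a * f x).
Proof. by apply: (@L2_bM (sqn a)) => //; exact: cmeas_cst. Qed.

Lemma L2N f : L2 f -> L2 (fun x => - f x).
Proof. by move=> /(L2Z (-1)); under eq_fun do rewrite mulN1r. Qed.

Lemma L2B f g : L2 f -> L2 g -> L2 (fun x => f x - g x).
Proof. by move=> ? /L2N; exact: L2D. Qed.

Lemma L2_sum I (s : seq I) (P : pred I) (F : I -> R -> R[i]) :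
  (forall i, P i -> L2 (F i)) -> L2 (fun x => \sum_(i <- s | P i) F i x).
Proof.
move=> rF; elim: s => [|i s IH].
  by under eq_fun do rewrite big_nil; exact: L2_0.
under eq_fun do rewrite big_cons.
by case Pi : (P i) => //; apply: L2D => //; apply: rF.
Qed.

Lemma L2_cintM f g : L2 f -> L2 g -> cint (fun x => f x * g x).
Proof.
move=> /L2E[mf rf] /L2E[mg rg].
apply: (@cint_le _ (fun x => sqn (f x) + sqn (g x))); first exact: cmeasM.
  exact: rintD.
move=> x; rewrite cnormE sqnM sqrtrM ?sqn_ge0//.
have := sqr_ge0 (Num.sqrt (sqn (f x)) - Num.sqrt (sqn (g x))).
rewrite sqrrB !sqr_sqrtr ?sqn_ge0//.
have : 0 <= Num.sqrt (sqn (f x)) * Num.sqrt (sqn (g x)).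
  by rewrite mulr_ge0// sqrtr_ge0.
lra.
Qed.

Lemma L2J f : L2 f -> L2 (fun x => conjc (f x)).
Proof.
move=> /L2E[mf rf]; apply/L2E; split; first exact: cmeasJ.
by under eq_fun do rewrite sqnJ.
Qed.

Lemma L2_cint f g : L2 f -> L2 g -> cint (fun x => f x * conjc (g x)).
Proof. by move=> ? /L2J; exact: L2_cintM. Qed.

Lemma innerDl f g h : L2 f -> L2 g -> L2 h ->
  inner (fun x => f x + g x) h = inner f h + inner g h.
Proof.
move=> ? ? ?; rewrite /inner -cintegralD; try exact: L2_cint.
by congr cintegral; apply/funext => x; rewrite mulrDl.
Qed.

Lemma innerZl a f h : L2 f -> L2 h ->
  inner (fun x => a * f x) h = a * inner f h.
Proof.
move=> ? ?; rewrite /inner -cintegralZ; last exact: L2_cint.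
by congr cintegral; apply/funext => x; rewrite mulrA.
Qed.

Lemma innerC f g : L2 f -> L2 g -> inner g f = conjc (inner f g).
Proof.
move=> ? ?; rewrite /inner -cintegralJ; last exact: L2_cint.
by congr cintegral; apply/funext => x; rewrite conjcM conjcK mulrC.
Qed.

Lemma innerDr f g h : L2 f -> L2 g -> L2 h ->
  inner h (fun x => f x + g x) = inner h f + inner h g.
Proof.
move=> ? ? ?; rewrite innerC//; last exact: L2D.
by rewrite innerDl// conjcD -!innerC.
Qed.

Lemma innerZr a f h : L2 f -> L2 h ->
  inner h (fun x => a * f x) = conjc a * inner h f.
Proof.
move=> ? ?; rewrite innerC//; last exact: L2Z.
by rewrite innerZl// conjcM -innerC.
Qed.

Lemma innerBl f g h : L2 f -> L2 g -> L2 h ->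
  inner (fun x => f x - g x) h = inner f h - inner g h.
Proof.
move=> ? ? ?; rewrite innerDl//; last exact: L2N.
rewrite -[inner (fun x => - g x) h]/(inner (fun x => - g x) h).
have -> : (fun x => - g x) = (fun x => -1 * g x) by apply/funext => x; rewrite mulN1r.
by rewrite innerZl// mulN1r.
Qed.

Lemma inner_sumr I (s : seq I) (P : pred I) (F : I -> R -> R[i]) h :
  (forall i, P i -> L2 (F i)) -> L2 h ->
  inner h (fun x => \sum_(i <- s | P i) F i x) =
  \sum_(i <- s | P i) inner h (F i).
Proof.
move=> LF Lh; elim: s => [|i s IH].
  under eq_fun do rewrite big_nil; rewrite big_nil /inner.
  by under eq_fun do rewrite conjc0 mulr0; rewrite cintegral0.
under eq_fun do rewrite big_cons; rewrite big_cons -IH.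
case Pi : (P i) => //; rewrite innerDr//; first exact: LF.
exact: L2_sum.
Qed.

Lemma inner_suml I (s : seq I) (P : pred I) (F : I -> R -> R[i]) h :
  (forall i, P i -> L2 (F i)) -> L2 h ->
  inner (fun x => \sum_(i <- s | P i) F i x) h =
  \sum_(i <- s | P i) inner (F i) h.
Proof.
move=> LF Lh; rewrite innerC//; last exact: L2_sum.
rewrite inner_sumr// conjc_sum; apply: eq_bigr => i Pi.
by rewrite -innerC//; exact: LF.
Qed.

Lemma inner_self f : inner f f = (nsq f)%:C%C.
Proof.
rewrite -cintegral_real /inner; congr cintegral.
by apply/funext => x; rewrite mulJ_sqn.
Qed.

Lemma nsqE f : nsq f = Re (inner f f). Proof. by rewrite inner_self. Qed.

Lemma nsqZ a f : L2 f -> nsq (fun x => a * f x) = sqn a * nsq f.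
Proof.
by move=> /L2_rint rf; rewrite /nsq -RintZ//; under eq_fun do rewrite sqnM.
Qed.

Lemma nsqN f : nsq (fun x => - f x) = nsq f.
Proof. by rewrite /nsq; under eq_fun do rewrite sqnN. Qed.

Lemma nsq_distC f g : nsq (fun x => f x - g x) = nsq (fun x => g x - f x).
Proof. by rewrite -nsqN; congr nsq; apply/funext => x; rewrite opprB. Qed.

Lemma nsqD f g : L2 f -> L2 g ->
  nsq (fun x => f x + g x) = nsq f + nsq g + 2 * Re (inner f g).
Proof.
move=> Lf Lg; have LD := L2D Lf Lg.
rewrite !nsqE innerDl// !innerDr// [inner g f]innerC// !cE; ring.
Qed.

Lemma nsqB f g : L2 f -> L2 g ->
  nsq (fun x => f x - g x) = nsq f + nsq g - 2 * Re (inner f g).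
Proof.
move=> Lf Lg; rewrite nsqD//; last exact: L2N.
rewrite nsqN; have -> : (fun x => - g x) = (fun x => -1 * g x).
  by apply/funext => x; rewrite mulN1r.
by rewrite innerZr// !cE; ring.
Qed.

Lemma nsqD_le f g : L2 f -> L2 g ->
  nsq (fun x => f x + g x) <= 2 * nsq f + 2 * nsq g.
Proof.
move=> Lf Lg; have := nsq_ge0 (fun x => f x - g x).
by rewrite nsqB// nsqD//; lra.
Qed.

Lemma Re_inner_sqr_le f g : L2 f -> L2 g ->
  Re (inner f g) ^+ 2 <= nsq f * nsq g.
Proof.
move=> Lf Lg; set b := Re _.
have key t : 0 <= nsq f + t ^+ 2 * nsq g - 2 * (t * b).
  have := nsq_ge0 (fun x => f x - (t%:C%C : R[i]) * g x).
  rewrite nsqB//; last exact: L2Z.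
  rewrite nsqZ// innerZr// !cE /= -/b /sqn /=.
  by rewrite expr0n addr0 oppr0 mul0r subr0.
have g0 := nsq_ge0 g; have [g0'|] := eqVneq (nsq g) 0.
  have [->|b0] := eqVneq b 0; first by rewrite g0' mulr0 expr0n.
  (* With [nsq g = 0] the expression in [key] is affine in t; this t makes it equal to -1. *)
  have := key ((nsq f + 1) / (2 * b)); rewrite g0' mulr0 addr0.
  have -> : nsq f - 2 * ((nsq f + 1) / (2 * b) * b) = -1 by field.
  by rewrite ler0N1.
move=> gn0; have gp : 0 < nsq g by rewrite lt_neqAle eq_sym gn0.
(* The minimiser of the quadratic polynomial in t. *)
have := key (b / nsq g).
have -> : nsq f + (b / nsq g) ^+ 2 * nsq g - 2 * (b / nsq g * b) =
  (nsq f * nsq g - b ^+ 2) / nsq g by field.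
by rewrite pmulr_lge0 ?invr_gt0// subr_ge0.
Qed.

(** Rotating [g] by [z = inner f g] makes the inner product real and equal to [sqn z], so the bound
    on real parts gives the bound on the modulus, after cancelling one factor [sqn z]. *)
Lemma CauchySchwarz f g : L2 f -> L2 g -> sqn (inner f g) <= nsq f * nsq g.
Proof.
move=> Lf Lg; set z := inner f g.
have := Re_inner_sqr_le Lf (L2Z z Lg).
rewrite innerZr// nsqZ// -/z mulrC mulJ_sqn /=.
have := sqn_ge0 z; have [->|z0] := eqVneq (sqn z) 0.
  by rewrite mulr_ge0// nsq_ge0.
move=> z0'; have zp : 0 < sqn z by rewrite lt_neqAle eq_sym z0.
by rewrite mulrCA expr2 ler_pM2l.
Qed.

Lemma inner_cvg (u : nat -> R -> R[i]) f g : (forall n, L2 (u n)) -> L2 f -> L2 g ->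
  nsq (fun x => u n x - f x) @[n --> \oo] --> 0 ->
  sqn (inner (u n) g - inner f g) @[n --> \oo] --> 0.
Proof.
move=> Lu Lf Lg uf.
apply: (@squeeze_cvgr _ _ _ _ (fun=> 0) (fun n => nsq (fun x => u n x - f x) * nsq g)).
- apply: nearW => n; rewrite sqn_ge0/= -innerBl//.
  by apply: CauchySchwarz => //; exact: L2B.
- exact: cvg_cst.
- by rewrite -[X in _ --> X](mul0r (nsq g)); apply: cvgMl.
Qed.

Lemma nsq_cvg (u : nat -> R -> R[i]) f : (forall n, L2 (u n)) -> L2 f ->
  nsq (fun x => u n x - f x) @[n --> \oo] --> 0 ->
  nsq (u n) @[n --> \oo] --> nsq f.
Proof.
move=> Lu Lf uf; pose d n x := u n x - f x.
have Ld n : L2 (d n) by exact: L2B.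
have E n : nsq (u n) = nsq f + (nsq (d n) + 2 * Re (inner (d n) f)).
  have -> : u n = (fun x => d n x + f x) by apply/funext => x; rewrite subrK.
  by rewrite nsqD//; ring.
rewrite -[X in _ --> X]addr0; under eq_fun do rewrite E.
apply: cvgD; first exact: cvg_cst.
rewrite -[X in _ --> X]addr0; apply: cvgD; first exact: uf.
rewrite -[X in _ --> X](mulr0 2); apply: cvgMr.
apply/cvgr0Pnorm_lt => e e0.
(* Adding 1 keeps the divisor positive when [nsq f] vanishes. *)
have f0 := nsq_ge0 f; have f1 : 0 < nsq f + 1 by rewrite ltr_wpDl.
have e1 : 0 < e ^+ 2 / (nsq f + 1) by rewrite divr_gt0// exprn_gt0.
near=> n.
have le : Re (inner (d n) f) ^+ 2 <= nsq (d n) * nsq f by exact: Re_inner_sqr_le.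
rewrite -ltr_sqr ?nnegrE ?normr_ge0 ?(ltW e0)// real_normK ?num_real//.
apply: le_lt_trans le _.
have : nsq (d n) < e ^+ 2 / (nsq f + 1).
  near: n; move/cvgr0Pnorm_lt : uf => /(_ (e ^+ 2 / (nsq f + 1))).
  move=> /(_ e1); apply: filterS => m; rewrite ger0_norm//; exact: nsq_ge0.
rewrite ltr_pdivlMr// => /le_lt_trans; apply.
by rewrite ler_wpM2l ?nsq_ge0// lerDl.
Unshelve. all: by end_near. Qed.

Lemma cvgL2E (u : nat -> R -> R[i]) f : (forall n, L2 (u n)) -> L2 f ->
  cvgL2 u f <-> nsq (fun x => u n x - f x) @[n --> \oo] --> 0.
Proof.
move=> Lu Lf; rewrite /cvgL2.
have E n : norm2 (u n \- f) = (Num.sqrt (nsq (fun x => u n x - f x)))%:E.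
  by rewrite norm2E//; exact: L2B.
under eq_fun do rewrite E.
split=> [/fine_cvg /= H|H].
  have -> : (fun n => nsq (fun x => u n x - f x)) = (fun n =>
      Num.sqrt (nsq (fun x => u n x - f x)) * Num.sqrt (nsq (fun x => u n x - f x))).
    by apply/funext => n; rewrite -expr2 sqr_sqrtr// nsq_ge0.
  by rewrite -[X in _ --> X](mulr0 0); apply: cvgM.
apply: cvg_EFin; first exact: nearW.
rewrite -[X in _ --> X]sqrtr0.
by apply: continuous_cvg => //; exact: sqrt_continuous.
Qed.

End ComplexL2.

(** * Riesz-Fischer *)

Section Limits.
Context {R : realType}.
Local Notation mu := (@lebesgue_measure R).

(** The sum taken in the extended reals has integral at most [C], hence is finite almost everywhere;
    [G] is its finite part, 0 where the series diverges. *)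
Lemma beppo_levi (g : nat -> R -> R) (C : R) : (forall n, rint (g n)) ->
  (forall n x, 0 <= g n x) -> (forall n, \sum_(i < n) Rint (g i) <= C) ->
  exists G : R -> R, [/\ rint G, forall x, 0 <= G x &
    {ae mu, forall x, \sum_(i < n) g i x @[n --> \oo] --> G x}].
Proof.
move=> rg g0 gC.
pose S x := (\sum_(0 <= i <oo) (g i x)%:E)%E.
have mS : measurable_fun setT S.
  apply: ge0_emeasurable_sum => [k x _ _|k _]; first by rewrite lee_fin.
  by apply/measurable_EFinP; exact: rint_meas.
have S0 x : (0 <= S x)%E by apply: nneseries_ge0 => n _ _; rewrite lee_fin.
have IS : (\int[mu]_x S x <= C%:E)%E.
  rewrite integral_nneseries//; last 2 first.
  - by move=> n; apply/measurable_EFinP; exact: rint_meas.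
  - by move=> n x _; rewrite lee_fin.
  apply: lime_le.
    by apply: is_cvg_nneseries => n _ _; apply: integral_ge0 => x _; rewrite lee_fin.
  apply: nearW => n; rewrite (eq_bigr (fun i => (Rint (g i))%:E)); last first.
    by move=> i _; rewrite RintE.
  by rewrite sumEFin lee_fin big_mkord.
have iS : mu.-integrable setT S.
  apply/integrableP; split => //.
  under eq_integral => x _ do rewrite gee0_abs//.
  by rewrite (le_lt_trans IS)// ltry.
have aeS : {ae mu, forall x, S x \is a fin_num}.
  by apply: ae_imp (integrable_ae measurableT iS) => x; apply.
exists (fine \o S); split.
- apply: (ge0_rint (f := fine \o S)) => [|x|].
  + exact: (measurableT_comp (fine_measurable measurableT) mS).
  + by rewrite fine_ge0.
  have -> : (\int[mu]_x ((fine \o S) x)%:E = \int[mu]_x S x)%E; last first.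
    exact: le_lt_trans IS (ltry _).
  apply: ae_eq_integral => //.
  + apply/measurable_EFinP.
    exact: (measurableT_comp (fine_measurable measurableT) mS).
  + by apply: ae_imp aeS => x Sx _ /=; rewrite fineK.
- by move=> x; rewrite fine_ge0.
apply: ae_imp aeS => x Sx /=.
have : (\sum_(0 <= i < n) (g i x)%:E)%E @[n --> \oo] --> (fine (S x))%:E.
  by rewrite fineK//; apply: is_cvg_nneseries => n _ _; rewrite lee_fin.
have -> : (fun n => \sum_(0 <= i < n) (g i x)%:E)%E =
    (fun n => (\sum_(i < n) g i x)%:E).
  by apply/funext => n; rewrite sumEFin big_mkord.
by move/fine_cvg.
Qed.

(** Used where no majorant is at hand: the integrability of the limit is part of the conclusion. *)
Lemma fatou_cvg (g : nat -> R -> R) (h : R -> R) (C : R) :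
  (forall n, rint (g n)) -> (forall n x, 0 <= g n x) ->
  measurable_fun setT h -> (forall x, 0 <= h x) ->
  {ae mu, forall x, g n x @[n --> \oo] --> h x} ->
  (\forall n \near \oo, Rint (g n) <= C) -> rint h /\ Rint h <= C.
Proof.
move=> rg g0 mh h0 gh gC.
have mg n : measurable_fun setT (EFin \o g n).
  by apply/measurable_EFinP; exact: rint_meas.
have g0' n x : setT x -> (0 <= (EFin \o g n) x)%E by move=> _; rewrite lee_fin.
have Ih : (\int[mu]_x (h x)%:E <= C%:E)%E.
  have -> : (\int[mu]_x (h x)%:E =
      \int[mu]_x limn_einf (fun n => (EFin \o g n) x))%E; last first.
    apply: le_trans (fatou mu measurableT mg g0') _.
    rewrite limn_einf_lim; apply: lime_le; first exact: is_cvg_einfs.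
    apply: nearW => n; near \oo => m.
    apply: (@le_trans _ _ (Rint (g m))%:E); last by rewrite lee_fin; near: m.
    rewrite RintE//; apply: ereal_inf_lbound; exists m => //=.
    by near: m; exact: nbhs_infty_ge.
  apply: ae_eq_integral => //.
  - exact/measurable_EFinP.
  - apply: (measurableT_comp (@oppe_measurable R setT)).
    apply: measurable_fun_limn_esup => n.
    exact: (measurableT_comp (@oppe_measurable R setT) (mg n)).
  apply: ae_imp gh => x gx _.
  have : EFin (g n x) @[n --> \oo] --> (h x)%:E.
    by apply: cvg_EFin => //; exact: nearW.
  by move/cvg_limn_einf_sup => [->].
have rh : rint h by apply: ge0_rint => //; exact: le_lt_trans Ih (ltry _).
by split => //; rewrite -lee_fin RintE.
Unshelve. all: by end_near. Qed.

Lemma cvgn_geometric_dist (w : nat -> R) (M : R) :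
  (forall k, `|w k.+1 - w k| <= M * 2^-1 ^+ k) -> cvgn w.
Proof.
move=> wM.
have M0 : 0 <= M by have := le_trans (normr_ge0 _) (wM 0%N); rewrite expr0 mulr1.
have cs : cvgn (series (telescope w)).
  apply: normed_cvg; apply: (@series_le_cvg _ _ (geometric M 2^-1)) => [n|n|n|].
  - exact: normr_ge0.
  - by rewrite /= mulr_ge0// exprn_ge0.
  - exact: wM.
  - by apply: is_cvg_geometric_series; rewrite ger0_norm// invf_lt1// ltr1n.
have -> : w = (fun n => w 0%N + series (telescope w) n).
  by apply/funext => n; exact: eq_sum_telescope.
by apply: is_cvgD => //; exact: is_cvg_cst.
Qed.

(* Unlike [limn], [flim] preserves measurability also where the sequence
   diverges. *)
Definition flim (w : nat -> R) : R := fine (limn_esup (fun n => (w n)%:E)).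

Lemma measurable_flim (w : nat -> R -> R) : (forall n, measurable_fun setT (w n)) ->
  measurable_fun setT (fun x => flim (fun n => w n x)).
Proof.
move=> mw; apply: (measurableT_comp (fine_measurable measurableT)).
by apply: measurable_fun_limn_esup => n; apply/measurable_EFinP.
Qed.

Lemma flimE (w : nat -> R) (l : R) : w n @[n --> \oo] --> l -> flim w = l.
Proof.
move=> cw; have : EFin (w n) @[n --> \oo] --> l%:E.
  by apply: cvg_EFin => //; exact: nearW.
by move=> /cvg_limn_einf_sup[_ E]; rewrite /flim E.
Qed.

Lemma cvg_flim (w : nat -> R) : cvgn w -> w n @[n --> \oo] --> flim w.
Proof. by move=> cw; rewrite (flimE cw). Qed.

(* Along a subsequence [v] with [nsq (v k.+1 - v k) <= 16^-k], the sum of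
   [4^k |v k.+1 - v k|^2] is integrable, so [v] converges almost everywhere;
   Fatou's lemma turns the pointwise limit into a limit in the mean. *)
Lemma riesz_fischer (u : nat -> R -> R[i]) : (forall n, L2 (u n)) ->
  (forall e, 0 < e -> exists N, forall m n, (N <= m)%N -> (N <= n)%N ->
     nsq (fun x => u m x - u n x) <= e) ->
  exists2 f, L2 f & nsq (fun x => u n x - f x) @[n --> \oo] --> 0.
Proof.
move=> Lu cu.
have e0 k : 0 < (16^-1 : R) ^+ k by rewrite exprn_gt0.
pose N k := sval (cid (cu _ (e0 k))).
have NP k m n : (N k <= m)%N -> (N k <= n)%N ->
    nsq (fun x => u m x - u n x) <= 16^-1 ^+ k.
  exact: (svalP (cid (cu _ (e0 k)))).
(* The maximum makes [phi] strictly increasing while keeping it above the Cauchy threshold [N k]. *)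
pose phi := fix phi k := if k is j.+1 then maxn (phi j).+1 (N j.+1) else N 0%N.
have phiN k : (N k <= phi k)%N by case: k => //= k; rewrite leq_maxr.
have phiS k : (phi k < phi k.+1)%N by rewrite /= leq_maxl.
have phik k : (k <= phi k)%N by elim: k => // k IH; apply: leq_ltn_trans (phiS k).
pose v k := u (phi k).
have Ld k : L2 (fun x => v k.+1 x - v k x) by apply: L2B; exact: Lu.
pose g k x := 4 ^+ k * sqn (v k.+1 x - v k x).
(* The k-th integral is at most 4^k 16^-k = 4^-k, which is below 2^-k; these add up to at most 2. *)
have [] := @beppo_levi g 2.
- by move=> k; apply: rintZ; exact: L2_rint.
- by move=> k x; rewrite mulr_ge0 ?exprn_ge0 ?sqn_ge0.
- move=> n; apply: (@le_trans _ _ (\sum_(i < n) 2^-1 ^+ i)).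
    apply: ler_sum => i _; rewrite RintZ; last exact: L2_rint.
    have := NP i _ _ (leq_trans (phiN i) (ltnW (phiS i))) (phiN i).
    rewrite -/(v i) -/(v i.+1) => /(ler_wpM2l (exprn_ge0 i (ler0n R 4))) /le_trans.
    apply; rewrite -exprMn (_ : 4 * 16^-1 = 4^-1); last by field.
    by apply: lerXn2r; rewrite ?nnegrE//; lra.
  have -> : \sum_(i < n) (2^-1 : R) ^+ i = 2 - 2 * 2^-1 ^+ n.
    elim: n => [|n IH]; first by rewrite big_ord0 expr0; ring.
    by rewrite big_ord_recr /= IH exprS; field.
  by rewrite lerBlDr lerDl mulr_ge0// exprn_ge0.
move=> G [rG G0 aG].
pose f x := Complex (flim (fun k => complex.Re (v k x)))
                    (flim (fun k => complex.Im (v k x))).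
have mf : cmeas f.
  split; apply: (measurable_flim (w := fun k x => _ (v k x))) => k;
    by have [] := L2_meas (Lu (phi k)).
have avf : {ae mu, forall x, (complex.Re (v k x) @[k --> \oo] --> complex.Re (f x)) /\
    (complex.Im (v k x) @[k --> \oo] --> complex.Im (f x))}.
  apply: ae_imp aG => x Gx.
  have gG k : g k x <= G x.
    have nd : nondecreasing_seq (fun n => \sum_(i < n) g i x).
      apply/nondecreasing_seqP => n; rewrite big_ord_recr lerDl.
      by rewrite mulr_ge0 ?exprn_ge0 ?sqn_ge0.
    apply: (@le_trans _ _ (\sum_(i < k.+1) g i x)).
      rewrite big_ord_recr /= lerDr sumr_ge0// => i _.
      by rewrite mulr_ge0 ?exprn_ge0 ?sqn_ge0.
    rewrite -(cvg_lim (@Rhausdorff R) Gx).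
    exact: nondecreasing_cvgn_le nd (cvgP _ Gx) k.+1.
  (* Each term 4^k |v k.+1 - v k|^2 is below the sum [G x], so the increments decay like 2^-k and
     the real and imaginary parts converge. *)
  have dG k (t : R) : t ^+ 2 <= sqn (v k.+1 x - v k x) ->
      `|t| <= Num.sqrt (G x) * 2^-1 ^+ k.
    move=> tle; rewrite -ler_sqr ?nnegrE ?mulr_ge0 ?sqrtr_ge0 ?exprn_ge0//.
    rewrite real_normK ?num_real// exprMn sqr_sqrtr// -exprM mulnC exprM.
    rewrite (_ : 2^-1 ^+ 2 = 4^-1); last by field.
    rewrite exprVn ler_pdivlMr ?exprn_gt0// mulrC; apply: le_trans (gG k).
    by rewrite ler_wpM2l ?exprn_ge0.
  split; apply: cvg_flim; apply: (@cvgn_geometric_dist _ (Num.sqrt (G x))) => k;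
    apply: dG; rewrite /sqn !cE; [rewrite lerDl|rewrite lerDr]; exact: sqr_ge0.
(* Fatou's lemma in k with n fixed carries the Cauchy estimate for [u n - v k] over to [u n - f]. *)
have key e : 0 < e -> exists2 n0, (forall n, (n0 <= n)%N ->
    rint (fun x => sqn (u n x - f x)) /\ nsq (fun x => u n x - f x) <= e) & True.
  move=> /cu[n0 Hn0]; exists n0 => // n nn0.
  apply: (@fatou_cvg (fun k x => sqn (u n x - v k x))).
  - by move=> k; apply/L2_rint/L2B; exact: Lu.
  - by move=> k x; exact: sqn_ge0.
  - by apply: measurable_sqn; apply: cmeasB => //; exact/L2_meas.
  - by move=> x; exact: sqn_ge0.
  - apply: ae_imp avf => x [vr vi]; rewrite /sqn !cE.
    under eq_fun do rewrite !cE.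
    by apply: cvgD; under eq_fun do rewrite expr2; rewrite expr2;
      apply: cvgM; apply: cvgB => //; exact: cvg_cst.
  near=> k; apply: Hn0 => //; apply: leq_trans (phik k).
  by near: k; exact: nbhs_infty_ge.
exists f.
  have [n0 /(_ n0 (leqnn n0))[ri _] _] := key 1 ltr01.
  have -> : f = (fun x => u n0 x - (u n0 x - f x)).
    by apply/funext => x; rewrite subKr.
  by apply: L2B => //; apply/L2E; split => //; apply: cmeasB => //; exact: L2_meas.
apply/cvgr0Pnorm_le => e ep; have [n0 H _] := key e ep.
by near=> n; rewrite ger0_norm ?nsq_ge0//; apply H; near: n; exact: nbhs_infty_ge.
Unshelve. all: by end_near. Qed.

End Limits.

(** * Trigonometric polynomials *)

Section TrigPolynomials.
Context {R : realType}.
Local Notation mu := (@lebesgue_measure R).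
Implicit Types (L : R) (f g : R -> R[i]).

(** The sign is the one for which [chi 1 k] is the factor produced by [translate k] on the Fourier
    side. *)
Definition chi L (k : int) (x : R) : R[i] := cexp (- (2 * pi * k%:~R * x / L)).

(** Generated by the two rules rather than by a list of coefficients: membership in [W], boundedness
    and orthogonality relations are then proved by induction along the construction of the
    symbol. *)
Inductive trigpoly L : (R -> R[i]) -> Prop :=
| trig_chi k : trigpoly L (chi L k)
| trig_lin (a : R[i]) f g : trigpoly L f -> trigpoly L g ->
    trigpoly L (fun x => a * f x + g x).

Lemma chi0 L x : chi L 0 x = 1.
Proof. by rewrite /chi mulr0 !mul0r oppr0 cexp0. Qed.

Lemma chiD L j k x : chi L (j + k) x = chi L j x * chi L k x.
Proof. by rewrite /chi -cexpD; congr cexp; rewrite rmorphD /=; ring. Qed.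

Lemma chiN L k x : chi L (- k) x = conjc (chi L k x).
Proof. by rewrite /chi -cexpN; congr cexp; rewrite rmorphN /=; ring. Qed.

Lemma sqn_chi L k x : sqn (chi L k x) = 1. Proof. exact: sqn_cexp. Qed.

Lemma chi_period L k (j : int) x : L != 0 -> chi L k (x + j%:~R * L) = chi L k x.
Proof.
move=> L0; rewrite /chi.
have -> : - (2 * pi * k%:~R * (x + j%:~R * L) / L) =
  - (2 * pi * k%:~R * x / L) + 2 * pi * (- (k * j))%:~R :> R.
  by rewrite rmorphN rmorphM /=; field.
by rewrite cexpD cexp_2piz mulr1.
Qed.

Lemma trig0 L : trigpoly L (fun=> 0).
Proof.
have := trig_lin (-1) (trig_chi L 0) (trig_chi L 0).
by under eq_fun do rewrite mulN1r addNr.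
Qed.

Lemma trigZ L a f : trigpoly L f -> trigpoly L (fun x => a * f x).
Proof. by move=> /trig_lin /(_ (trig0 L)) => /(_ a); under eq_fun do rewrite addr0. Qed.

Lemma trigD L f g : trigpoly L f -> trigpoly L g -> trigpoly L (fun x => f x + g x).
Proof. by move=> tf tg; have := trig_lin 1 tf tg; under eq_fun do rewrite mul1r. Qed.

Lemma trig_cst L a : trigpoly L (fun=> a).
Proof. by have := trigZ a (trig_chi L 0); under eq_fun do rewrite chi0 mulr1. Qed.

Lemma trigM L f g : trigpoly L f -> trigpoly L g -> trigpoly L (fun x => f x * g x).
Proof.
move=> tf; elim: tf g => {f} [k|a f h _ IHf _ IHh] g tg; last first.
  have := trig_lin a (IHf _ tg) (IHh _ tg).
  by under eq_fun do rewrite mulrA -mulrDl.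
elim: tg => {g} [j|a f h _ IHf _ IHh].
  have <- : chi L (k + j) = (fun x => chi L k x * chi L j x).
    by apply/funext => x; rewrite chiD.
  exact: trig_chi.
have := trig_lin a IHf IHh.
by under eq_fun do rewrite mulrCA -mulrDr.
Qed.

Lemma trigX L f n : trigpoly L f -> trigpoly L (fun x => f x ^+ n).
Proof.
move=> tf; elim: n => [|n IH].
  by under eq_fun do rewrite expr0; exact: trig_cst.
by under eq_fun do rewrite exprS; exact: trigM.
Qed.

Lemma trigJ L f : trigpoly L f -> trigpoly L (fun x => conjc (f x)).
Proof.
elim=> {f} [k|a f h _ IHf _ IHh].
  have <- : chi L (- k) = (fun x => conjc (chi L k x)).
    by apply/funext => x; rewrite chiN.
  exact: trig_chi.
have := trig_lin (conjc a) IHf IHh.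
by under eq_fun do rewrite -conjcM -conjcD.
Qed.

Lemma trig_sum L I (s : seq I) (P : pred I) (F : I -> R -> R[i]) :
  (forall i, P i -> trigpoly L (F i)) ->
  trigpoly L (fun x => \sum_(i <- s | P i) F i x).
Proof.
move=> tF; elim: s => [|i s IH].
  by under eq_fun do rewrite big_nil; exact: trig0.
under eq_fun do rewrite big_cons.
by case Pi : (P i) => //; apply: trigD => //; apply: tF.
Qed.

Lemma trig_period L f (j : int) x : L != 0 -> trigpoly L f ->
  f (x + j%:~R * L) = f x.
Proof.
by move=> L0; elim=> {f} [k|a f g _ IHf _ IHg]; [rewrite chi_period|rewrite IHf IHg].
Qed.

Lemma measurable_chi L k : cmeas (chi L k).
Proof.
have mlin : measurable_fun setT (fun x : R => - (2 * pi * k%:~R * x / L)).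
  by apply: rmeasN; do 2 apply: measurable_funM => //.
split; apply: (measurableT_comp _ mlin); apply: continuous_measurable_fun.
  exact: continuous_cos.
exact: continuous_sin.
Qed.

Lemma trig_bounded L f : trigpoly L f ->
  cmeas f /\ exists C, forall x, sqn (f x) <= C.
Proof.
elim=> {f} [k|a f g _ [mf [C fC]] _ [mg [D gD]]].
  by split; [exact: measurable_chi|exists 1 => x; rewrite sqn_chi].
split; first by apply: cmeasD => //; apply: cmeasM => //; exact: cmeas_cst.
exists (2 * (sqn a * C) + 2 * D) => x; apply: le_trans (sqnD_le _ _) _.
by rewrite sqnM lerD ?ler_wpM2l ?sqn_ge0.
Qed.

(** Half the sum of a rotated character of index -1 and its conjugate. *)
Lemma trig_cos L (c : R) : trigpoly L (fun x => (cos (2 * pi * (x - c) / L))%:C%C).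
Proof.
have t1 := trigZ (cexp (- (2 * pi * c / L))) (trig_chi L (-1)).
have := trigZ (2^-1)%:C%C (trigD t1 (trigJ t1)).
congr trigpoly; apply/funext => x; rewrite /chi -cexpD.
have -> : - (2 * pi * c / L) + - (2 * pi * (-1)%:~R * x / L) =
  2 * pi * (x - c) / L by rewrite mulrN1z; ring.
by apply: complexP; rewrite !cE /=; field.
Qed.

End TrigPolynomials.

(** * Polynomial approximation of indicators *)

Section Bumps.
Context {R : realType}.

Lemma bernoulli_ge (t : R) N : 0 <= t -> 1 + N%:R * t <= (1 + t) ^+ N.
Proof.
move=> t0; elim: N => [|N IH]; first by rewrite mul0r addr0 expr0.
rewrite exprS -(natr1 N); apply: le_trans (ler_wpM2l _ IH); last lra.
have : 0 <= N%:R * t * t :> R by rewrite !mulr_ge0.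
lra.
Qed.

Lemma bernoulli_le (t : R) N : 0 <= t <= 1 -> 1 - N%:R * t <= (1 - t) ^+ N.
Proof.
move=> /andP[t0 t1]; elim: N => [|N IH]; first by rewrite mul0r subr0 expr0.
rewrite exprS -(natr1 N); apply: le_trans (ler_wpM2l _ IH); last lra.
have : 0 <= N%:R * t * t :> R by rewrite !mulr_ge0.
lra.
Qed.

(* Converges to the indicator of [x < 1/2] on [0, 1], up to the point [1/2]. *)
Definition arc_bump n (x : R) : R := (1 - x ^+ n) ^+ (2 ^ n).

Lemma bump_ge0_le1 n x : 0 <= x <= 1 -> 0 <= arc_bump n x <= 1.
Proof.
move=> /andP[x0 x1]; have : 0 <= x ^+ n <= 1 by rewrite exprn_ge0//= exprn_ile1.
move=> /andP[? ?]; rewrite exprn_ge0 ?subr_ge0//= exprn_ile1 ?subr_ge0//.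
by rewrite lerBlDr lerDl.
Qed.

(** Bernoulli's inequality gives 1 - (2x)^n as a lower bound, and 2x < 1. *)
Lemma bump_lt (x : R) : 0 <= x -> x < 2^-1 -> arc_bump n x @[n --> \oo] --> (1 : R).
Proof.
move=> x0 x2; have x1 : x <= 1 by lra.
apply: (@squeeze_cvgr _ _ _ _ (fun n => 1 - (2 * x) ^+ n) (fun=> 1)).
- apply: nearW => n; have := @bump_ge0_le1 n x; rewrite x0 x1 => /(_ isT)/andP[_ ->].
  rewrite andbT /arc_bump; apply: le_trans (bernoulli_le _ _).
    by rewrite exprMn natrX.
  by rewrite exprn_ge0//= exprn_ile1.
- rewrite -[X in _ --> X]subr0; apply: cvgB; first exact: cvg_cst.
  by apply: cvg_expr; rewrite ger0_norm; lra.
- exact: cvg_cst.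
Qed.

(** Multiplying by (1 + x^n)^(2^n) gives at most 1, while Bernoulli's inequality bounds that factor
    below by (2x)^n, with 2x > 1. *)
Lemma bump_gt (x : R) : 2^-1 < x -> x <= 1 -> arc_bump n x @[n --> \oo] --> (0 : R).
Proof.
move=> x2 x1; have x0 : 0 <= x by lra.
apply: (@squeeze_cvgr _ _ _ _ (fun=> 0) (fun n => (2 * x)^-1 ^+ n)).
- apply: nearW => n; have := @bump_ge0_le1 n x; rewrite x0 x1 => /(_ isT)/andP[-> _] /=.
  have h0 := exprn_ge0 n x0.
  have hb := bernoulli_ge (2 ^ n) h0; rewrite natrX -exprMn in hb.
  have h1 : arc_bump n x * (1 + x ^+ n) ^+ (2 ^ n) <= 1.
    rewrite /arc_bump -exprMn -subr_sqr expr1n exprn_ile1//.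
      by rewrite subr_ge0 -exprM exprn_ile1.
    by rewrite lerBlDr lerDl sqr_ge0.
  have pos : 0 < (2 * x) ^+ n by rewrite exprn_gt0//; lra.
  rewrite exprVn -[leRHS]mul1r ler_pdivlMr//; apply: le_trans h1 => //.
  have := @bump_ge0_le1 n x; rewrite x0 x1 => /(_ isT)/andP[b0 _].
  by rewrite ler_wpM2l//; lra.
- exact: cvg_cst.
- by apply: cvg_expr; rewrite ger0_norm ?invr_ge0 ?invf_lt1; lra.
Qed.

Lemma cos_gt (t r : R) : `|t| < r -> r <= pi -> cos r < cos t.
Proof.
move=> tr rp; have t0 := normr_ge0 t.
have -> : cos t = cos `|t| by case: (ger0P t) => // _; rewrite cosN.
by rewrite ltr_cos ?in_itv//=; lra.
Qed.

Lemma cos_lt (t r : R) : 0 <= r -> r < `|t| -> `|t| < 2 * pi - r -> cos t < cos r.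
Proof.
move=> r0 rt tr.
have -> : cos t = cos `|t| by case: (ger0P t) => // _; rewrite cosN.
have [tp|tp] := leP `|t| pi.
  by rewrite ltr_cos ?in_itv//=; lra.
(* Reflection brings the angle back to the interval from 0 to pi, where the cosine decreases. *)
have -> : cos `|t| = cos (2 * pi - `|t|).
  rewrite -cosN -(cosD2pi (- `|t|)); congr cos; rewrite mulr_natl.
  by rewrite addrC.
by rewrite ltr_cos ?in_itv//=; lra.
Qed.

End Bumps.

(** * Pointwise positivity from tests by squares of trigonometric polynomials *)

Section Positivity.
Context {R : realType}.
Local Notation mu := (@lebesgue_measure R).
Variables (a L : R).
Hypothesis L0 : 0 < L.

Lemma ae_neq (c : R) : {ae mu, forall x, x != c}.
Proof.
exists [set c]; split=> //; first exact: lebesgue_measure_set1.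
by move=> x /= /negP; rewrite negbK => /eqP.
Qed.

(** A difference of cosines lies between -2 and 2; the divisor 4 and the offset 1/2 bring it into
    the domain on which the bumps are controlled. *)
Lemma bump_cos_bounds (c r x : R) :
  0 <= 2^-1 + (cos r - cos (2 * pi * (x - c) / L)) / 4 <= 1.
Proof.
have := cos_geN1 r; have := cos_le1 r.
have := cos_geN1 (2 * pi * (x - c) / L); have := cos_le1 (2 * pi * (x - c) / L).
lra.
Qed.

Lemma angle_norm (t : R) : `|2 * pi * t / L| = 2 * pi * `|t| / L.
Proof.
have p0 := pi_ge0 R.
by rewrite !normrM normfV (gtr0_norm L0) [`|2|]ger0_norm// [`|pi|]ger0_norm.
Qed.

(* The indicator of an arc is the limit of [arc_bump n (X x)], where
   [X x < 1/2] means [cos (2 pi (x - c) / L) > cos (2 pi r / L)]. *)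
Lemma ball_Rint_ge0 (w : R -> R) (c r : R) : rint w ->
  (forall x, ~ `[a, a + L[%classic x -> w x = 0) ->
  (forall m, trigpoly L m -> 0 <= Rint (fun x => sqn (m x) * w x)) ->
  0 < r -> r < c - a -> r < a + L - c ->
  0 <= Rint (fun x => \1_(ball c r) x * w x).
Proof.
move=> rw w0 wm r0 rca rac.
have p0 := pi_gt0 R.
pose rho := 2 * pi * r / L.
pose X x := 2^-1 + (cos rho - cos (2 * pi * (x - c) / L)) / 4 : R.
have X01 x : 0 <= X x <= 1 by exact: bump_cos_bounds.
have tX : trigpoly L (fun x => (X x)%:C%C).
  have := trigD (trig_cst L (2^-1 + cos rho / 4)%:C%C)
    (trigZ (- 4^-1)%:C%C (trig_cos L c)).
  congr trigpoly; apply/funext => x.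
  by apply: complexP; rewrite !cE /= /X; ring.
have tb n : trigpoly L (fun x => (arc_bump n (X x))%:C%C).
  have := trigX (2 ^ n) (trigD (trig_cst L 1) (trigZ (-1) (trigX n tX))).
  congr trigpoly; apply/funext => x.
  by rewrite /arc_bump rmorphXn rmorphB rmorphXn rmorph1 mulN1r.
have mX : measurable_fun setT X by have [[]] := trig_bounded tX.
have mb n : measurable_fun setT (fun x => arc_bump n (X x) ^+ 2).
  by apply: measurable_funX; have [[]] := trig_bounded (tb n).
have mB : measurable_fun setT (\1_(ball c r) : R -> R).
  by apply: measurable_indic; exact: measurable_ball.
have [] := @dominated_Rint R (fun n x => arc_bump n (X x) ^+ 2 * w x)
    (fun x => \1_(ball c r) x * w x) (fun x => `|w x|).
- move=> n; apply: (@rint_bM _ 1) => // x; rewrite normrX exprn_ile1//.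
  by have /andP[b0 b1] := bump_ge0_le1 n (X01 x); rewrite ger0_norm.
- by apply: measurable_funM => //; exact: rint_meas.
(* At the two end points of the ball [X x] equals 1/2, where the bumps need not converge to the
   indicator. *)
- have := ae_and (ae_neq (c - r)) (ae_neq (c + r)).
  apply: ae_imp => x [xl xr].
  have [xD|xD] := pselect (`[a, a + L[%classic x); last first.
    by rewrite w0// mulr0; under eq_fun do rewrite mulr0; exact: cvg_cst.
  apply: cvgMl; move: xD; rewrite /= in_itv /= => /andP[ax xa].
  have rhoE y : (rho < 2 * pi * y / L) = (r < y).
    by rewrite /rho ltr_pM2r ?invr_gt0// ltr_pM2l// mulr_gt0.
  have rhoE' y : (2 * pi * y / L < rho) = (y < r).
    by rewrite /rho ltr_pM2r ?invr_gt0// ltr_pM2l// mulr_gt0.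
  have rhoL y : (2 * pi * y / L < 2 * pi - rho) = (y < L - r).
    have -> : 2 * pi - rho = 2 * pi * (L - r) / L.
      by rewrite /rho; field; rewrite gt_eqF.
    by rewrite ltr_pM2r ?invr_gt0// ltr_pM2l// mulr_gt0.
  have [xr'|xr'] := ltP `|x - c| r.
    rewrite (_ : \1_(ball c r) x = 1); last first.
      by rewrite indicE mem_set// /ball/= distrC.
    rewrite -[X in _ --> X](expr1n R 2) !expr2; under eq_fun do rewrite expr2.
    have [Xlo _] := andP (X01 x).
    suff bl : arc_bump n (X x) @[n --> \oo] --> (1 : R) by apply: cvgM.
    apply: bump_lt => //; rewrite /X.
    suff : cos rho < cos (2 * pi * (x - c) / L) by lra.
    apply: cos_gt; first by rewrite angle_norm rhoE'.
    (* The angle [rho] is at most pi because the two conditions on [r] add up to 2 r < L. *)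
    rewrite /rho ler_pdivrMr// mulrAC mulrC ler_pM2l//; lra.
  rewrite (_ : \1_(ball c r) x = 0); last first.
    by rewrite indicE memNset//= /ball/= distrC; apply/negP; rewrite -leNgt.
  rewrite -(mulr0 (0 : R)); under eq_fun do rewrite expr2.
  have [_ Xhi] := andP (X01 x).
  suff bl : arc_bump n (X x) @[n --> \oo] --> (0 : R) by apply: cvgM.
  apply: bump_gt => //; rewrite /X.
  suff : cos (2 * pi * (x - c) / L) < cos rho by lra.
  have rx : r < `|x - c|.
    rewrite lt_neqAle xr' andbT; apply: contraNneq xl => rE.
    case: (ger0P (x - c)) rE => s rE; last by rewrite rE; apply/eqP; ring.
    by move/eqP: xr; case; rewrite rE; ring.
  apply: cos_lt.
  - by rewrite /rho divr_ge0 ?mulr_ge0 ?ltW.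
  - by rewrite angle_norm rhoE.
  (* No other copy of the arc meets the period: there x - c < a + L - c < L - r and c - x <= c - a <
     L - r. *)
  - rewrite angle_norm rhoL ltr_norml; apply/andP; split; lra.
- exact: rint_norm.
- apply: ae_all => x n; rewrite normrM ler_piMl// normrX exprn_ile1//.
  by have /andP[b0 b1] := bump_ge0_le1 n (X01 x); rewrite ger0_norm.
move=> _ cv; rewrite -(cvg_lim (@Rhausdorff R) cv).
apply: limr_ge; first exact: (cvgP _ cv).
apply: nearW => n; have := wm _ (tb n).
rewrite (_ : (fun x => sqn _ * w x) = (fun x => arc_bump n (X x) ^+ 2 * w x))//.
by apply/funext => x; rewrite /sqn /= expr0n addr0.
Qed.

(** Turns an inequality between quadratic forms in [m] into a pointwise one. The completeness of the
    exponentials, the bound on [Phi] and the final estimate are all instances of it. *)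
Lemma trig_test_ge0 (w : R -> R) : rint w ->
  (forall x, ~ `[a, a + L[%classic x -> w x = 0) ->
  (forall m, trigpoly L m -> 0 <= Rint (fun x => sqn (m x) * w x)) ->
  {ae mu, forall x, 0 <= w x}.
Proof.
move=> rw w0 wm.
pose E (x : R) (n : nat) : set R := ball x n.+1%:R^-1.
have r0 n : 0 < (n.+1%:R : R)^-1 by rewrite invr_gt0 ltr0Sn.
have Eh x : nicely_shrinking x (E x).
  split; first by move=> n; exact: measurable_ball.
  exists (1, fun n => PosNum (r0 n)); split => //=.
  - exact: cvg_harmonic.
  - by move=> n.
  - by move=> n; rewrite mul1e.
have lw : locally_integrable setT w by apply: open_integrable_locally => //; exact: openT.
(* Every ball around the left end point leaves the period, so that point is discarded; around any
   other point of the period, small balls stay inside. *)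
have := ae_and (ae_neq a) (lebesgue_differentiation lw).
apply: ae_imp => c [ca lc].
have [cD|cD] := pselect (`[a, a + L[%classic c); last by rewrite w0.
move: cD; rewrite /= in_itv /= => /andP[ac cL].
have {}ac : a < c by rewrite lt_neqAle eq_sym ca.
rewrite -lee_fin; apply: cvge_ge (nice_lebesgue_differentiation Eh lw lc).
have m0 : 0 < Num.min (c - a) (a + L - c) by rewrite lt_min; lra.
near=> n.
have : n.+1%:R^-1 < Num.min (c - a) (a + L - c).
  by near: n; exact: near_infty_natSinv_lt (PosNum m0).
rewrite lt_min => /andP[n1 n2].
apply: mule_ge0; first by rewrite inve_ge0.
have := ball_Rint_ge0 rw w0 wm (r0 n) n1 n2.
rewrite -lee_fin RintE; last first.
  apply: rint_bM rw => [|x]; first by apply: measurable_indic; exact: measurable_ball.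
  by rewrite indicE; case: (_ \in _); rewrite ?normr1 ?normr0.
rewrite [X in _ -> (_ <= X)%E]integral_mkcond => /le_trans; apply.
rewrite le_eqVlt; apply/orP; left; apply/eqP; apply: eq_integral => x _.
by rewrite patchE indicE; case: ifP => _; rewrite ?mul1r ?mul0r.
Unshelve. all: by end_near. Qed.

End Positivity.

(** * Fourier series *)

Section SymmetricSums.
Context {V : nmodType}.
Implicit Types (u : int -> V).

(** The same symmetric partial sums as in [csum] and [synthesis], named so that their order
    properties can be stated. *)
Definition ssum n u : V := \sum_(j < n.*2.+1) u (j%:Z - n%:Z).

(** The index set as a duplicate-free list, for extracting one term and for comparing windows by
    inclusion. *)
Definition srange n : seq int := [seq j%:Z - n%:Z | j <- iota 0 n.*2.+1].

Lemma ssumE n u : ssum n u = \sum_(k <- srange n) u k.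
Proof. by rewrite big_map -[iota _ _]/(index_iota 0 n.*2.+1) big_mkord. Qed.

Lemma srange_uniq n : uniq (srange n).
Proof.
rewrite map_inj_uniq ?iota_uniq// => i j /(congr1 (fun z => z + n%:Z)).
by rewrite !subrK => -[].
Qed.

Lemma mem_srange n k : (k \in srange n) = (`|k| <= n)%N.
Proof.
apply/mapP/idP => [[j]|kn].
  by rewrite mem_iota => jn ->; lia.
exists (absz (k + n%:Z)); first by rewrite mem_iota; lia.
by lia.
Qed.

Lemma ssum0 u : ssum 0 u = u 0.
Proof. by rewrite /ssum big_ord_recl big_ord0 addr0. Qed.

Lemma ssumS n u : ssum n.+1 u = ssum n u + (u (- n.+1%:Z) + u n.+1%:Z).
Proof.
rewrite /ssum doubleS big_ord_recl big_ord_recr /=.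
rewrite [RHS]addrCA; congr (_ + (_ + _)).
- by congr u; lia.
- by apply: eq_bigr => i _; congr u; rewrite /bump leq0n /=; lia.
- by congr u; rewrite /bump leq0n /=; lia.
Qed.

Lemma eq_ssum n u v : u =1 v -> ssum n u = ssum n v.
Proof. by move=> uv; apply: eq_bigr => i _; exact: uv. Qed.

End SymmetricSums.

(** * Integrals of sines and cosines over an interval *)

Section Orthogonality.
Context {R : realType}.
Local Notation mu := (@lebesgue_measure R).

Lemma Rint_indic_itv (f : R -> R) (a b : R) : measurable_fun setT f ->
  Rint (fun x => \1_(`[a, b[) x * f x) = \int[mu]_(x in `[a, b]) f x.
Proof.
move=> mf; rewrite /Rint /Rintegral; congr fine.
rewrite -integral_itv_bndo_bndc; last first.
  by apply/measurable_EFinP; apply: measurable_funTS.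
rewrite [in RHS]integral_mkcond; apply: eq_integral => x _.
by rewrite patchE indicE; case: ifP => _; rewrite ?mul1r ?mul0r.
Qed.

Lemma Rint_FTC (F f : R -> R) (a b : R) : a < b -> (forall x : R, is_derive x (1 : R) F (f x)) ->
  continuous f -> Rint (fun x => \1_(`[a, b[) x * f x) = F b - F a.
Proof.
move=> ab dF cf; rewrite Rint_indic_itv; last exact: continuous_measurable_fun.
have cF : continuous F.
  move=> x; apply: differentiable_continuous; apply/derivable1_diffP.
  by have [] := dF x.
rewrite /Rintegral (@continuous_FTC2 _ f F)//.
- exact: continuous_subspaceT.
- split; first by move=> x _; have [] := dF x.
    exact/cvg_at_right_filter/cF.
  exact/cvg_at_left_filter/cF.
- by move=> x _; rewrite derive1E; have [_ ->] := dF x.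
Qed.

Lemma Rint_cos (c a b : R) : a < b -> c != 0 ->
  Rint (fun x => \1_(`[a, b[) x * cos (c * x)) = (sin (c * b) - sin (c * a)) / c.
Proof.
move=> ab c0.
have cf : continuous (fun x : R => cos (c * x)).
  move=> x; apply: continuous_comp; last exact: continuous_cos.
  by apply: continuousM; [exact: cvg_cst|exact: cvg_id].
have dF (x : R) : is_derive x (1 : R) (fun y => c^-1 * sin (c * y)) (cos (c * x)).
  by apply: is_derive_eq; rewrite /GRing.scale /=; field.
by rewrite (Rint_FTC ab dF cf); ring.
Qed.

Lemma Rint_sin (c a b : R) : a < b -> c != 0 ->
  Rint (fun x => \1_(`[a, b[) x * sin (c * x)) = - (cos (c * b) - cos (c * a)) / c.
Proof.
move=> ab c0.
have cf : continuous (fun x : R => sin (c * x)).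
  move=> x; apply: continuous_comp; last exact: continuous_sin.
  by apply: continuousM; [exact: cvg_cst|exact: cvg_id].
have dF (x : R) : is_derive x (1 : R) (fun y => - c^-1 * cos (c * y)) (sin (c * x)).
  by apply: is_derive_eq; rewrite /GRing.scale /=; field.
by rewrite (Rint_FTC ab dF cf); ring.
Qed.

Lemma rint_indic (a b : R) : rint (\1_(`[a, b[) : R -> R).
Proof. exact: integrable_indic_itv. Qed.

Lemma Rint_indic (a b : R) : a <= b -> Rint (\1_(`[a, b[) : R -> R) = b - a.
Proof.
move=> ab; rewrite /Rint /Rintegral.
rewrite integral_indic// setIT.
transitivity (fine (if (a < b)%R then (b - a)%R%:E else 0%E)).
  by congr fine; rewrite [LHS](@lebesgue_measure_itv R `[a, b[) /= lte_fin EFinB.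
by case: ltP => // ba; apply/eqP; rewrite eq_sym subr_eq0 eq_le ba ab.
Qed.

End Orthogonality.

(** * Restriction of functions to a set, extended by zero *)

Section Cut.
Context {R : realType}.
Local Notation mu := (@lebesgue_measure R).
Implicit Types (A : set R) (f : R -> R[i]).

Definition cut A f (x : R) : R[i] := (\1_A x)%:C%C * f x.

Lemma cutE A f x : A x -> cut A f x = f x.
Proof. by move=> Ax; rewrite /cut indicE mem_set// mul1r. Qed.

Lemma cutN A f x : ~ A x -> cut A f x = 0.
Proof. by move=> Ax; rewrite /cut indicE memNset// mul0r. Qed.

Lemma sqn_indic A x : sqn ((\1_A x)%:C%C : R[i]) = \1_A x.
Proof.
by rewrite /sqn /= expr0n addr0 indicE; case: (_ \in _); rewrite ?expr1n ?expr0n.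
Qed.

Lemma sqn_cut A f x : sqn (cut A f x) = \1_A x * sqn (f x).
Proof. by rewrite sqnM sqn_indic. Qed.

Lemma indic_ge0_le1 A x : 0 <= (\1_A x : R) <= 1.
Proof. by rewrite indicE; case: (_ \in _); rewrite ?lexx ?ler01. Qed.

Lemma cmeas_indic A : measurable A -> cmeas (fun x => (\1_A x)%:C%C).
Proof. by move=> mA; split; [exact: measurable_indic|exact: measurable_cst]. Qed.

Lemma cmeas_cut A f : measurable A -> cmeas f -> cmeas (cut A f).
Proof. by move=> mA mf; apply: cmeasM => //; exact: cmeas_indic. Qed.

Lemma cint_cut A f : measurable A -> cint f -> cint (cut A f).
Proof.
move=> mA; apply: (@cint_bM _ 1); first exact: cmeas_indic.
by move=> x; rewrite sqn_indic; have /andP[] := indic_ge0_le1 A x.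
Qed.

Lemma L2_cut A f : measurable A -> L2 f -> L2 (cut A f).
Proof.
move=> mA; apply: (@L2_bM _ 1); first exact: cmeas_indic.
by move=> x; rewrite sqn_indic; have /andP[] := indic_ge0_le1 A x.
Qed.

Lemma cut_supp A f : (forall x, ~ A x -> f x = 0) -> f = cut A f.
Proof.
move=> f0; apply/funext => x; have [Ax|Ax] := pselect (A x); first by rewrite cutE.
by rewrite cutN// f0.
Qed.

Lemma L2_cut_bounded C (a b : R) f : cmeas f -> (forall x, sqn (f x) <= C) ->
  L2 (cut `[a, b[ f).
Proof.
move=> mf fC; apply/L2E; split; first exact: cmeas_cut.
under eq_fun do rewrite sqn_cut mulrC; apply: (rint_bM (C := C)).
- exact: measurable_sqn.
- by move=> x; rewrite ger0_norm ?sqn_ge0.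
- exact: rint_indic.
Qed.

End Cut.

(** * Fourier series on an arbitrary period: Bessel and Parseval *)

Section FourierSeries.
Context {R : realType}.
Local Notation mu := (@lebesgue_measure R).
Variables (a L : R).
Hypothesis L0 : 0 < L.
Local Notation D := `[a, a + L[%classic.

(** Extending the characters by zero outside one period lets the inner product of the whole line
    serve for the period as well. *)
Definition ec (k : int) : R -> R[i] := cut D (chi L k).

Lemma L2_trig_cut m : trigpoly L m -> L2 (cut D m).
Proof. by move=> /trig_bounded[mm [C mC]]; exact: L2_cut_bounded mC. Qed.

Lemma L2_ec k : L2 (ec k). Proof. by apply: L2_trig_cut; exact: trig_chi. Qed.

Lemma inner_ec j k : inner (ec j) (ec k) = if j == k then L%:C%C else 0.
Proof.
have aL : a < a + L by rewrite ltrDl.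
rewrite /inner.
have -> : (fun x => ec j x * conjc (ec k x)) = cut D (chi L (j - k)).
  apply/funext => x; rewrite /ec /cut conjcM chiD chiN conjc_real.
  rewrite mulrACA; congr (_ * _); rewrite -rmorphM /= indicE.
  by case: (_ \in _); rewrite ?mulr1 ?mulr0.
case: eqVneq => [->|jk].
  rewrite subrr; have -> : cut D (chi L 0) = (fun x => (\1_D x)%:C%C).
    by apply/funext => x; rewrite /cut chi0 mulr1.
  by rewrite cintegral_real Rint_indic ?ltW// addrAC subrr add0r.
set n := j - k; have n0 : n != 0 by rewrite subr_eq0.
pose c : R := - (2 * pi * n%:~R / L).
have c0 : c != 0.
  rewrite oppr_eq0 !mulf_neq0 ?invr_eq0 ?(gt_eqF L0)// ?intr_eq0//.
  by rewrite gt_eqF// pi_gt0.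
have chiE x : chi L n x = cexp (c * x) by congr cexp; rewrite /c; ring.
(* Periodicity gives the primitives of the cosine and of the sine equal values at both ends, so both
   integrals vanish. *)
have per : chi L n (a + L) = chi L n a.
  by have := @chi_period R L n 1 a; rewrite mul1r => -> //; rewrite gt_eqF.
rewrite !chiE in per.
apply: complexP.
  rewrite -[LHS]/(Rint (fun x => complex.Re (cut D (chi L n) x))).
  transitivity (Rint (fun x => \1_D x * cos (c * x))).
    by congr Rint; apply/funext => x; rewrite /cut chiE cE /= mul0r subr0.
  rewrite Rint_cos//; have /= -> := congr1 (@complex.Im R) per.
  by rewrite subrr mul0r.
rewrite -[LHS]/(Rint (fun x => complex.Im (cut D (chi L n) x))).
transitivity (Rint (fun x => \1_D x * sin (c * x))).
  by congr Rint; apply/funext => x; rewrite /cut chiE cE /= mul0r addr0.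
rewrite Rint_sin//; have /= -> := congr1 (@complex.Re R) per.
by rewrite subrr oppr0 mul0r.
Qed.

Definition fcoef (w : R -> R[i]) k : R[i] := inner w (ec k).

(** Partial sums of a Fourier series; the factor 1 / L compensates for [ec k] having squared norm
    L. *)
Definition fsum (c : int -> R[i]) n : R -> R[i] :=
  fun x => \sum_(k <- srange n) (L^-1)%:C%C * c k * ec k x.

Lemma L2_fsum c n : L2 (fsum c n).
Proof. by apply: L2_sum => k _; apply: L2Z; exact: L2_ec. Qed.

Lemma inner_fsum_ec c n k :
  inner (fsum c n) (ec k) = if k \in srange n then c k else 0.
Proof.
rewrite inner_suml; [|by move=> j _; exact/L2Z/L2_ec|exact: L2_ec].
have E j : inner (fun x => (L^-1)%:C%C * c j * ec j x) (ec k) =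
    if j == k then c k else 0.
  rewrite innerZl; try exact: L2_ec.
  rewrite inner_ec; case: eqP => [->|_]; last by rewrite mulr0.
  by rewrite mulrAC -rmorphM /= mulVf ?gt_eqF// mul1r.
under eq_bigr do rewrite E; rewrite -big_mkcond /=.
case: ifP => kn.
  by rewrite -big_filter (@filter_pred1_uniq _ _ k) ?srange_uniq// big_seq1.
rewrite big1_seq// => j /andP[/eqP -> kn']; by rewrite kn' in kn.
Qed.

Lemma inner_fsum c f n : L2 f ->
  inner f (fsum c n) = (L^-1)%:C%C * \sum_(k <- srange n) conjc (c k) * fcoef f k.
Proof.
move=> Lf; rewrite inner_sumr//; last by move=> j _; exact/L2Z/L2_ec.
rewrite mulr_sumr; apply: eq_bigr => k _.
by rewrite innerZr//; [rewrite conjcM conjc_real mulrA|exact: L2_ec].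
Qed.

Lemma inner_fsum_fcoef f n : L2 f -> inner f (fsum (fcoef f) n) =
  (L^-1 * ssum n (fun k => sqn (fcoef f k)))%:C%C.
Proof.
move=> Lf; rewrite inner_fsum// rmorphM ssumE rmorph_sum /=; congr (_ * _).
by apply: eq_bigr => k _; rewrite mulrC mulJ_sqn.
Qed.

Lemma inner_fsum_fsum c m n : (n <= m)%N -> inner (fsum c m) (fsum c n) =
  (L^-1 * ssum n (fun k => sqn (c k)))%:C%C.
Proof.
move=> nm; rewrite inner_fsum; last exact: L2_fsum.
rewrite rmorphM ssumE rmorph_sum /=; congr (_ * _).
apply: eq_big_seq => k kn; rewrite /fcoef inner_fsum_ec ifT.
  by rewrite mulrC mulJ_sqn.
by move: kn; rewrite !mem_srange => /leq_trans; apply.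
Qed.

Lemma nsq_fsum c n : nsq (fsum c n) = L^-1 * ssum n (fun k => sqn (c k)).
Proof. by rewrite nsqE inner_fsum_fsum. Qed.

Lemma nsq_fsumB c m n : (n <= m)%N ->
  nsq (fun x => fsum c m x - fsum c n x) =
  L^-1 * (ssum m (fun k => sqn (c k)) - ssum n (fun k => sqn (c k))).
Proof.
move=> nm; rewrite nsqB; try exact: L2_fsum.
by rewrite !nsq_fsum inner_fsum_fsum//=; ring.
Qed.

(** Expand the squared distance from [f] to its partial sum: the cross term is twice the squared
    norm of the partial sum. *)
Lemma bessel f n : L2 f -> ssum n (fun k => sqn (fcoef f k)) <= L * nsq f.
Proof.
move=> Lf; have := nsq_ge0 (fun x => f x - fsum (fcoef f) n x).
rewrite nsqB//; last exact: L2_fsum.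
rewrite nsq_fsum inner_fsum_fcoef//= => H.
rewrite mulrC -ler_pdivrMr// mulrC; lra.
Qed.

Lemma ssum_ndecr (u : int -> R) : (forall k, 0 <= u k) ->
  nondecreasing_seq (fun n => ssum n u).
Proof.
move=> u0; apply/nondecreasing_seqP => n; rewrite ssumS lerDl.
exact: addr_ge0.
Qed.

(** By linearity [w] is orthogonal to every trigonometric polynomial, in particular to every
    [|m|^2]. The positivity test then applies to the real and imaginary parts of [w] and to their
    opposites. *)
Lemma fcoef_inj (w : R -> R[i]) : cint w -> (forall x, ~ D x -> w x = 0) ->
  (forall k, fcoef w k = 0) -> {ae mu, forall x, w x = 0}.
Proof.
move=> cw w0 wk.
have test m : trigpoly L m -> cint (fun x => m x * w x) /\ 
    cintegral (fun x => m x * w x) = 0.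
  move=> tm; have [mm [C mC]] := trig_bounded tm.
  split; first exact: cint_bM mC cw.
  elim: tm {mm C mC} => {m} [k|b f g tf IHf tg IHg].
    (* The inner product conjugates the character, whence the opposite index. *)
    have := wk (- k); rewrite /fcoef /inner => <-; congr cintegral.
    apply/funext => x; have [Dx|Dx] := pselect (D x).
      by rewrite /ec cutE// chiN conjcK mulrC.
    by rewrite w0// mulr0 mul0r.
  have [mf [Cf fC]] := trig_bounded tf; have [mg [Cg gC]] := trig_bounded tg.
  have cf := cint_bM mf fC cw; have cg := cint_bM mg gC cw.
  transitivity (cintegral (fun x => b * (f x * w x) + g x * w x)).
    by congr cintegral; apply/funext => x; ring.
  rewrite cintegralD ?cintegralZ//; last exact: cintZ.
  by rewrite IHf IHg mulr0 addr0.
have test2 m : trigpoly L m ->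
    Rint (fun x => sqn (m x) * complex.Re (w x)) = 0 /\
    Rint (fun x => sqn (m x) * complex.Im (w x)) = 0.
  move=> tm; have [_ E] := test _ (trigM tm (trigJ tm)).
  split.
    rewrite -[RHS]/(complex.Re (0 : R[i])) -E /=; congr Rint.
    by apply/funext => x; rewrite mulJ_sqn !cE /=; ring.
  rewrite -[RHS]/(complex.Im (0 : R[i])) -E /=; congr Rint.
  by apply/funext => x; rewrite mulJ_sqn !cE /=; ring.
have [rr ri] := cw.
have pos (u : R -> R) : rint u -> (forall x, ~ D x -> u x = 0) ->
    (forall m, trigpoly L m -> Rint (fun x => sqn (m x) * u x) = 0) ->
    {ae mu, forall x, u x = 0}.
  move=> ru u0 um.
  have h1 : {ae mu, forall x, 0 <= u x}.
    by apply: (@trig_test_ge0 R a L) => // m tm; rewrite um.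
  have h2 : {ae mu, forall x, 0 <= - u x}.
    apply: (@trig_test_ge0 R a L) => //.
    - exact: rintN.
    - by move=> x Dx; rewrite u0// oppr0.
    move=> m tm; have [mm [C mC]] := trig_bounded tm.
    under eq_fun do rewrite mulrN; rewrite RintN ?um ?oppr0//.
    apply: rint_bM ru => [|x]; first exact: measurable_sqn.
    by rewrite ger0_norm ?sqn_ge0.
  apply: ae_imp (ae_and h1 h2) => x [u1 u2]; apply: le_anti.
  by rewrite u1 andbT -oppr_ge0.
have hr : {ae mu, forall x, complex.Re (w x) = 0}.
  apply: pos => // [x Dx|m tm]; first by rewrite w0.
  by have [] := test2 _ tm.
have hi : {ae mu, forall x, complex.Im (w x) = 0}.
  apply: pos => // [x Dx|m tm]; first by rewrite w0.
  by have [] := test2 _ tm.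
by apply: ae_imp (ae_and hr hi) => x [? ?]; exact: complexP.
Qed.

(* Only the integrability of [w] is assumed: the limit of its Fourier series in
   [L2] has the same coefficients as [w], hence equals [w]. *)
Lemma fourier_series_cvg (w : R -> R[i]) (C : R) : cint w ->
  (forall x, ~ D x -> w x = 0) ->
  (forall n, ssum n (fun k => sqn (fcoef w k)) <= C) ->
  [/\ L2 w, nsq (fun x => fsum (fcoef w) n x - w x) @[n --> \oo] --> 0 &
      ssum n (fun k => sqn (fcoef w k)) @[n --> \oo] --> L * nsq w].
Proof.
move=> cw w0 wC; set c := fcoef w.
pose A n := ssum n (fun k => sqn (c k)).
have ndA : nondecreasing_seq A by apply: ssum_ndecr => k; exact: sqn_ge0.
have cA : cvgn A.
  by apply: nondecreasing_is_cvgn => //; exists C => _ [n _ <-]; exact: wC.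
have Lfs n := L2_fsum c n.
have [s Ls fs] : exists2 s, L2 s & nsq (fun x => fsum c n x - s x) @[n --> \oo] --> 0.
  apply: riesz_fischer => // e e0.
  (* Two partial sums within L e / 2 of the limit differ by at most L e, and [nsq_fsumB] divides by
     L. *)
  have eL : 0 < L * e / 2 by rewrite divr_gt0// mulr_gt0.
  have [N _ HN] : \forall n \near \oo, `|limn A - A n| <= L * e / 2.
    by move/cvgrPdist_le : cA; apply.
  exists N.
  have wl m n : (N <= n)%N -> (n <= m)%N -> nsq (fun x => fsum c m x - fsum c n x) <= e.
    move=> Nn nm; rewrite nsq_fsumB// -/(A m) -/(A n) mulrC ler_pdivrMr//.
    have := HN n Nn; have := HN m (leq_trans Nn nm) => /=.
    rewrite !ler_norml => /andP[h1 h2] /andP[h3 h4]; lra.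
  move=> m n Nm Nn; have [nm|/ltnW mn] := leqP n m; first exact: wl.
  by rewrite nsq_distC; exact: wl.
(* The limit is known only in the mean and may be nonzero off [D]. Cutting it does not increase the
   distance to the partial sums, which vanish there. *)
pose s' := cut D s.
have Ls' : L2 s' by exact: L2_cut.
have fs' : nsq (fun x => fsum c n x - s' x) @[n --> \oo] --> 0.
  apply: (@squeeze_cvgr _ _ _ _ (fun=> 0) (fun n => nsq (fun x => fsum c n x - s x)));
    [|exact: cvg_cst|exact: fs].
  apply: nearW => n; rewrite nsq_ge0/=.
  apply: le_Rint; [exact/L2_rint/L2B|exact/L2_rint/L2B|move=> x].
  have [Dx|Dx] := pselect (D x); first by rewrite /s' cutE.
  rewrite /s' cutN// subr0 /fsum big1 ?sqn0 ?sqn_ge0// => k _.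
  by rewrite /ec cutN// mulr0.
have cs' k : inner s' (ec k) = c k.
  have H := inner_cvg Lfs Ls' (L2_ec k) fs'.
  have H' : sqn (inner (fsum c n) (ec k) - inner s' (ec k)) @[n --> \oo] -->
      sqn (c k - inner s' (ec k)).
    (* The k-th coefficient of the partial sums is constant as soon as n reaches |k|. *)
    apply: cvg_near_cst; exists `|k|%N => // n /= kn.
    by rewrite inner_fsum_ec mem_srange kn.
  have /sqn_eq0/eqP : sqn (c k - inner s' (ec k)) = 0 by exact: cvg_unique H' H.
  by rewrite subr_eq0 => /eqP.
(* On a bounded interval square integrability implies integrability: multiply by the
   square-integrable function [ec 0], the indicator of [D]. *)
have cs1 : cint s'.
  have := L2_cintM (L2_ec 0) Ls'; congr cint; apply/funext => x.
  have [Dx|Dx] := pselect (D x); first by rewrite /ec cutE// chi0 mul1r.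
  by rewrite /s' /ec !cutN// mulr0.
have ws : {ae mu, forall x, s' x = w x}.
  have cN : cint (fun x => -1 * s' x) by exact: cintZ.
  have : {ae mu, forall x, w x + -1 * s' x = 0}.
    apply: fcoef_inj; first exact: cintD.
      by move=> x Dx; rewrite w0// /s' cutN// mulr0 addr0.
    move=> k; rewrite /fcoef /inner.
    have ck f : cint f -> cint (fun x => f x * conjc (ec k x)).
      move=> cf; rewrite (_ : (fun x => _) = (fun x => conjc (ec k x) * f x)).
        apply: (@cint_bM _ 1) => //; first by apply: cmeasJ; have /L2_meas := L2_ec k.
        move=> x; rewrite sqnJ sqn_cut sqn_chi mulr1.
        by have /andP[] := indic_ge0_le1 D x.
      by apply/funext => x; rewrite mulrC.
    under eq_fun do rewrite mulrDl -mulrA.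
    rewrite cintegralD; [|exact: ck|exact/cintZ/ck].
    rewrite cintegralZ; last exact: ck.
    by rewrite -/(inner w (ec k)) -/(inner s' (ec k)) cs' mulN1r subrr.
  by apply: ae_imp => x; rewrite mulN1r => /eqP; rewrite subr_eq0 => /eqP ->.
have mw := cint_meas cw.
have Lw : L2 w by exact: ae_eq_L2 ws mw Ls'.
have fw : nsq (fun x => fsum c n x - w x) @[n --> \oo] --> 0.
  rewrite (_ : (fun n => _) = (fun n => nsq (fun x => fsum c n x - s' x)))//.
  apply/funext => n; apply: ae_eq_nsq; try by apply/L2_meas/L2B.
  by apply: ae_imp ws => x ->.
split => //.
have H := nsq_cvg Lfs Lw fw.
have -> : (fun n => ssum n (fun k => sqn (c k))) = (fun n => L * nsq (fsum c n)).
  by apply/funext => n; rewrite nsq_fsum mulrA divff ?gt_eqF// mul1r.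
exact: cvgMr.
Qed.

Lemma parseval (w : R -> R[i]) : L2 w -> (forall x, ~ D x -> w x = 0) ->
  nsq (fun x => fsum (fcoef w) n x - w x) @[n --> \oo] --> 0 /\
  ssum n (fun k => sqn (fcoef w k)) @[n --> \oo] --> L * nsq w.
Proof.
move=> Lw w0; have [||_ ? ?//] := @fourier_series_cvg w (L * nsq w) _ w0.
  have := L2_cintM (L2_ec 0) Lw; congr cint; apply/funext => x.
  have [Dx|Dx] := pselect (D x); first by rewrite /ec cutE// chi0 mul1r.
  by rewrite w0// mulr0.
by move=> n; exact: bessel.
Qed.

End FourierSeries.

(** * Periodization *)

Section Translation.
Context {R : realType}.
Local Notation mu := (@lebesgue_measure R).

Lemma measurable_shift (c : R) : measurable_fun setT (fun x : R => x + c).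
Proof. by apply: measurable_funD. Qed.

(** The pushforward under a translation agrees with Lebesgue measure on half-open intervals, and
    these determine the measure. *)
Lemma lebesgue_measure_shift (c : R) (A : set R) : measurable A ->
  mu ((fun x => x + c) @^-1` A) = mu A.
Proof.
move=> mA; apply/esym.
apply: (@lebesgue_measure_unique R
  (pushforward (lebesgue_measure : {measure set (measurableTypeR R) -> \bar R})
     (fun x : measurableTypeR R => (x + c : measurableTypeR R)))) => //.
  exact: measurable_shift.
move=> _ _ [[b d] /= _ <-]; rewrite /pushforward.
have -> : (fun x : R => x + c) @^-1` `]b, d] = `](b - c), (d - c)]%classic.
  by apply/seteqP; split => x /=; rewrite !in_itv /= ltrBlDr lerBrDr.
rewrite !lebesgue_measure_itv /= !lte_fin ltrD2r.
by case: ifP => // _; rewrite -!EFinB; congr EFin; ring.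
Qed.

Lemma ge0_integral_shift (f : R -> R) (c : R) : measurable_fun setT f ->
  (forall x, 0 <= f x) ->
  (\int[mu]_x (f (x + c))%:E = \int[mu]_x (f x)%:E)%E.
Proof.
move=> mf f0.
have mf' : measurable_fun (setT : set (measurableTypeR R)) (EFin \o f).
  by apply/measurable_EFinP.
have := @ge0_integral_pushforward _ _ (measurableTypeR R) (measurableTypeR R) R
  (fun x => x + c) (measurable_shift c) (@lebesgue_measure R) setT
  (EFin \o f) measurableT mf' (fun y _ => f0 y).
rewrite preimage_setT => <-.
apply: eq_measure_integral => [|? A mA _]; first exact: measurable_shift.
exact: lebesgue_measure_shift.
Qed.

Lemma rint_shift (f : R -> R) (c : R) : rint f -> rint (fun x => f (x + c)).
Proof.
move=> rf; have mf := rint_meas rf.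
have mfc : measurable_fun setT (fun x : R => f (x + c)).
  exact: (measurableT_comp mf (measurable_shift c)).
apply/integrableP; split; first exact/measurable_EFinP.
have mn : measurable_fun setT (fun x : R => `|f x|) by exact: measurableT_comp.
have := ge0_integral_shift c mn (fun x => normr_ge0 _).
by move=> /= ->; exact: rint_lty (rint_norm rf).
Qed.

Lemma ge0_Rint_shift (f : R -> R) (c : R) : rint f -> (forall x, 0 <= f x) ->
  Rint (fun x => f (x + c)) = Rint f.
Proof.
move=> rf f0; rewrite /Rint /Rintegral ge0_integral_shift//.
exact: rint_meas.
Qed.

Lemma Rint_shift (f : R -> R) (c : R) : rint f -> Rint (fun x => f (x + c)) = Rint f.
Proof.
move=> rf; have rn := rint_norm rf.
(* A signed function is the difference of the nonnegative functions |f| + f and |f|, for which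
   invariance is known. *)
have rs : rint (fun x => `|f x| + f x) by exact: rintD.
have E1 := ge0_Rint_shift c rn (fun x => normr_ge0 _).
have s0 x : 0 <= `|f x| + f x by rewrite -lerBlDr sub0r -normrN ler_norm.
have E2 := ge0_Rint_shift c rs s0.
move: E2; rewrite RintD ?E1; [|exact: (rint_shift c rn)|exact: rint_shift].
by rewrite RintD// => /addrI.
Qed.

Lemma ae_shift (P : R -> Prop) (c : R) : {ae mu, forall x, P x} ->
  {ae mu, forall x, P (x + c)}.
Proof.
move=> [N [mN N0 NP]]; exists ((fun x => x + c) @^-1` N); split.
- by have := measurable_shift c measurableT mN; rewrite setTI.
- by rewrite -N0; exact: lebesgue_measure_shift.
- by move=> x /= Px; apply: NP.
Qed.

End Translation.

(** * Decomposition of the line into translated cells *)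

Section Unfolding.
Context {R : realType}.
Local Notation mu := (@lebesgue_measure R).
Variable s : R.
Hypothesis s0 : 0 < s.
Local Notation D := `[- (s / 2), - (s / 2) + s[%classic.

(** The union of the 2 n + 1 translates of the cell [D] by k s with |k| <= n. Centring [D] at the
    origin matches these sets to the symmetric partial sums. *)
Definition tile n : set R := `[- ((n%:R + 2^-1) * s), (n%:R + 2^-1) * s[%classic.

Lemma measurable_tile n : measurable (tile n). Proof. exact: measurable_itv. Qed.

Lemma indic_tile n x : \1_(tile n) x = ssum n (fun k => \1_D (x - k%:~R * s)) :> R.
Proof.
have indE (a b y : R) : \1_(`[a, b[) y = ((a <= y) && (y < b))%:R :> R.
  by rewrite indicE; congr (_ %:R); rewrite mem_setE in_itv.
elim: n => [|n IH].
  by rewrite ssum0 mul0r subr0 !indE; congr (_%:R); congr (_ && _); lra.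
rewrite ssumS -IH /tile !indE.
have nE : (n.+1%:Z)%:~R = n%:R + 1 :> R by rewrite -pmulrn -natr1.
rewrite mulrNz nE.
rewrite -(natr1 n); have ns : 0 <= n%:R * s :> R by rewrite mulr_ge0// ltW.
set m := n%:R * s in ns *.
(* The old tile runs from [p2] to [p3]; the two new cells run from [p1] to [p2] and from [p3] to
   [p4]. *)
pose p1 := - (m + s + s / 2); pose p2 := - (m + s / 2).
pose p3 := m + s / 2; pose p4 := m + s + s / 2.
have e1 : - ((n%:R + 1 + 2^-1) * s) = p1 by rewrite /p1 /m; ring.
have e2 : (n%:R + 1 + 2^-1) * s = p4 by rewrite /p4 /m; ring.
have e3 : - ((n%:R + 2^-1) * s) = p2 by rewrite /p2 /m; ring.
have e4 : (n%:R + 2^-1) * s = p3 by rewrite /p3 /m; ring.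
have xl : x - - (n%:R + 1) * s = x + (m + s) by rewrite /m; ring.
have xr : x - (n%:R + 1) * s = x - (m + s) by rewrite /m; ring.
have d1 : (- (s / 2) <= x + (m + s)) = (p1 <= x).
  by rewrite /p1; apply/idP/idP => ?; lra.
have d2 : (x + (m + s) < - (s / 2) + s) = (x < p2).
  by rewrite /p2; apply/idP/idP => ?; lra.
have d3 : (- (s / 2) <= x - (m + s)) = (p3 <= x).
  by rewrite /p3; apply/idP/idP => ?; lra.
have d4 : (x - (m + s) < - (s / 2) + s) = (x < p4).
  by rewrite /p4; apply/idP/idP => ?; lra.
rewrite xl xr.
rewrite e1 e2 e3 e4 d1 d2 d3 d4.
have h12 : p1 <= p2 by rewrite lerN2 lerD2r lerDl ltW.
have h34 : p3 <= p4 by rewrite lerD2r lerDl ltW.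
have h23 : p2 <= p3.
  by apply: (@le_trans _ _ 0); rewrite ?oppr_le0 addr_ge0// divr_ge0// ltW.
clear -h12 h23 h34.
case: (leP p1 x) => c1; case: (leP p2 x) => c2; case: (leP p3 x) => c3;
  case: (ltP x p4) => c4; rewrite /= ?addr0 ?add0r//; lra.
Qed.

(** Integrability is asked cell by cell and not on the line, so that the identity can be used to
    prove that [f] is integrable, as in Plancherel's theorem. *)
Lemma tile_Rint n (f : R -> R) :
  (forall k : int, rint (fun x => \1_D x * f (x + k%:~R * s))) ->
  rint (fun x => \1_(tile n) x * f x) /\
  Rint (fun x => \1_(tile n) x * f x) =
  Rint (fun x => \1_D x * ssum n (fun k => f (x + k%:~R * s))).
Proof.
move=> rf.
have rs (k : int) : rint (fun x => \1_D (x - k%:~R * s) * f x).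
  have := rint_shift (- (k%:~R * s)) (rf k).
  by under eq_fun do rewrite subrK.
have E : (fun x => \1_(tile n) x * f x) =
    (fun x => \sum_(j < n.*2.+1)
       \1_D (x - (j%:Z - n%:Z)%:~R * s) * f x).
  by apply/funext => x; rewrite indic_tile mulr_suml.
rewrite E; split; first by apply: rint_sum => j _; exact: rs.
rewrite Rint_sum; last by move=> j _; exact: rs.
under [in RHS]eq_fun do rewrite mulr_sumr.
rewrite Rint_sum; last by move=> j _; exact: rf.
apply: eq_bigr => j _; rewrite -[RHS](Rint_shift (- ((j%:Z - n%:Z)%:~R * s)))//.
by congr Rint; apply/funext => x; rewrite subrK.
Qed.

Lemma cvg_tile x : \1_(tile n) x @[n --> \oo] --> (1 : R).
Proof.
apply: cvg_near_cst; near=> n; apply/eqP; rewrite indicE.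
suff nx : `|x| / s < n%:R.
  rewrite mem_set// /tile /= in_itv /=; rewrite ltr_pdivrMr// in nx.
  have := ler_norm x; have := ler_norm (- x); rewrite normrN.
  have : 0 < 2^-1 * s by rewrite mulr_gt0.
  rewrite mulrDl; lra.
near: n; exact: nbhs_infty_gtr.
Unshelve. all: by end_near. Qed.

Lemma tile_Rint_cvg (f : R -> R) : rint f ->
  Rint (fun x => \1_(tile n) x * f x) @[n --> \oo] --> Rint f.
Proof.
move=> rf; have [] // := @dominated_Rint R (fun n x => \1_(tile n) x * f x) f (fun x => `|f x|).
- move=> n; apply: (@rint_bM _ 1) => //; first by apply: measurable_indic; exact: measurable_tile.
  by move=> x; have /andP[? ?] := indic_ge0_le1 (tile n) x; rewrite ger0_norm.
- exact: rint_meas.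
- apply: ae_all => x; rewrite -[X in _ --> X]mul1r; apply: cvgMl.
  exact: cvg_tile.
- exact: rint_norm.
- apply: ae_all => x n; rewrite normrM ler_piMl//.
  by have /andP[? ?] := indic_ge0_le1 (tile n) x; rewrite ger0_norm.
Qed.

End Unfolding.

(** * Absolutely convergent sums over the integers *)

Section AbsoluteSums.
Context {R : realType}.
Implicit Types (u v : int -> R) (z : int -> R[i]).

Lemma ler_ssum n u v : (forall k, u k <= v k) -> ssum n u <= ssum n v.
Proof. by move=> uv; apply: ler_sum. Qed.

Lemma ler_norm_ssum n u v : (forall k, `|u k| <= v k) -> `|ssum n u| <= ssum n v.
Proof.
move=> uv; apply: le_trans (ler_norm_sum _ _ _) _; exact: ler_sum.
Qed.

Lemma ssumD n u v : ssum n (fun k => u k + v k) = ssum n u + ssum n v.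
Proof. exact: big_split. Qed.

Lemma ssumZ n (a : R) u : ssum n (fun k => a * u k) = a * ssum n u.
Proof. by rewrite /ssum mulr_sumr. Qed.

Lemma ge0_ssum_cvg u (C : R) : (forall k, 0 <= u k) -> (forall n, ssum n u <= C) ->
  cvgn (fun n => ssum n u).
Proof.
move=> u0 uC; apply: nondecreasing_is_cvgn; first exact: ssum_ndecr.
by exists C => _ [n _ <-].
Qed.

Lemma ssum_le_lim u (l : R) n : (forall k, 0 <= u k) ->
  ssum n u @[n --> \oo] --> l -> ssum n u <= l.
Proof.
move=> u0 ul; rewrite -(cvg_lim (@Rhausdorff R) ul).
exact: nondecreasing_cvgn_le (ssum_ndecr u0) (cvgP _ ul) n.
Qed.

Lemma ge0_ssum_cvg_le u v : (forall k, 0 <= u k) -> (forall k, u k <= v k) ->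
  cvgn (fun n => ssum n v) -> cvgn (fun n => ssum n u).
Proof.
move=> u0 uv cv; apply: (@ge0_ssum_cvg _ (limn (fun n => ssum n v))) => // n.
apply: le_trans (ler_ssum n uv) _; apply: ssum_le_lim => // k.
exact: le_trans (u0 k) (uv k).
Qed.

(** Write u = (v + u) - v, where the first family lies between 0 and 2 v. *)
Lemma ssum_abs_cvg u v : (forall k, `|u k| <= v k) -> cvgn (fun n => ssum n v) ->
  cvgn (fun n => ssum n u).
Proof.
move=> uv cv.
have cvu : cvgn (fun n => ssum n (fun k => v k + u k)).
  apply: (@ge0_ssum_cvg_le _ (fun k => 2 * v k)).
  - by move=> k; have := uv k; rewrite ler_norml => /andP[]; lra.
  - by move=> k; have := uv k; rewrite ler_norml => /andP[]; lra.
  by under eq_fun do rewrite ssumZ; exact: is_cvgMr.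
rewrite (_ : (fun n => ssum n u) =
  (fun n => ssum n (fun k => v k + u k) - ssum n v)); first exact: is_cvgB.
by apply/funext => n; rewrite ssumD addrAC subrr add0r.
Qed.

Lemma ler_sum_subset (s t : seq int) u : uniq s -> uniq t -> {subset s <= t} ->
  (forall k, 0 <= u k) -> \sum_(k <- s) u k <= \sum_(k <- t) u k.
Proof.
move=> us ut st u0; rewrite [leRHS](bigID (mem s)) /= -[in leRHS]big_filter.
have ps : perm_eq [seq k <- t | k \in s] s.
  apply: uniq_perm => //; first exact: filter_uniq.
  by move=> k; rewrite mem_filter andb_idr//; exact: st.
by rewrite (perm_big _ ps) lerDl sumr_ge0.
Qed.

(** A window shifted by j is contained in the symmetric window enlarged by |j|. *)
Lemma ssum_shift_le u (j : int) n : (forall k, 0 <= u k) ->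
  ssum n (fun k => u (j + k)) <= ssum (n + `|j|%N) u.
Proof.
move=> u0; rewrite !ssumE -(big_map (fun k => j + k) xpredT u).
apply: ler_sum_subset => //; try exact: srange_uniq.
  by rewrite map_inj_uniq ?srange_uniq//; exact: addrI.
move=> _ /mapP[k kn ->]; move: kn; rewrite !mem_srange; lia.
Qed.

(** The terms being nonnegative, convergence along symmetric windows is ordinary absolute
    summability. *)
Definition abs_summable z := cvgn (fun n => ssum n (fun k => cnorm (z k))).

Lemma Re_cnorm (w : R[i]) : `|complex.Re w| <= cnorm w.
Proof.
by rewrite -ler_sqr ?nnegrE ?cnorm_ge0// cnorm_sqr real_normK ?num_real// ReE_le.
Qed.

Lemma Im_cnorm (w : R[i]) : `|complex.Im w| <= cnorm w.
Proof.
by rewrite -ler_sqr ?nnegrE ?cnorm_ge0// cnorm_sqr real_normK ?num_real// ImE_le.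
Qed.

Lemma Re_csum_cvg z : abs_summable z ->
  ssum n (fun k => complex.Re (z k)) @[n --> \oo] --> complex.Re (csum z).
Proof. by apply: ssum_abs_cvg => k; exact: Re_cnorm. Qed.

Lemma Im_csum_cvg z : abs_summable z ->
  ssum n (fun k => complex.Im (z k)) @[n --> \oo] --> complex.Im (csum z).
Proof. by apply: ssum_abs_cvg => k; exact: Im_cnorm. Qed.

Lemma cnormM (w w' : R[i]) : cnorm (w * w') = cnorm w * cnorm w'.
Proof. by rewrite !cnormE sqnM sqrtrM// sqn_ge0. Qed.

Lemma abs_summableZ (a : R[i]) z : abs_summable z ->
  abs_summable (fun k => a * z k).
Proof.
move=> cz; rewrite /abs_summable.
under eq_fun => n do under eq_ssum => k do rewrite cnormM.
by under eq_fun do rewrite ssumZ; exact: is_cvgMr.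
Qed.

Lemma csumZ (a : R[i]) z : abs_summable z -> csum (fun k => a * z k) = a * csum z.
Proof.
move=> cz; have cr := Re_csum_cvg cz; have ci := Im_csum_cvg cz.
have crz := Re_csum_cvg (@abs_summableZ a z cz).
have ciz := Im_csum_cvg (@abs_summableZ a z cz).
apply: complexP; rewrite cE.
  apply: (cvg_unique (@Rhausdorff R) crz).
  rewrite (_ : (fun n => _) = (fun n =>
    complex.Re a * ssum n (fun k => complex.Re (z k)) -
    complex.Im a * ssum n (fun k => complex.Im (z k)))).
    by apply: cvgB; exact: cvgMr.
  apply/funext => n; rewrite -mulNr -!ssumZ -ssumD.
  by apply: eq_ssum => k; rewrite cE; ring.
apply: (cvg_unique (@Rhausdorff R) ciz).
rewrite (_ : (fun n => _) = (fun n =>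
  complex.Re a * ssum n (fun k => complex.Im (z k)) +
  complex.Im a * ssum n (fun k => complex.Re (z k)))).
  by apply: cvgD; exact: cvgMr.
apply/funext => n; rewrite -!ssumZ -ssumD.
by apply: eq_ssum => k; rewrite cE; ring.
Qed.

(** The real and imaginary parts are bounded by [l] separately, which costs the factor 2; only
    boundedness matters later. *)
Lemma sqn_csum_le z (l : R) : ssum n (fun k => cnorm (z k)) @[n --> \oo] --> l ->
  sqn (csum z) <= 2 * l ^+ 2.
Proof.
move=> zl; have az : abs_summable z by apply: cvgP zl.
have c0 k : 0 <= cnorm (z k) by exact: cnorm_ge0.
have bnd (u : int -> R) (t : R) : (forall k, `|u k| <= cnorm (z k)) ->
    ssum n u @[n --> \oo] --> t -> t ^+ 2 <= l ^+ 2.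
  move=> uz ut; have : `|t| <= l.
    rewrite -(cvg_lim (@Rhausdorff R) (cvg_norm ut)).
    apply: limr_le; first exact: cvgP (cvg_norm ut).
    apply: nearW => n; apply: le_trans (ler_norm_ssum n uz) _.
    exact: ssum_le_lim.
  move=> tl; rewrite -(real_normK (num_real t)) ler_sqr ?nnegrE//.
  exact: le_trans (normr_ge0 t) tl.
have := bnd _ _ (fun k => Re_cnorm (z k)) (Re_csum_cvg az).
have := bnd _ _ (fun k => Im_cnorm (z k)) (Im_csum_cvg az).
rewrite /sqn; lra.
Qed.

End AbsoluteSums.

(** * Periodization of integrable functions *)

Section Periodization.
Context {R : realType}.
Local Notation mu := (@lebesgue_measure R).
Local Notation D := `[- (1 / 2) : R, - (1 / 2) + 1[%classic.
Implicit Types (F : R -> R[i]).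

(** The integer translates of a null set are countably many, so their union is null. *)
Lemma ae_periodic (P : R -> Prop) : (forall x (k : int), P x -> P (x + k%:~R)) ->
  {ae mu, forall x, D x -> P x} -> {ae mu, forall x, P x}.
Proof.
move=> perP aeP.
have h1 : {ae mu, forall x, forall n : nat, D (x - n%:R) -> P (x - n%:R)}.
  by apply: ae_foralln => n; exact: (ae_shift (- n%:R) aeP).
have h2 : {ae mu, forall x, forall n : nat, D (x + n%:R) -> P (x + n%:R)}.
  by apply: ae_foralln => n; exact: (ae_shift n%:R aeP).
apply: ae_imp (ae_and h1 h2) => x [px nx].
(* The floor of x + 1/2 is the integer whose subtraction brings x into [D]. *)
have := floor_itv (x + 1 / 2); set k := Num.floor _.
rewrite intrD /= => /andP[kx xk].
have Dk : D (x - k%:~R) by rewrite /= in_itv /=; lra.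
have : P (x - k%:~R).
  case: (intP k) Dk => [|n|n]; first by move/(px 0%N).
    by rewrite -pmulrn => /px.
  by rewrite mulrNz opprK -pmulrn => /nx.
by move=> /(perP _ k); rewrite subrK.
Qed.

Lemma tile1_Rint n (f : R -> R) : rint f ->
  Rint (fun x => \1_(tile 1 n) x * f x) =
  Rint (fun x => \1_D x * ssum n (fun k => f (x + k%:~R))).
Proof.
move=> rf; have [|_ ->] := @tile_Rint R 1 ltr01 n f.
  move=> k; apply: (@rint_bM _ 1); first exact: measurable_indic.
    by move=> x; have /andP[? ?] := indic_ge0_le1 D x; rewrite ger0_norm.
  exact: rint_shift.
congr Rint; apply/funext => x; congr (_ * _).
by apply: eq_ssum => k; rewrite mulr1.
Qed.

Definition int_shift F x (k : int) : R[i] := F (x + k%:~R).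

(* A measurable representative of the sum of the integer translates of [F]. *)
Definition pz F (x : R) : R[i] :=
  Complex (flim (fun n => ssum n (fun k => complex.Re (int_shift F x k))))
          (flim (fun n => ssum n (fun k => complex.Im (int_shift F x k)))).

Lemma pzE F x : abs_summable (int_shift F x) -> pz F x = csum (int_shift F x).
Proof.
by move=> cF; apply: complexP; apply: flimE; [exact: Re_csum_cvg|exact: Im_csum_cvg].
Qed.

Lemma measurable_ssum n (f : int -> R -> R) :
  (forall k, measurable_fun setT (f k)) ->
  measurable_fun setT (fun x => ssum n (fun k => f k x)).
Proof. by move=> mf; apply: measurable_sum => j. Qed.

Lemma cmeas_shift F (c : R) : cmeas F -> cmeas (fun x => F (x + c)).
Proof.
by move=> [mr mi]; split; [apply: (measurableT_comp mr)|apply: (measurableT_comp mi)];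
  exact: measurable_shift.
Qed.

Lemma measurable_pz F : cmeas F -> cmeas (pz F).
Proof.
move=> mF.
have mT (T : R[i] -> R) : (forall c : R, measurable_fun setT (fun x : R => T (F (x + c)))) ->
    measurable_fun setT
      (fun x : R => flim (fun n => ssum n (fun k => T (int_shift F x k)))).
  move=> mTF; apply: (@measurable_flim R (fun n x => ssum n (fun k => T (int_shift F x k)))) => n.
  by apply: (@measurable_ssum n (fun k x => T (int_shift F x k))) => k; exact: mTF.
by split; [apply: (mT (@complex.Re R))|apply: (mT (@complex.Im R))] => c;
  have [] := cmeas_shift c mF.
Qed.

Lemma rint_cutD (f : R -> R) : rint f -> rint (fun x => \1_D x * f x).
Proof.
apply: (@rint_bM _ 1) => [|x]; first exact: measurable_indic.
by have /andP[? ?] := indic_ge0_le1 D x; rewrite ger0_norm.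
Qed.

Lemma rint_ssum (f : R -> R) n : rint f ->
  rint (fun x => ssum n (fun k => f (x + k%:~R))).
Proof. by move=> rf; apply: rint_sum => j _; exact: rint_shift. Qed.

(* The increments of the symmetric partial sums are nonnegative, so Beppo Levi
   applies. *)
Lemma ssum_dominated (N : R -> R) : rint N -> (forall x, 0 <= N x) ->
  exists G : R -> R, [/\ rint G, forall x, 0 <= G x & {ae mu, forall x, D x ->
    ssum n (fun k => N (x + k%:~R)) @[n --> \oo] --> G x}].
Proof.
move=> rN N0.
pose S n x := ssum n (fun k => N (x + k%:~R)).
pose g n x := \1_D x * (if n is m.+1 then S n x - S m x else S 0%N x).
have gS n x : \sum_(i < n.+1) g i x = \1_D x * S n x.
  elim: n => [|n IH]; first by rewrite big_ord1.
  by rewrite big_ord_recr /= IH /g; ring.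
have i0 x : 0 <= (\1_D x : R) by have /andP[] := indic_ge0_le1 D x.
have S0 n x : 0 <= S n x by apply: sumr_ge0.
have rS n : rint (S n) by exact: rint_ssum.
have rg n : rint (g n).
  by case: n => [|n]; apply: rint_cutD => //; exact: rintB.
have [] := @beppo_levi R g (Rint N) rg.
- case=> [|n] x; rewrite mulr_ge0// subr_ge0.
  have ge0 (k : int) : 0 <= N (x + k%:~R) by [].
  exact: (ssum_ndecr ge0 (leqnSn n)).
- case=> [|n]; first by rewrite big_ord0 Rint_ge0.
  rewrite -Rint_sum//; under eq_fun do rewrite gS.
  (* Unfolding identifies the integral over one cell with the integral of [N] over a tile, which is
     at most its integral over the line. *)
  rewrite -tile1_Rint//; apply: le_Rint => // [|x].
    apply: (@rint_bM _ 1) => //; first by apply: measurable_indic; exact: measurable_tile.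
    by move=> x; have /andP[? ?] := indic_ge0_le1 (tile 1 n) x; rewrite ger0_norm.
  by have /andP[? ?] := indic_ge0_le1 (tile 1 n) x; rewrite ler_piMl.
move=> G [rG G0 aG]; exists G; split => //.
apply: ae_imp aG => x Gx Dx.
(* The identity [gS] concerns the first n + 1 increments, hence the shift of the index. *)
rewrite -(cvg_shiftS (fun n => \sum_(i < n) g i x)) in Gx.
move: Gx; rewrite /=; under eq_fun do rewrite gS.
by under eq_fun do rewrite indicE mem_set// mul1r.
Qed.

(** Beppo Levi applied to the modulus of [F] gives summability on one cell; translating x by an
    integer only reindexes the sum. *)
Lemma unfold_abs_summable F : cint F ->
  {ae mu, forall x, abs_summable (int_shift F x)}.
Proof.
move=> cF; apply: ae_periodic.
  move=> x k sx; pose u j := cnorm (int_shift F x j).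
  have u0 j : 0 <= u j by exact: cnorm_ge0.
  apply: (@ge0_ssum_cvg _ _ (limn (fun n => ssum n u))) => [j|n].
    exact: cnorm_ge0.
  have -> : ssum n (fun j => cnorm (int_shift F (x + k%:~R) j)) =
      ssum n (fun j => u (k + j)).
    by apply: eq_ssum => j; rewrite /u /int_shift intrD addrA.
  by apply: le_trans (ssum_shift_le k n u0) _; exact: ssum_le_lim.
have [G [_ _ aG]] := ssum_dominated (cint_norm cF) (fun x => cnorm_ge0 (F x)).
by apply: ae_imp aG => x Gx Dx; apply: cvgP (Gx Dx).
Qed.

Lemma unfold_cintegral F : cint F ->
  cint (cut D (pz F)) /\ cintegral (cut D (pz F)) = cintegral F.
Proof.
move=> cF; have mF := cint_meas cF.
have [G [rG G0 aG]] := ssum_dominated (cint_norm cF) (fun x => cnorm_ge0 (F x)).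
(* [T] stands for the real or the imaginary part, so that both are treated by one argument. *)
have main (T : R[i] -> R) : (forall w, `|T w| <= cnorm w) ->
    (forall x, abs_summable (int_shift F x) ->
       ssum n (fun k => T (int_shift F x k)) @[n --> \oo] --> T (pz F x)) ->
    (forall (t : R) w, T (t%:C%C * w) = t * T w) ->
    measurable_fun setT (fun x => T (pz F x)) ->
    rint (fun x => T (F x)) ->
    rint (fun x => T (cut D (pz F) x)) /\
    Rint (fun x => T (cut D (pz F) x)) = Rint (fun x => T (F x)).
  move=> Tn Tc TZ mT rT.
  have [] := @dominated_Rint R
    (fun n x => \1_D x * ssum n (fun k => T (int_shift F x k)))
    (fun x => \1_D x * T (pz F x)) G.
  - by move=> n; apply: rint_cutD; exact: rint_ssum rT.
  - by apply: measurable_funM => //; exact: measurable_indic.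
  - have := ae_and aG (unfold_abs_summable cF); apply: ae_imp => x [_ sx].
    by apply: cvgMr; exact: Tc.
  - exact: rG.
  - apply: ae_imp aG => x Gx n; rewrite normrM.
    have [Dx|Dx] := pselect (D x); last first.
      by rewrite indicE memNset// normr0 mul0r.
    rewrite indicE mem_set// normr1 mul1r.
    apply: le_trans (ler_norm_ssum n (fun k => Tn _)) _.
    by apply: ssum_le_lim (Gx Dx) => k; exact: cnorm_ge0.
  move=> r1 c1; rewrite (_ : (fun x => T (cut D (pz F) x)) = (fun x => \1_D x * T (pz F x))).
    split => //.
    (* The same sequence has two limits: one by domination on the cell, the other by exhausting the
       line by tiles. *)
    have c2 := tile_Rint_cvg ltr01 rT.
    have E n : Rint (fun x => \1_D x * ssum n (fun k => T (int_shift F x k))) =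
        Rint (fun x => \1_(tile 1 n) x * T (F x)) by rewrite (tile1_Rint n rT).
    rewrite -(funext E) in c2; exact: (cvg_unique (@Rhausdorff R) c1 c2).
  by apply/funext => x; rewrite TZ.
have [mr mi] := measurable_pz mF; have [rr ri] := cF.
have [||||//|r1 e1] := main (@complex.Re R).
- exact: Re_cnorm.
- by move=> x sx; rewrite pzE//; exact: Re_csum_cvg.
- by move=> t w; rewrite cE /=; ring.
- exact: mr.
have [||||//|r2 e2] := main (@complex.Im R).
- exact: Im_cnorm.
- by move=> x sx; rewrite pzE//; exact: Im_csum_cvg.
- by move=> t w; rewrite cE /=; ring.
- exact: mi.
by split; [split|apply: complexP].
Qed.

End Periodization.

(** * Fourier transform *)

Section Plancherel.
Context {R : realType}.
Local Notation mu := (@lebesgue_measure R).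
Implicit Types (u f g : R -> R[i]) (xi : R).
Local Notation FI := fourier_integral.

Definition phase xi (x : R) : R[i] := cexp (- (2 * pi * x * xi)).

Lemma sqn_phase xi x : sqn (phase xi x) = 1. Proof. exact: sqn_cexp. Qed.

Lemma measurable_phase xi : cmeas (phase xi).
Proof.
have mlin : measurable_fun setT (fun x : R => - (2 * pi * x * xi)).
  by apply: rmeasN; do 2 apply: measurable_funM => //.
split; apply: (measurableT_comp _ mlin); apply: continuous_measurable_fun.
  exact: continuous_cos.
exact: continuous_sin.
Qed.

Lemma cint_phase u xi : cint u -> cint (fun x => u x * phase xi x).
Proof.
move=> cu; under eq_fun do rewrite mulrC.
apply: (@cint_bM _ 1) cu => [|x]; first exact: measurable_phase.
by rewrite sqn_phase.
Qed.

Lemma L2_phase u xi : L2 u -> L2 (fun x => u x * phase xi x).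
Proof.
move=> cu; under eq_fun do rewrite mulrC.
apply: (@L2_bM _ 1) cu => [|x]; first exact: measurable_phase.
by rewrite sqn_phase.
Qed.

Lemma FI_D u v xi : cint u -> cint v ->
  FI (fun x => u x + v x) xi = FI u xi + FI v xi.
Proof.
move=> cu cv; rewrite /FI -cintegralD; [|exact: cint_phase|exact: cint_phase].
by congr cintegral; apply/funext => x; rewrite mulrDl.
Qed.

Lemma FI_Z (a : R[i]) u xi : cint u -> FI (fun x => a * u x) xi = a * FI u xi.
Proof.
move=> cu; rewrite /FI -cintegralZ; last exact: cint_phase.
by congr cintegral; apply/funext => x; rewrite mulrA.
Qed.

Lemma FI_B u v xi : cint u -> cint v ->
  FI (fun x => u x - v x) xi = FI u xi - FI v xi.
Proof.
move=> cu cv; rewrite -[- FI v xi]mulN1r -FI_Z// -FI_D//; last exact: cintZ.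
by congr (FI _ _); apply/funext => x; rewrite mulN1r.
Qed.

Lemma cintegral_shift f (c : R) : cint f ->
  cint (fun x => f (x + c)) /\ cintegral (fun x => f (x + c)) = cintegral f.
Proof.
move=> [rr ri]; split.
  by split; [exact: (rint_shift c rr)|exact: (rint_shift c ri)].
by apply: complexP; [exact: (Rint_shift c rr)|exact: (Rint_shift c ri)].
Qed.

Lemma nsq_shift f (c : R) : L2 f ->
  L2 (fun x => f (x + c)) /\ nsq (fun x => f (x + c)) = nsq f.
Proof.
move=> Lf; have rf := L2_rint Lf; split; last exact: (Rint_shift c rf).
by apply/L2E; split; [exact/cmeas_shift/L2_meas|exact: (rint_shift c rf)].
Qed.

Lemma FI_translate (k : int) u xi : cint u ->
  FI (translate k u) xi = chi 1 k xi * FI u xi.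
Proof.
move=> cu; rewrite /FI -cintegralZ; last exact: cint_phase.
have cg : cint (fun x => chi 1 k xi * (u x * phase xi x)) by exact/cintZ/cint_phase.
have [_ <-] := cintegral_shift (- k%:~R) cg.
congr cintegral; apply/funext => x; rewrite /translate /phase mulrCA; congr (_ * _).
by rewrite /chi -cexpD; congr cexp; field.
Qed.

Lemma FI_bounded u xi : cint u ->
  sqn (FI u xi) <= 2 * Rint (fun x => cnorm (u x)) ^+ 2.
Proof.
move=> cu; have [rr ri] := cint_phase xi cu.
have nE x : cnorm (u x * phase xi x) = cnorm (u x).
  by rewrite cnormM [cnorm (phase xi x)]cnormE sqn_phase sqrtr1 mulr1.
have bnd (f : R -> R) : rint f -> (forall x, `|f x| <= cnorm (u x)) ->
    Rint f ^+ 2 <= Rint (fun x => cnorm (u x)) ^+ 2.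
  move=> rf fu; rewrite -(real_normK (num_real (Rint f))) ler_sqr ?nnegrE//; last first.
    by apply: Rint_ge0 => x; exact: cnorm_ge0.
  apply: le_trans (le_normr_Rintegral measurableT rf) _.
  by apply: le_Rint => //; [exact: rint_norm|exact: cint_norm].
have hr : Rint (fun x => complex.Re (u x * phase xi x)) ^+ 2 <=
    Rint (fun x => cnorm (u x)) ^+ 2.
  by apply: bnd rr _ => x; rewrite -nE; exact: Re_cnorm.
have hi : Rint (fun x => complex.Im (u x * phase xi x)) ^+ 2 <=
    Rint (fun x => cnorm (u x)) ^+ 2.
  by apply: bnd ri _ => x; rewrite -nE; exact: Im_cnorm.
by rewrite /sqn mulr_natl mulr2n lerD.
Qed.

(** The transform is continuous: its integrand is continuous in the frequency and dominated by the
    modulus of [u]. *)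
Lemma FI_measurable u : cint u -> cmeas (FI u).
Proof.
move=> cu.
have cont (T : R[i] -> R) : (forall w, `|T w| <= cnorm w) ->
    (forall x, continuous (fun xi => T (u x * phase xi x))) ->
    (forall xi, rint (fun x => T (u x * phase xi x))) ->
    measurable_fun setT (fun xi => Rint (fun x => T (u x * phase xi x))).
  move=> Tn Tc Tr; apply: continuous_measurable_fun => xi.
  apply: (@continuity_under_integral _ _ _ mu (fun xi x => T (u x * phase xi x))
    setT measurableT (xi - 1) (xi + 1) _ _ (fun x => cnorm (u x))).
  - by move=> x _; exact: Tr.
  - by apply: ae_all => x _ y _; exact: Tc.
  - exact: cint_norm.
  - move=> x _; apply: ae_all => y _; apply: le_trans (Tn _) _.
    by rewrite cnormM [cnorm (phase x y)]cnormE sqn_phase sqrtr1 mulr1.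
  - by rewrite inE /= in_itv /=; lra.
have ccos x : continuous (fun xi : R => cos (- (2 * pi * x * xi))).
  move=> xi; apply: continuous_comp; last exact: continuous_cos.
  by apply: continuousN; apply: continuousM; [exact: cvg_cst|exact: cvg_id].
have csin x : continuous (fun xi : R => sin (- (2 * pi * x * xi))).
  move=> xi; apply: continuous_comp; last exact: continuous_sin.
  by apply: continuousN; apply: continuousM; [exact: cvg_cst|exact: cvg_id].
split.
  apply: (cont (@complex.Re R)); first exact: Re_cnorm.
    move=> x xi.
    have -> : (fun xi => complex.Re (u x * phase xi x)) = (fun xi =>
        complex.Re (u x) * cos (- (2 * pi * x * xi)) -
        complex.Im (u x) * sin (- (2 * pi * x * xi))).
      by apply/funext => y; rewrite cE.
    by apply: cvgB; apply: cvgMr; [exact: ccos|exact: csin].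
  by move=> xi; have [] := cint_phase xi cu.
apply: (cont (@complex.Im R)); first exact: Im_cnorm.
  move=> x xi.
  have -> : (fun xi => complex.Im (u x * phase xi x)) = (fun xi =>
      complex.Re (u x) * sin (- (2 * pi * x * xi)) +
      complex.Im (u x) * cos (- (2 * pi * x * xi))).
    by apply/funext => y; rewrite cE.
  by apply: cvgD; apply: cvgMr; [exact: csin|exact: ccos].
by move=> xi; have [] := cint_phase xi cu.
Qed.

(* Parseval on the period [L] at each of the points [xi + k / L], integrated
   over [xi] in an interval of length [1 / L]. *)
Lemma plancherel_compact (a L : R) u : 0 < L -> cint u -> L2 u ->
  (forall x, ~ `[a, a + L[%classic x -> u x = 0) ->
  L2 (FI u) /\ nsq (FI u) = nsq u.
Proof.
move=> L0 cu Lu u0; set s := L^-1; have s0 : 0 < s by rewrite invr_gt0.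
pose D : set R := `[- (s / 2), - (s / 2) + s[%classic.
(* The inner product conjugates [ec k]; conjugating the integrand too makes the k-th coefficient the
   conjugate of the transform at xi + k / L. *)
pose w xi x := conjc (u x * phase xi x).
have Lw xi : L2 (w xi) by exact/L2J/L2_phase.
have w0 xi x : ~ `[a, a + L[%classic x -> w xi x = 0.
  by move=> Dx; rewrite /w u0// mul0r conjc0.
have nw xi : nsq (w xi) = nsq u.
  by congr Rint; apply/funext => x; rewrite sqnJ sqnM sqn_phase mulr1.
have FIE xi (k : int) : sqn (FI u (xi + k%:~R * s)) = sqn (fcoef a L (w xi) k).
  rewrite -sqnJ -cintegralJ; last exact: cint_phase.
  congr (sqn (cintegral _)); apply/funext => x.
  have [Dx|Dx] := pselect (`[a, a + L[%classic x); last first.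
    by rewrite u0// mul0r conjc0 w0// mul0r.
  rewrite /ec cutE// /w -conjcM; congr conjc; rewrite -[RHS]mulrA; congr (_ * _).
  rewrite /phase /chi -cexpD; congr cexp; rewrite /s; field.
  by rewrite gt_eqF.
pose g xi := sqn (FI u xi).
have mF := FI_measurable cu.
have mg : measurable_fun setT g by exact: measurable_sqn.
have g0 xi : 0 <= g xi by exact: sqn_ge0.
pose S n xi := ssum n (fun k => g (xi + k%:~R * s)).
have SE n xi : S n xi = ssum n (fun k => sqn (fcoef a L (w xi) k)).
  by apply: eq_ssum => k; exact: FIE.
(* Bessel's inequality supplies a majorant uniform in n and xi, and Parseval's identity the limit at
   every xi. *)
have Sle n xi : S n xi <= L * nsq u by rewrite SE -(nw xi); exact: bessel.
have S0 n xi : 0 <= S n xi by apply: sumr_ge0.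
have Scvg xi : S n xi @[n --> \oo] --> L * nsq u.
  have [_] := parseval L0 (Lw xi) (w0 xi).
  by rewrite nw; under eq_fun do rewrite -SE.
have rD : rint (\1_D : R -> R) by exact: rint_indic.
have rDc (c : R) : rint (fun x => \1_D x * c).
  have := rintZ c rD; congr rint; apply/funext => x; exact: mulrC.
have D01 x : 0 <= (\1_D x : R) <= 1 by exact: indic_ge0_le1.
have rgk (k : int) : rint (fun x => \1_D x * g (x + k%:~R * s)).
  under eq_fun do rewrite mulrC.
  apply: (@rint_bM _ (2 * Rint (fun x => cnorm (u x)) ^+ 2)) rD.
    exact: (measurableT_comp mg (measurable_shift _)).
  by move=> x; rewrite ger0_norm//; exact: FI_bounded.
have RD : Rint (\1_D : R -> R) = s.
  by rewrite Rint_indic ?lerDl ?ltW// addrAC subrr add0r.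
have tileE n := tile_Rint s0 n rgk.
have rS n : rint (fun x => \1_D x * S n x).
  rewrite /S; under eq_fun do rewrite mulr_sumr.
  by apply: rint_sum => j _; exact: rgk.
have IS : Rint (fun x => \1_D x * S n x) @[n --> \oo] --> nsq u.
  have -> : nsq u = Rint (fun x => \1_D x * (L * nsq u)).
    under eq_fun do rewrite mulrC; rewrite RintZ// RD /s.
    by rewrite mulrAC divff ?gt_eqF// mul1r.
  have [] // := @dominated_Rint R (fun n x => \1_D x * S n x)
    (fun x => \1_D x * (L * nsq u)) (fun x => \1_D x * (L * nsq u)).
  - by apply: measurable_funM => //; exact: rint_meas.
  - by apply: ae_all => x; apply: cvgMr; exact: Scvg.
  - apply: ae_all => x n; have /andP[i0 _] := D01 x.
    by rewrite ger0_norm ?mulr_ge0// ler_wpM2l.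
(* Fatou's lemma along the tiles first makes [g] integrable; only then do its integrals over the
   tiles converge to the integral over the line. *)
have [rg gle] : rint g /\ Rint g <= nsq u.
  apply: (@fatou_cvg R (fun n x => \1_(tile s n) x * g x)) => //.
  - by move=> n; have [] := tileE n.
  - by move=> n x; rewrite mulr_ge0//; have /andP[] := indic_ge0_le1 (tile s n) x.
  - apply: ae_all => x; rewrite -[X in _ --> X]mul1r; apply: cvgMl.
    exact: cvg_tile.
  apply: nearW => n; have [_ ->] := tileE n.
  have -> : nsq u = Rint (fun x => \1_D x * (L * nsq u)).
    under eq_fun do rewrite mulrC; rewrite RintZ// RD /s.
    by rewrite mulrAC divff ?gt_eqF// mul1r.
  apply: le_Rint; [exact: rS|exact: rDc|move=> x].
  by have /andP[i0 _] := D01 x; apply: ler_wpM2l => //; exact: Sle.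
split; first by apply/L2E.
have c2 := tile_Rint_cvg s0 rg.
have E n : Rint (fun x => \1_(tile s n) x * g x) = Rint (fun x => \1_D x * S n x).
  by have [_] := tileE n.
rewrite (funext E) in c2; exact: (cvg_unique (@Rhausdorff R) c2 IS).
Qed.

Definition trunc n f : R -> R[i] := cut (tile 1 n) f.

Lemma trunc_L2 n f : L2 f -> L2 (trunc n f).
Proof. by apply: L2_cut; exact: measurable_tile. Qed.

Lemma trunc_cint n f : cint f -> cint (trunc n f).
Proof. by apply: cint_cut; exact: measurable_tile. Qed.

Lemma trunc_L2_cint n f : L2 f -> cint (trunc n f).
Proof.
move=> Lf.
have L1 : L2 (trunc n (fun=> 1)).
  by apply: (@L2_cut_bounded _ 1); [exact: cmeas_cst|move=> x; rewrite sqn1].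
have := L2_cintM L1 Lf; congr cint; apply/funext => x.
by rewrite /trunc /cut mulr1.
Qed.

Lemma sqn_truncB n f x : sqn (trunc n f x - f x) = (1 - \1_(tile 1 n) x) * sqn (f x).
Proof.
rewrite /trunc; have [Dx|Dx] := pselect (tile 1 n x).
  by rewrite cutE// subrr sqn0 indicE mem_set// subrr mul0r.
by rewrite cutN// sub0r sqnN indicE memNset// subr0 mul1r.
Qed.

Lemma trunc_cvg f : L2 f -> nsq (fun x => trunc n f x - f x) @[n --> \oo] --> 0.
Proof.
move=> Lf; have rf := L2_rint Lf.
have i01 n (x : R) : 0 <= (\1_(tile (1 : R) n) x : R) <= 1 by exact: indic_ge0_le1.
have [|||||_] := @dominated_Rint R (fun n x => sqn (trunc n f x - f x)) (fun=> 0)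
  (fun x => sqn (f x)).
- by move=> n; apply/L2_rint/L2B => //; exact: trunc_L2.
- exact: measurable_cst.
- apply: ae_all => x.
  have c1 : 1 - \1_(tile 1 n) x @[n --> \oo] --> (1 - 1 : R).
    by apply: cvgB; [exact: cvg_cst|exact: cvg_tile].
  have c2 : (1 - \1_(tile 1 n) x) * sqn (f x) @[n --> \oo] -->
      (1 - 1) * sqn (f x) by exact: cvgMl.
  rewrite subrr mul0r in c2; apply: cvg_trans c2; apply: near_eq_cvg.
  by apply: nearW => n /=; rewrite sqn_truncB.
- exact: rf.
- apply: ae_all => x n; rewrite ger0_norm ?sqn_ge0// sqn_truncB.
  by have /andP[? ?] := i01 n x; rewrite ler_piMl ?sqn_ge0//; lra.
by rewrite Rint0.
Qed.

Lemma trunc_FI_cvg u xi : cint u ->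
  complex.Re (FI (trunc n u) xi) @[n --> \oo] --> complex.Re (FI u xi) /\
  complex.Im (FI (trunc n u) xi) @[n --> \oo] --> complex.Im (FI u xi).
Proof.
move=> cu; have [rr ri] := cint_phase xi cu.
have E n : (fun x => trunc n u x * phase xi x) =
    (fun x => (\1_(tile 1 n) x)%:C%C * (u x * phase xi x)).
  by apply/funext => x; rewrite mulrA.
split.
  apply: cvg_trans (tile_Rint_cvg ltr01 rr); apply: near_eq_cvg.
  apply: nearW => n; rewrite /fourier_integral -/(phase xi).
  rewrite -[RHS]/(Rint (fun x => complex.Re (trunc n u x * phase xi x))).
  by congr Rint; apply/funext => x; rewrite -ReZ -(congr1 (@^~ x) (E n)).
apply: cvg_trans (tile_Rint_cvg ltr01 ri); apply: near_eq_cvg.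
apply: nearW => n; rewrite /fourier_integral -/(phase xi).
rewrite -[RHS]/(Rint (fun x => complex.Im (trunc n u x * phase xi x))).
by congr Rint; apply/funext => x; rewrite -ImZ -(congr1 (@^~ x) (E n)).
Qed.

Lemma plancherel_trunc n u : cint u -> L2 u ->
  L2 (FI (trunc n u)) /\ nsq (FI (trunc n u)) = nsq (trunc n u).
Proof.
move=> cu Lu.
apply: (@plancherel_compact (- (n%:R + 2^-1)) (2 * (n%:R + 2^-1))).
- by rewrite mulr_gt0// ltr_wpDl.
- exact: trunc_cint.
- exact: trunc_L2.
move=> x Dx; rewrite /trunc cutN// => Tx; apply: Dx; move: Tx.
rewrite /tile /= !in_itv /= !mulr1 => /andP[-> /=]; lra.
Qed.

Lemma nsq_trunc_le n u : L2 u -> nsq (trunc n u) <= nsq u.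
Proof.
move=> Lu; apply: le_Rint => [||x]; [exact/L2_rint/trunc_L2|exact: L2_rint|].
by rewrite sqn_cut ler_piMl ?sqn_ge0//; have /andP[] := indic_ge0_le1 (tile 1 n) x.
Qed.

(** Fatou's lemma over the truncations yields an inequality only. Applied to differences it makes
    the transform continuous in the mean, which upgrades it to an equality. *)
Lemma plancherel_le u : cint u -> L2 u -> L2 (FI u) /\ nsq (FI u) <= nsq u.
Proof.
move=> cu Lu; have mF := FI_measurable cu.
have [rF Fle] : rint (fun xi => sqn (FI u xi)) /\ nsq (FI u) <= nsq u.
  apply: (@fatou_cvg R (fun n xi => sqn (FI (trunc n u) xi))).
  - by move=> n; have [/L2_rint] := plancherel_trunc n cu Lu.
  - by move=> n x; exact: sqn_ge0.
  - exact: measurable_sqn.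
  - by move=> x; exact: sqn_ge0.
  - apply: ae_all => xi; have [cr ci] := trunc_FI_cvg xi cu.
    rewrite /sqn; apply: cvgD; under eq_fun do rewrite expr2; rewrite expr2;
      exact: cvgM.
  apply: nearW => n; have [_ E] := plancherel_trunc n cu Lu.
  by rewrite -/(nsq (FI (trunc n u))) E; exact: nsq_trunc_le.
by split => //; apply/L2E.
Qed.

Theorem plancherel u : cint u -> L2 u -> L2 (FI u) /\ nsq (FI u) = nsq u.
Proof.
move=> cu Lu; have [LF _] := plancherel_le cu Lu; split => //.
have LFn n : L2 (FI (trunc n u)) by have [] := plancherel_trunc n cu Lu.
(* The inequality is applied to the integrable function [trunc n u - u]. *)
have cF : nsq (fun xi => FI (trunc n u) xi - FI u xi) @[n --> \oo] --> 0.
  apply: (@squeeze_cvgr _ _ _ _ (fun=> 0) (fun n => nsq (fun x => trunc n u x - u x)));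
    [|exact: cvg_cst|exact: trunc_cvg].
  apply: nearW => n; rewrite nsq_ge0 /=.
  have cd : cint (fun x => trunc n u x - u x).
    have := cintD (trunc_cint n cu) (cintZ (-1) cu).
    by congr cint; apply/funext => x; rewrite mulN1r.
  have [_] := plancherel_le cd (L2B (trunc_L2 n Lu) Lu).
  by congr (nsq _ <= _); apply/funext => xi; rewrite FI_B//; exact: trunc_cint.
have c1 := nsq_cvg LFn LF cF.
have c2 := nsq_cvg (fun n => trunc_L2 n Lu) Lu (trunc_cvg Lu).
have E n : nsq (FI (trunc n u)) = nsq (trunc n u).
  by have [] := plancherel_trunc n cu Lu.
rewrite (funext E) in c1; exact: (cvg_unique (@Rhausdorff R) c1 c2).
Qed.

End Plancherel.

(** * Extension of the transform to all square-integrable functions *)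

Section FourierTransform.
Context {R : realType}.
Local Notation mu := (@lebesgue_measure R).
Implicit Types (f g : R -> R[i]).
Local Notation FI := fourier_integral.

(** Restates the graph closure with real squared norms. Plancherel's theorem enters in showing that
    the transforms of the approximants are square integrable. *)
Lemma is_fourierE f g : is_fourier f g <-> [/\ L2 f, L2 g & exists u : nat -> R -> R[i],
  [/\ forall n, cint (u n) /\ L2 (u n),
      nsq (fun x => u n x - f x) @[n --> \oo] --> 0 &
      nsq (fun x => FI (u n) x - g x) @[n --> \oo] --> 0]].
Proof.
split=> -[Lf Lg [u [Hu uf ug]]]; split => //; exists u.
  have Hu' n : cint (u n) /\ L2 (u n) by have [/L1E] := Hu n.
  have Lu n : L2 (u n) by have [] := Hu' n.
  have LF n : L2 (FI (u n)) by have [c l] := Hu' n; have [] := plancherel c l.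
  by split => //; [move/(cvgL2E Lu Lf) : uf|move/(cvgL2E LF Lg) : ug].
have Lu n : L2 (u n) by have [] := Hu n.
have LF n : L2 (FI (u n)) by have [c l] := Hu n; have [] := plancherel c l.
split => //; [|exact/(cvgL2E Lu Lf)|exact/(cvgL2E LF Lg)].
by move=> n; have [? ?] := Hu n; split => //; apply/L1E.
Qed.

Lemma nsq_lin_cvg (a : R[i]) (u v : nat -> R -> R[i]) f g :
  (forall n, L2 (u n)) -> (forall n, L2 (v n)) -> L2 f -> L2 g ->
  nsq (fun x => u n x - f x) @[n --> \oo] --> 0 ->
  nsq (fun x => v n x - g x) @[n --> \oo] --> 0 ->
  nsq (fun x => a * u n x + v n x - (a * f x + g x)) @[n --> \oo] --> 0.
Proof.
move=> Lu Lv Lf Lg uf vg.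
apply: (@squeeze_cvgr _ _ _ _ (fun=> 0) (fun n =>
  2 * sqn a * nsq (fun x => u n x - f x) + 2 * nsq (fun x => v n x - g x))).
- apply: nearW => n; rewrite nsq_ge0 /=.
  have -> : (fun x => a * u n x + v n x - (a * f x + g x)) =
      (fun x => a * (u n x - f x) + (v n x - g x)).
    by apply/funext => x; ring.
  have Luf : L2 (fun x => u n x - f x) by exact: L2B.
  have Lvg : L2 (fun x => v n x - g x) by exact: L2B.
  by apply: le_trans (nsqD_le (L2Z a Luf) Lvg) _; rewrite nsqZ// mulrA.
- exact: cvg_cst.
rewrite -(addr0 (0 : R)) -[X in X + _](mulr0 (2 * sqn a)) -[X in _ + X](mulr0 2).
by apply: cvgD; exact: cvgMr.
Qed.

Lemma is_fourier_lin (a : R[i]) f1 g1 f2 g2 : is_fourier f1 g1 -> is_fourier f2 g2 ->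
  is_fourier (fun x => a * f1 x + f2 x) (fun x => a * g1 x + g2 x).
Proof.
move=> /is_fourierE[Lf1 Lg1 [u [Hu uf ug]]] /is_fourierE[Lf2 Lg2 [v [Hv vf vg]]].
have Lu n : L2 (u n) by have [] := Hu n.
have Lv n : L2 (v n) by have [] := Hv n.
have LFu n : L2 (FI (u n)) by have [c l] := Hu n; have [] := plancherel c l.
have LFv n : L2 (FI (v n)) by have [c l] := Hv n; have [] := plancherel c l.
apply/is_fourierE; split; [by apply: L2D => //; exact: L2Z|by apply: L2D => //; exact: L2Z|].
exists (fun n x => a * u n x + v n x); split.
- move=> n; have [cu _] := Hu n; have [cv _] := Hv n; split.
    by apply: cintD => //; exact: cintZ.
  by apply: L2D => //; exact: L2Z.
- exact: nsq_lin_cvg.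
have := nsq_lin_cvg a LFu LFv Lg1 Lg2 ug vg.
apply: cvg_trans; apply: near_eq_cvg; apply: nearW => n.
have [cu _] := Hu n; have [cv _] := Hv n.
by congr nsq; apply/funext => x; rewrite FI_D ?FI_Z//; exact: cintZ.
Qed.

Lemma is_fourier0 : is_fourier (fun=> 0 : R[i]) (fun=> 0).
Proof.
apply/is_fourierE; split; [exact: L2_0|exact: L2_0|exists (fun n => fun=> 0)].
have z : nsq (fun=> 0 - 0 : R[i]) = 0.
  by rewrite /nsq; under eq_fun do rewrite subr0 sqn0; exact: Rint0.
split.
- by move=> n; split; [exact: cint0|exact: L2_0].
- by rewrite z; exact: cvg_cst.
have -> : (fun n : nat => nsq (fun x => FI (fun=> 0) x - 0 : R[i])) = (fun n => 0).
  apply/funext => n; rewrite -[RHS]z; congr nsq; apply/funext => x.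
  rewrite /fourier_integral; under eq_fun do rewrite mul0r.
  by rewrite cintegral0.
exact: cvg_cst.
Qed.

Lemma is_fourier_sum I (s : seq I) (F G : I -> R -> R[i]) (a : I -> R[i]) :
  (forall i, is_fourier (F i) (G i)) ->
  is_fourier (fun x => \sum_(i <- s) a i * F i x) (fun x => \sum_(i <- s) a i * G i x).
Proof.
move=> FG; elim: s => [|i s IH].
  have := is_fourier0; congr is_fourier; apply/funext => x; by rewrite big_nil.
have := is_fourier_lin (a i) (FG i) IH.
by congr is_fourier; apply/funext => x; rewrite big_cons.
Qed.

Lemma is_fourier_translate (k : int) f g : is_fourier f g ->
  is_fourier (translate k f) (fun xi => chi 1 k xi * g xi).
Proof.
move=> /is_fourierE[Lf Lg [u [Hu uf ug]]].
have mk := measurable_chi (1 : R) k.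
have k1 x : sqn (chi 1 k x : R[i]) <= 1 by rewrite sqn_chi.
apply/is_fourierE; split.
- by have [] := nsq_shift (- k%:~R) Lf.
- exact: (L2_bM mk k1 Lg).
exists (fun n => translate k (u n)); split.
- move=> n; have [cu Lu] := Hu n.
  by split; [have [] := cintegral_shift (- k%:~R) cu|have [] := nsq_shift (- k%:~R) Lu].
- apply: cvg_trans uf; apply: near_eq_cvg; apply: nearW => n.
  have [_ Lu] := Hu n.
  by have [_ /esym] := nsq_shift (- k%:~R) (L2B Lu Lf).
apply: cvg_trans ug; apply: near_eq_cvg; apply: nearW => n.
have [cu _] := Hu n; congr Rint; apply/funext => x.
by rewrite FI_translate// -mulrBr sqnM sqn_chi mul1r.
Qed.

Lemma is_fourier_nsq f g : is_fourier f g -> nsq g = nsq f.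
Proof.
move=> /is_fourierE[Lf Lg [u [Hu uf ug]]].
have Lu n : L2 (u n) by have [] := Hu n.
have LFu n : L2 (FI (u n)) by have [c l] := Hu n; have [] := plancherel c l.
have E n : nsq (FI (u n)) = nsq (u n) by have [c l] := Hu n; have [] := plancherel c l.
have c1 := nsq_cvg LFu Lg ug; have c2 := nsq_cvg Lu Lf uf.
rewrite (funext E) in c1; exact: (cvg_unique (@Rhausdorff R) c1 c2).
Qed.

(** The combinations have the shape [a * g x + f x] of [is_fourier_lin], so preservation of norms
    yields preservation of inner products. *)
Lemma polarization f g : L2 f -> L2 g ->
  inner f g = Complex ((nsq (fun x => 1 * g x + f x) - nsq f - nsq g) / 2)
    ((nsq (fun x => 'i%C * g x + f x) - nsq f - nsq g) / 2).
Proof.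
move=> Lf Lg; have Ii : sqn ('i%C : R[i]) = 1.
  by rewrite /sqn /= expr0n expr1n add0r.
have Re_i (z : R[i]) : complex.Re ('i%C * conjc z) = complex.Im z.
  by case: z => x y /=; ring.
apply: complexP; rewrite [RHS]/=.
  rewrite nsqD ?nsqZ ?innerZl//; last exact: L2Z.
  by rewrite [inner g f]innerC// mul1r ReJ sqn1; field.
rewrite nsqD ?nsqZ ?innerZl//; last exact: L2Z.
by rewrite [inner g f]innerC// Re_i Ii; field.
Qed.

Lemma is_fourier_inner f1 g1 f2 g2 : is_fourier f1 g1 -> is_fourier f2 g2 ->
  inner g1 g2 = inner f1 f2.
Proof.
move=> h1 h2; have [Lf1 Lg1 _] := h1; have [Lf2 Lg2 _] := h2.
rewrite (polarization Lg1 Lg2) (polarization Lf1 Lf2).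
by rewrite (is_fourier_nsq h1) (is_fourier_nsq h2)
  (is_fourier_nsq (is_fourier_lin 1 h2 h1)) (is_fourier_nsq (is_fourier_lin 'i%C h2 h1)).
Qed.

(** Truncations are integrable and converge in the mean. Plancherel's theorem on their differences
    makes the transforms a Cauchy sequence. *)
Lemma is_fourier_exists f : L2 f -> exists g, is_fourier f g.
Proof.
move=> Lf; pose u n := trunc n f.
have cu n : cint (u n) by exact: trunc_L2_cint.
have Lu n : L2 (u n) by exact: trunc_L2.
have LFu n : L2 (FI (u n)) by have [] := plancherel (cu n) (Lu n).
have uf := trunc_cvg Lf.
have [g Lg ug] : exists2 g, L2 g & nsq (fun x => FI (u n) x - g x) @[n --> \oo] --> 0.
  apply: riesz_fischer => // e e0.
  (* Two distances of at most e / 4 each enter with the factor 2 of [nsqD_le]. *)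
  have e4 : 0 < e / 4 by rewrite divr_gt0.
  have [N _ HN] : \forall n \near \oo, `|nsq (fun x => u n x - f x)| <= e / 4.
    by move/cvgr0Pnorm_le : uf; apply.
  exists N => m n Nm Nn.
  have cmn : cint (fun x => u m x - u n x).
    have := cintD (cu m) (cintZ (-1) (cu n)).
    by congr cint; apply/funext => x; rewrite mulN1r.
  have -> : (fun x => FI (u m) x - FI (u n) x) = FI (fun x => u m x - u n x).
    by apply/funext => x; rewrite FI_B.
  have [_ ->] := plancherel cmn (L2B (Lu m) (Lu n)).
  have -> : (fun x => u m x - u n x) = (fun x => (u m x - f x) + (f x - u n x)).
    by apply/funext => x; rewrite addrA subrK.
  apply: le_trans (nsqD_le (L2B (Lu m) Lf) (L2B Lf (Lu n))) _.
  rewrite (nsq_distC f (u n)).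
  have := HN m Nm; have := HN n Nn => /=.
  rewrite !ger0_norm ?nsq_ge0// => h1 h2; lra.
by exists g; apply/is_fourierE; split => //; exists u; split.
Qed.

Lemma fourierP f : L2 f -> is_fourier f (fourier f).
Proof. by move=> /is_fourier_exists[g fg]; exact: (xgetPex (fun=> 0) (ex_intro _ g fg)). Qed.

End FourierTransform.

(** * Frames of translates *)

Section ShiftedSums.
Context {R : realType}.

Lemma ge0_ssum_shift (u : int -> R) (j : int) (l : R) : (forall k, 0 <= u k) ->
  ssum n u @[n --> \oo] --> l ->
  ssum n (fun k => u (j + k)) @[n --> \oo] --> l.
Proof.
move=> u0 ul.
(* A shift cannot increase the sum of a nonnegative family; shifting back gives the opposite
   inequality. *)
have half (v : int -> R) (i : int) (t : R) : (forall k, 0 <= v k) ->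
    ssum n v @[n --> \oo] --> t ->
    exists2 t', ssum n (fun k => v (i + k)) @[n --> \oo] --> t' & t' <= t.
  move=> v0 vt.
  have le n : ssum n (fun k => v (i + k)) <= t.
    by apply: le_trans (ssum_shift_le i n v0) _; exact: ssum_le_lim.
  have cv := ge0_ssum_cvg (fun k => v0 (i + k)) le.
  exists (limn (fun n => ssum n (fun k => v (i + k)))) => //.
  by apply: limr_le => //; exact: nearW.
have [t' ct' t'l] := half u j l u0 ul.
have [t cl lt'] := half _ (- j) t' (fun k => u0 (j + k)) ct'.
have lE : t = l.
  apply: (cvg_unique (@Rhausdorff R) cl).
  apply: cvg_trans ul; apply: near_eq_cvg; apply: nearW => n.
  by apply: eq_ssum => k; rewrite addrA subrr add0r.
suff -> : l = t' by [].
by apply: le_anti; rewrite t'l andbT -lE.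
Qed.

(** Symmetric windows are not invariant under shifts; absolute convergence reduces the claim to the
    nonnegative families |u| + u and |u|. *)
Lemma ssum_shift_cvg (u : int -> R) (j : int) (l : R) :
  cvgn (fun n => ssum n (fun k => `|u k|)) ->
  ssum n u @[n --> \oo] --> l ->
  ssum n (fun k => u (j + k)) @[n --> \oo] --> l.
Proof.
move=> cu ul; set b := limn _ in cu.
have pos k : 0 <= `|u k| + u k by rewrite -lerBlDr sub0r -normrN ler_norm.
have h1 := ge0_ssum_shift j (fun k => normr_ge0 (u k)) cu.
have h2 : ssum n (fun k => `|u k| + u k) @[n --> \oo] --> b + l.
  by under eq_fun do rewrite ssumD; exact: cvgD.
have h3 := ge0_ssum_shift j pos h2.
rewrite (_ : l = b + l - b); last by rewrite addrAC subrr add0r.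
have h4 : ssum n (fun k => `|u (j + k)| + u (j + k)) - ssum n (fun k => `|u (j + k)|)
    @[n --> \oo] --> b + l - b by exact: cvgB.
apply: cvg_trans h4; apply: near_eq_cvg; apply: nearW => n.
by rewrite ssumD addrAC subrr add0r.
Qed.

Lemma abs_summable_shift (z : int -> R[i]) (j : int) : abs_summable z ->
  abs_summable (fun k => z (j + k)).
Proof.
by move=> cz; apply: (cvgP _ (ge0_ssum_shift j (fun k => cnorm_ge0 (z k)) cz)).
Qed.

Lemma csum_shift (z : int -> R[i]) (j : int) : abs_summable z ->
  csum (fun k => z (j + k)) = csum z.
Proof.
move=> cz; have cs := @abs_summable_shift z j cz.
apply: complexP.
  apply: (cvg_unique (@Rhausdorff R) (Re_csum_cvg cs)).
  apply: (@ssum_shift_cvg (fun k => complex.Re (z k))); last exact: Re_csum_cvg.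
  by apply: ge0_ssum_cvg_le cz => // k; exact: Re_cnorm.
apply: (cvg_unique (@Rhausdorff R) (Im_csum_cvg cs)).
apply: (@ssum_shift_cvg (fun k => complex.Im (z k))); last exact: Im_csum_cvg.
by apply: ge0_ssum_cvg_le cz => // k; exact: Im_cnorm.
Qed.

End ShiftedSums.

(** * Brackets as periodized products *)

Section Brackets.
Context {R : realType}.
Local Notation mu := (@lebesgue_measure R).
Local Notation D := `[- (1 / 2) : R, - (1 / 2) + 1[%classic.
Implicit Types (f g m p q : R -> R[i]).

(** Having period 1, [m] factors out of the sum of translates, which moves integrals from the line
    to the period. *)
Lemma unfold_periodic m F : trigpoly 1 m -> cint F ->
  cint (fun x => m x * cut D (pz F) x) /\
  cintegral (fun x => m x * F x) = cintegral (fun x => m x * cut D (pz F) x).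
Proof.
move=> tm cF; have [mm [C mC]] := trig_bounded tm.
have cmF := cint_bM mm mC cF.
have [c1 e1] := unfold_cintegral cF; have [c2 e2] := unfold_cintegral cmF.
have c3 := cint_bM mm mC c1; split => //.
rewrite -e2; apply: ae_eq_cintegral; [|exact: cint_meas|exact: cint_meas].
apply: ae_imp (unfold_abs_summable cF) => x sx.
have E : int_shift (fun y => m y * F y) x = (fun k => m x * int_shift F x k).
  apply/funext => k; rewrite /int_shift; congr (_ * _).
  by have := @trig_period R 1 m k x (oner_neq0 R) tm; rewrite mulr1.
rewrite /cut mulrCA; congr (_ * _); rewrite !pzE//; last first.
  by rewrite E; exact: abs_summableZ.
by rewrite E csumZ.
Qed.

(** A measurable representative of [bracket], equal to it wherever the sum converges absolutely. *)
Definition brk p q : R -> R[i] := pz (fun x => p x * conjc (q x)).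

Lemma inner_trig m p q k : trigpoly 1 m -> L2 p -> L2 q ->
  cint (cut D (fun x => m x * brk p q x)) /\
  inner (fun x => m x * p x) (fun x => chi 1 k x * q x) =
  fcoef (- (1 / 2)) 1 (cut D (fun x => m x * brk p q x)) k.
Proof.
move=> tm Lp Lq; have cF := L2_cint Lp Lq.
have [c1 _] := unfold_periodic tm cF.
have cutE' : cut D (fun x => m x * brk p q x) = (fun x => m x * cut D (brk p q) x).
  by apply/funext => x; rewrite /cut mulrCA.
rewrite cutE'; split => //.
have [_] := unfold_periodic (trigM tm (trigJ (trig_chi 1 k))) cF.
rewrite /inner /fcoef /inner => E; transitivity (cintegral
    (fun x => m x * conjc (chi 1 k x) * (p x * conjc (q x)))).
  by congr cintegral; apply/funext => x; rewrite conjcM; ring.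
rewrite E; congr cintegral; apply/funext => x.
have [Dx|Dx] := pselect (D x); first by rewrite /ec !cutE// -/(brk p q); ring.
by rewrite /ec !cutN// !mulr0 mul0r.
Qed.

(** Real valued and measurable, to be integrated against; almost everywhere it is the sum of the
    squared moduli of the translates. *)
Definition Phi p x : R := complex.Re (brk p p x).

Lemma measurable_brk p q : L2 p -> L2 q -> cmeas (brk p q).
Proof.
by move=> Lp Lq; apply/measurable_pz/cint_meas; exact: L2_cint.
Qed.

Lemma PhiP p : L2 p -> {ae mu, forall x,
  ssum n (fun k => sqn (p (x + k%:~R))) @[n --> \oo] --> Phi p x /\
  brk p p x = (Phi p x)%:C%C}.
Proof.
move=> Lp; apply: ae_imp (unfold_abs_summable (L2_cint Lp Lp)) => x sx.
have zE k : int_shift (fun y => p y * conjc (p y)) x k = (sqn (p (x + k%:~R)))%:C%C.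
  by rewrite /int_shift mulJ_sqn.
have cr := Re_csum_cvg sx; have ci := Im_csum_cvg sx.
split.
  rewrite /Phi /brk pzE//; apply: cvg_trans cr; apply: near_eq_cvg.
  by apply: nearW => n; apply: eq_ssum => k; rewrite zE.
rewrite /Phi /brk pzE//; apply: complexP => //.
apply: (cvg_unique (@Rhausdorff R) ci).
have -> : (fun n => ssum n (fun k => complex.Im (int_shift (fun y => p y * conjc (p y)) x k))) =
    (fun n : nat => 0).
  by apply/funext => n; rewrite /ssum big1// => j _; rewrite zE.
exact: cvg_cst.
Qed.

Lemma nsq_trigM m p : trigpoly 1 m -> L2 p ->
  rint (fun x => sqn (m x) * (\1_D x * Phi p x)) /\
  nsq (fun x => m x * p x) = Rint (fun x => sqn (m x) * (\1_D x * Phi p x)).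
Proof.
move=> tm Lp; have cF := L2_cint Lp Lp.
have tmm := trigM tm (trigJ tm).
have [[rr _] E] := unfold_periodic tmm cF.
have rE : (fun x => complex.Re (m x * conjc (m x) * cut D (brk p p) x)) =
    (fun x => sqn (m x) * (\1_D x * Phi p x)).
  by apply/funext => x; rewrite mulJ_sqn ReZ /cut ReZ.
split; first by rewrite -rE.
rewrite -rE nsqE /inner.
have -> : (fun x => m x * p x * conjc (m x * p x)) =
    (fun x => m x * conjc (m x) * (p x * conjc (p x))).
  by apply/funext => x; rewrite conjcM; ring.
by rewrite E.
Qed.

(* By the arithmetic-geometric inequality [|p q| <= (|p|^2 + |q|^2) / 2]. *)
Lemma brk_bound p q : L2 p -> L2 q ->
  {ae mu, forall x, sqn (brk p q x) <= 2 * ((Phi p x + Phi q x) / 2) ^+ 2}.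
Proof.
move=> Lp Lq; have s1 := unfold_abs_summable (L2_cint Lp Lq).
apply: ae_imp (ae_and s1 (ae_and (PhiP Lp) (PhiP Lq))) => x [sx [[pp _] [qq _]]].
rewrite /brk pzE//.
apply: le_trans (sqn_csum_le sx) _; rewrite ler_wpM2l//.
set l := limn _.
have sl : ssum n (fun k => cnorm (int_shift (fun y => p y * conjc (q y)) x k))
    @[n --> \oo] --> l by exact: sx.
have l0 : 0 <= l.
  by apply: limr_ge => //; apply: nearW => n; apply: sumr_ge0 => j _; exact: cnorm_ge0.
suff ll : l <= (Phi p x + Phi q x) / 2.
  by rewrite ler_sqr ?nnegrE//; exact: le_trans ll.
have c2 : (ssum n (fun k => sqn (p (x + k%:~R))) + ssum n (fun k => sqn (q (x + k%:~R)))) / 2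
    @[n --> \oo] --> (Phi p x + Phi q x) / 2 by apply: cvgMl; exact: cvgD.
rewrite -(cvg_lim (@Rhausdorff R) c2); apply: ler_lim => //; first exact: cvgP c2.
apply: nearW => n; rewrite -ssumD mulrC -ssumZ; apply: ler_ssum => k.
rewrite /int_shift cnormM !cnormE sqnJ.
set s := sqn (p _); set t := sqn (q _).
have := sqr_ge0 (Num.sqrt s - Num.sqrt t); rewrite sqrrB !sqr_sqrtr ?sqn_ge0//; lra.
Qed.

End Brackets.

(** * Symbols of elements of W and the bound on Phi *)

Section Frames.
Context {R : realType}.
Local Notation mu := (@lebesgue_measure R).
Local Notation D := `[- (1 / 2) : R, - (1 / 2) + 1[%classic.
Implicit Types (f m p q : R -> R[i]) (W V : set (R -> R[i])).

(** Both [W] and the transform are linear, so the element is assembled along the construction of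
    [m], starting from the translates. *)
Lemma trig_realize W f p m : closed_subspace W -> frame_for W (translates f) ->
  is_fourier f p -> trigpoly 1 m ->
  exists2 F, W F & is_fourier F (fun x => m x * p x).
Proof.
move=> [_ _ Wlin _] [Wf _] fp; elim=> {m} [k|a g h _ [F1 W1 h1] _ [F2 W2 h2]].
  by exists (translate k f); [exact: Wf|exact: is_fourier_translate].
exists (fun x => a * F1 x + F2 x); first exact: Wlin.
have := is_fourier_lin a h1 h2; congr is_fourier; apply/funext => x; ring.
Qed.

Lemma frame_upper W (G : int -> R -> R[i]) : closed_subspace W -> frame_for W G ->
  exists2 beta : R, 0 < beta &
  forall f n, W f -> ssum n (fun k => sqn (inner f (G k))) <= beta * nsq f.
Proof.
move=> [WL2 _ _ _] [_ [alpha [beta [a0 ab Hf]]]]; exists beta.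
  exact: lt_le_trans ab.
move=> f n Wf; have [_ up] := Hf f Wf; have Lf := WL2 f Wf.
rewrite -lee_fin; apply: le_trans (le_trans up _).
  apply: esum_ge; exists [set` srange n].
    by split => //; exact: finite_seq.
  rewrite -fsbig_seq ?srange_uniq// ssumE -sumEFin.
  by apply: lee_sum => k _; rewrite cnorm_sqr.
rewrite norm2E// -EFin_expe -EFinM sqr_sqrtr//.
exact: nsq_ge0.
Qed.

Lemma inner_trig_translate f p f' q F m k : is_fourier f p -> is_fourier f' q ->
  is_fourier F (fun x => m x * p x) -> trigpoly 1 m ->
  inner F (translates f' k) =
  fcoef (- (1 / 2)) 1 (cut D (fun x => m x * brk p q x)) k.
Proof.
move=> fp fq Fm tm; have [_ Lp _] := fp; have [_ Lq _] := fq.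
have [_ <-] := inner_trig k tm Lp Lq.
by rewrite (is_fourier_inner Fm (is_fourier_translate k fq)).
Qed.

(* The frame inequality for the trigonometric polynomials [m p] says that the
   Fourier coefficients of [m Phi] are square summable with
   [|m Phi|^2 <= beta int |m|^2 Phi], that is [int |m|^2 (beta - Phi) Phi >= 0]. *)
Lemma Phi_bounded W f p : closed_subspace W -> frame_for W (translates f) ->
  is_fourier f p ->
  exists2 beta : R, 0 < beta & {ae mu, forall x, D x -> Phi p x <= beta}.
Proof.
move=> cW fW fp; have [Lf Lp _] := fp.
have [beta b0 Hb] := frame_upper cW fW; exists beta => //.
have L1 : 0 < 1 :> R by [].
(* Square integrability of [m Phi] is not known beforehand: the frame bound controls its Fourier
   coefficients, and [fourier_series_cvg] deduces it from integrability. *)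
have key m : trigpoly 1 m -> L2 (cut D (fun x => m x * brk p p x)) /\
    nsq (cut D (fun x => m x * brk p p x)) <=
    beta * Rint (fun x => sqn (m x) * (\1_D x * Phi p x)).
  move=> tm; have [F WF Fm] := trig_realize cW fW fp tm.
  have [cw _] := inner_trig 0 tm Lp Lp.
  have [rm nm] := nsq_trigM tm Lp.
  have bnd n : ssum n (fun k => sqn (fcoef (- (1 / 2)) 1
      (cut D (fun x => m x * brk p p x)) k)) <= beta * nsq F.
    rewrite (_ : ssum n _ = ssum n (fun k => sqn (inner F (translates f k)))).
      exact: Hb.
    by apply: eq_ssum => k; rewrite (inner_trig_translate k fp fp Fm tm).
  have [|Lw _ cw'] := fourier_series_cvg L1 cw _ bnd; first by move=> x; exact: cutN.
  split => //; rewrite -nm (is_fourier_nsq Fm).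
  rewrite -[leLHS]mul1r -(cvg_lim (@Rhausdorff R) cw').
  by apply: limr_le; [exact: cvgP cw'|exact: nearW].
have [L_1 _] := key _ (trig_cst 1 1).
have rB : rint (fun x => \1_D x * sqn (brk p p x)).
  have := L2_rint L_1; congr rint; apply/funext => x.
  by rewrite sqn_cut (mul1r (brk p p x)).
have [rP _] := nsq_trigM (trig_cst 1 1) Lp.
have {}rP : rint (fun x => \1_D x * Phi p x).
  by move: rP; congr rint; apply/funext => x; rewrite sqn1 [LHS]mul1r.
have pos : {ae mu, forall x, 0 <= beta * (\1_D x * Phi p x) - \1_D x * sqn (brk p p x)}.
  apply: (trig_test_ge0 L1 (a := - (1 / 2))).
  - by apply: rintB => //; exact: rintZ.
  - by move=> x Dx; rewrite indicE memNset// !mul0r mulr0 subr0.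
  move=> m tm; have [Lm nm] := key m tm; have [rm _] := nsq_trigM tm Lp.
  have -> : (fun x => sqn (m x) * (beta * (\1_D x * Phi p x) - \1_D x * sqn (brk p p x))) =
      (fun x => beta * (sqn (m x) * (\1_D x * Phi p x)) -
        sqn (cut D (fun x => m x * brk p p x) x)).
    by apply/funext => x; rewrite sqn_cut sqnM; ring.
  rewrite RintB; [|exact: rintZ|exact: L2_rint].
  by rewrite RintZ// subr_ge0.
apply: ae_imp pos => x; move=> + Dx; rewrite indicE mem_set//.
rewrite [1%:R * Phi _ _]mul1r [1%:R * sqn _]mul1r subr_ge0.
(* The bracket was kept complex in the test; its real part suffices, and Phi^2 <= beta Phi excludes
   Phi > beta > 0. *)
have : Phi p x ^+ 2 <= sqn (brk p p x) by exact: ReE_le.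
move=> h1 h2; rewrite leNgt; apply/negP => h3.
have := le_trans h1 h2; rewrite expr2 leNgt; apply/negP; rewrite negbK.
by rewrite ltr_pM2r// (lt_trans b0).
Qed.

End Frames.

(** * The approximate duality inequality on symbols *)

Section DualFrames.
Context {R : realType}.
Local Notation mu := (@lebesgue_measure R).
Local Notation D := `[- (1 / 2) : R, - (1 / 2) + 1[%classic.
Implicit Types (f p q : R -> R[i]) (W V : set (R -> R[i])).

Lemma ae_bounded_L2 f (C : R) : cmeas f -> {ae mu, forall x, sqn (f x) <= C} ->
  L2 (cut D f).
Proof.
move=> mf fC; have ms := measurable_sqn mf.
(* Truncation gives an everywhere bounded function that is almost everywhere the original one; the
   absolute value covers a negative [C]. *)
have mm : measurable_fun setT (fun x : R => Num.min (sqn (f x)) `|C|).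
  by apply: measurable_minr => //; exact: measurable_cst.
have rm : rint (fun x => \1_D x * Num.min (sqn (f x)) `|C|).
  have := rint_bM (C := `|C|) mm _ (rint_indic (- (1 / 2)) (- (1 / 2) + 1)).
  under eq_fun do rewrite mulrC; apply => x.
  by rewrite ger0_norm ?le_min ?sqn_ge0 ?normr_ge0// ge_min lexx orbT.
apply/L2E; split; first exact: cmeas_cut.
apply: ae_eq_rint rm; last by apply: measurable_sqn; exact: cmeas_cut.
apply: ae_imp fC => x fx; rewrite sqn_cut; congr (_ * _).
by apply/min_idPl; exact: le_trans fx (ler_norm C).
Qed.

(** [F] itself is an admissible value of the projection, and the chosen one differs from it by an
    element of both summands, which vanishes almost everywhere. *)
Lemma projection_ae W V F : closed_subspace W -> direct_sum W (orthocompl V) -> W F ->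
  W (projection W (orthocompl V) F) /\
  {ae mu, forall x, projection W (orthocompl V) F x = F x}.
Proof.
move=> [WL2 _ Wlin _] [_ uniq] WF.
have U0 : orthocompl V (F \- F).
  rewrite (_ : F \- F = fun=> 0); last by apply/funext => x /=; rewrite subrr.
  split; first exact: L2_0.
  move=> g _; rewrite /inner; under eq_fun do rewrite mul0r.
  exact: cintegral0.
have [Wp Up] := xgetPex (fun=> 0) (ex_intro
  (fun w => W w /\ orthocompl V (F \- w)) F (conj WF U0)).
split => //; rewrite -/(projection W (orthocompl V) F) in Wp Up.
have WFp : W (F \- projection W (orthocompl V) F).
  have := Wlin (-1) _ _ Wp WF; congr W; apply/funext => x /=.
  by rewrite mulN1r addrC.
apply: ae_imp (uniq _ WFp Up) => x /= /eqP.
by rewrite subr_eq0 => /eqP ->.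
Qed.

(* Writing [B] for [brk p q], an element of [W] with symbol [m] is sent by the
   mixed frame operator to the one with symbol [m B], so that the hypothesis is
   [int |m|^2 |1 - B|^2 Phi <= eps^2 int |m|^2 Phi] for all trigonometric
   polynomials [m]. *)
Lemma dual_frame_bracket W V f f' p q (eps : R) :
  closed_subspace W -> closed_subspace V -> direct_sum W (orthocompl V) ->
  is_fourier f p -> is_fourier f' q -> 0 <= eps ->
  approx_oblique_dual_frames W V (translates f) (translates f') eps ->
  {ae mu, forall x, D x -> 0 < Phi p x -> sqn (1 - brk p q x) <= eps ^+ 2}.
Proof.
move=> cW cV WV fp fq eps0 [fW fV opn].
have [Lf Lp _] := fp; have [Lf' Lq _] := fq.
have [beta b0 Pb] := Phi_bounded cW fW fp.
have [beta' b0' Qb] := Phi_bounded cV fV fq.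
have L1 : 0 < 1 :> R by [].
have [WL2 _ Wlin _] := cW.
set B := brk p q.
have mB : cmeas B by exact: measurable_brk.
(* The bracket is controlled by the bounds on [Phi p] and [Phi q], which come from the frames for
   [W] and for [V]. *)
have ae_all_D : {ae mu, forall x, D x -> sqn (B x) <= 2 * ((beta + beta') / 2) ^+ 2}.
  have := ae_and (brk_bound Lp Lq) (ae_and (ae_and (PhiP Lp) (PhiP Lq)) (ae_and Pb Qb)).
  apply: ae_imp => x [bx [[[pp _] [qq _]] [px qx]]] Dx.
  have p0 : 0 <= Phi p x.
    rewrite -(cvg_lim (@Rhausdorff R) pp); apply: limr_ge; first exact: cvgP pp.
    by apply: nearW => n; apply: sumr_ge0 => j _; exact: sqn_ge0.
  have q0 : 0 <= Phi q x.
    rewrite -(cvg_lim (@Rhausdorff R) qq); apply: limr_ge; first exact: cvgP qq.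
    by apply: nearW => n; apply: sumr_ge0 => j _; exact: sqn_ge0.
  apply: le_trans bx _; rewrite ler_wpM2l// ler_sqr ?nnegrE; [|lra|lra].
  by have := px Dx; have := qx Dx; lra.
have LB : L2 (cut D B).
  (* The bound on [B] holds on [D] only, while [ae_bounded_L2] asks for one on the whole line;
     [cut D B] has one. *)
  have -> : cut D B = cut D (cut D B).
    by apply: cut_supp => x; exact: cutN.
  apply: (@ae_bounded_L2 _ (2 * ((beta + beta') / 2) ^+ 2)); first exact: cmeas_cut.
  apply: ae_imp ae_all_D => x bx; have [Dx|Dx] := pselect (D x).
    by rewrite cutE//; exact: bx.
  by rewrite cutN// sqn0 mulr_ge0// sqr_ge0.
(* [Phi] is bounded only almost everywhere, hence the truncation. *)
pose Ph x := Num.min (Num.max (\1_D x * Phi p x) 0) beta.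
have Ph0 x : 0 <= Ph x by rewrite le_min le_max lexx orbT ltW.
have Phb x : Ph x <= beta by rewrite ge_min lexx orbT.
have PhN x : ~ D x -> Ph x = 0.
  move=> Dx; rewrite /Ph indicE memNset// mul0r maxxx.
  by apply/min_idPl; exact: ltW.
have [mP _] := measurable_brk Lp Lp.
have m1P : measurable_fun setT (fun x : R => \1_D x * Phi p x).
  by apply: measurable_funM => //; exact: measurable_indic.
have mPh : measurable_fun setT Ph.
  apply: measurable_minr; last exact: measurable_cst.
  by apply: measurable_maxr => //; exact: measurable_cst.
have PhE : {ae mu, forall x, \1_D x * Phi p x = Ph x}.
  apply: ae_imp (ae_and (PhiP Lp) Pb) => x [[pp _] px].
  have [Dx|Dx] := pselect (D x); last by rewrite PhN// indicE memNset// mul0r.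
  have p0 : 0 <= Phi p x.
    rewrite -(cvg_lim (@Rhausdorff R) pp); apply: limr_ge; first exact: cvgP pp.
    by apply: nearW => n; apply: sumr_ge0 => j _; exact: sqn_ge0.
  rewrite /Ph indicE mem_set// [1%:R * _]mul1r.
  by rewrite (max_idPl p0) (min_idPl (px Dx)).
have nsqP m : trigpoly 1 m -> nsq (fun x => m x * p x) = Rint (fun x => sqn (m x) * Ph x).
  move=> tm; have [rm ->] := nsq_trigM tm Lp; have [mm _] := trig_bounded tm.
  apply: ae_eq_Rint; first by apply: ae_imp PhE => x ->.
    by apply: measurable_funM => //; exact: measurable_sqn.
  exact: rint_meas.
(* With the square root of the weight as a multiplier, the weighted norm becomes an ordinary one and
   the L^2 limit lemmas apply. *)
pose r x : R[i] := (Num.sqrt (Ph x))%:C%C.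
have sqr_r x : sqn (r x) = Ph x by rewrite /sqn /= expr0n addr0 sqr_sqrtr.
have mr : cmeas r.
  split; last exact: measurable_cst.
  exact: (measurableT_comp (continuous_measurable_fun (@sqrt_continuous R)) mPh).
have Lr u : L2 u -> L2 (fun x => r x * u x).
  by apply: (@L2_bM _ beta) => // x; rewrite sqr_r.
have nr u : nsq (fun x => r x * u x) = Rint (fun x => sqn (u x) * Ph x).
  by congr Rint; apply/funext => x; rewrite sqnM sqr_r mulrC.
have nr_le u : L2 u -> nsq (fun x => r x * u x) <= beta * nsq u.
  move=> Lu; rewrite nr /nsq -RintZ; last exact: L2_rint.
  apply: le_Rint => [||x]; [|exact/rintZ/L2_rint|].
    have := L2_rint (Lr u Lu); congr rint; apply/funext => x.
    by rewrite sqnM sqr_r mulrC.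
  by rewrite mulrC ler_wpM2r ?sqn_ge0.
have LU m : trigpoly 1 m -> L2 (cut D (fun x => m x * (1 - B x))).
  move=> tm; have [mm [C mC]] := trig_bounded tm.
  have L_1B : L2 (fun x => cut D (fun=> 1) x - cut D B x).
    by apply: L2B => //; apply: (@L2_trig_cut _ _ 1); exact: trig_cst.
  have := L2_bM mm mC L_1B; congr L2; apply/funext => x.
  by rewrite /cut -mulrBr mulrCA.
have test m : trigpoly 1 m ->
    Rint (fun x => sqn (cut D (fun x => m x * (1 - B x)) x) * Ph x) <=
    eps ^+ 2 * Rint (fun x => sqn (m x) * Ph x).
  move=> tm; have [F WF Fm] := trig_realize cW fW fp tm.
  have LF := WL2 F WF.
  pose w := cut D (fun x => m x * B x).
  have Lw : L2 w.
    have [mm [C mC]] := trig_bounded tm.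
    have := L2_bM mm mC LB; congr L2; apply/funext => x.
    by rewrite /w /cut mulrCA.
  pose c k := inner F (translates f' k).
  have cE' k : c k = fcoef (- (1 / 2)) 1 w k.
    exact: inner_trig_translate fp fq Fm tm.
  have [fw _] := parseval L1 Lw (fun x => @cutN _ D _ x).
  rewrite -(funext cE') in fw.
  (* The symbol of the n-th partial synthesis; on [D] it is the n-th partial sum of the Fourier
     series of [w]. *)
  pose sm n x := \sum_(j < n.*2.+1) c (j%:Z - n%:Z) * chi 1 (j%:Z - n%:Z) x.
  have tsm n : trigpoly 1 (sm n) by apply: trig_sum => j _; apply: trigZ; exact: trig_chi.
  have smE n : cut D (sm n) = fsum (- (1 / 2)) 1 c n.
    apply/funext => x; rewrite /cut /fsum mulr_sumr.
    rewrite -[RHS](ssumE n (fun k => (1^-1)%:C%C * c k * ec (- (1 / 2)) 1 k x)).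
    by apply: eq_bigr => j _; rewrite invr1 rmorph1 -[RHS]mulrA [RHS]mul1r /ec /cut mulrCA.
  pose S n x := \sum_(j < n.*2.+1) c (j%:Z - n%:Z) * translates f (j%:Z - n%:Z) x.
  have FS n : is_fourier (S n) (fun x => sm n x * p x).
    have := @is_fourier_sum R _ (index_enum 'I_n.*2.+1)
      (fun j => translates f (j%:Z - n%:Z)) (fun j x => chi 1 (j%:Z - n%:Z) x * p x)
      (fun j => c (j%:Z - n%:Z)) (fun j => is_fourier_translate _ fp).
    congr is_fourier; apply/funext => x; rewrite /sm mulr_suml.
    by apply: eq_bigr => j _; rewrite mulrA.
  have LS n : L2 (S n) by have [] := FS n.
  have Lfs n : L2 (fsum (- (1 / 2)) 1 c n) by exact: L2_fsum.
  (* The norm of a combination of translates is a weighted norm of its symbol. *)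
  have nsqr (m' F' : R -> R[i]) : trigpoly 1 m' ->
      is_fourier F' (fun x => m' x * p x) -> nsq F' = nsq (fun x => r x * cut D m' x).
    move=> tm' F'm; rewrite -(is_fourier_nsq F'm) nsqP// nr; congr Rint.
    apply/funext => x; rewrite sqn_cut; have [Dx|Dx] := pselect (D x).
      by rewrite indicE mem_set// [1%:R * _]mul1r.
    by rewrite PhN// !mulr0.
  have tB (m1 m2 : R -> R[i]) : trigpoly 1 m1 -> trigpoly 1 m2 -> trigpoly 1 (fun x => m1 x - m2 x).
    move=> t1 t2; have := trig_lin (-1) t2 t1; congr trigpoly; apply/funext => x.
    by rewrite mulN1r addrC.
  have FB (F1 F2 g1 g2 : R -> R[i]) : is_fourier F1 (fun x => g1 x * p x) ->
      is_fourier F2 (fun x => g2 x * p x) ->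
      is_fourier (fun x => F1 x - F2 x) (fun x => (g1 x - g2 x) * p x).
    move=> h1 h2; have := is_fourier_lin (-1) h2 h1.
    by congr is_fourier; apply/funext => x; ring.
  (* Without a limit of the partial sums [synthesis] would be its default value. The tolerance e /
     (4 beta) absorbs the bound [beta] of the weight and the factor 2 of each of two terms. *)
  have [G LG SG] : exists2 G, L2 G & nsq (fun x => S n x - G x) @[n --> \oo] --> 0.
    apply: riesz_fischer => // e e0.
    have e4 : 0 < e / (4 * beta) by rewrite divr_gt0// mulr_gt0.
    have [N _ HN] : \forall n \near \oo,
        `|nsq (fun x => fsum (- (1 / 2)) 1 c n x - w x)| <= e / (4 * beta).
      by move/cvgr0Pnorm_le : fw; apply.
    exists N => k n Nk Nn.
    rewrite (nsqr _ _ (tB _ _ (tsm k) (tsm n)) (FB _ _ _ _ (FS k) (FS n))).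
    have -> : cut D (fun x => sm k x - sm n x) = (fun x =>
        (fsum (- (1 / 2)) 1 c k x - w x) + (w x - fsum (- (1 / 2)) 1 c n x)).
      by apply/funext => x; rewrite addrA subrK -!smE /cut mulrBr.
    have Lk := L2B (Lfs k) Lw; have Ln := L2B Lw (Lfs n).
    apply: le_trans (nr_le _ (L2D Lk Ln)) _.
    apply: le_trans (ler_wpM2l (ltW b0) (nsqD_le Lk Ln)) _.
    rewrite (nsq_distC w); have := HN k Nk; have := HN n Nn => /=.
    rewrite !ger0_norm ?nsq_ge0// !ler_pdivlMr ?mulr_gt0// => h1 h2; lra.
  have [LSy Sy] : L2 (synthesis (translates f) (analysis (translates f') F)) /\
      cvgL2 S (synthesis (translates f) (analysis (translates f') F)).
    have cS : cvgL2 S G by apply/(cvgL2E LS LG).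
    exact: (xgetPex (fun=> 0) (ex_intro (fun g => L2 g /\ cvgL2 S g) G (conj LG cS))).
  set G0 := synthesis _ _ in LSy Sy.
  move/(cvgL2E LS LSy) : Sy => Sy.
  have [Wpr prE] := projection_ae cW WV WF.
  have Lpr := WL2 _ Wpr.
  (* The hypothesis on the operator norm, squared, at an element of [W], where the projection is the
     identity almost everywhere. *)
  have FG : nsq (fun x => F x - G0 x) <= eps ^+ 2 * nsq F.
    have := opn F LF; rewrite -/G0 norm2E; last exact: L2B.
    rewrite norm2E// -EFinM lee_fin -ler_sqr ?nnegrE ?mulr_ge0 ?sqrtr_ge0//.
    rewrite exprMn !sqr_sqrtr ?nsq_ge0//.
    suff -> : nsq (projection W (orthocompl V) F \- G0) = nsq (fun x => F x - G0 x) by [].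
    apply: ae_eq_nsq; [|exact/L2_meas/L2B|exact/L2_meas/L2B].
    by apply: ae_imp prE => x /= ->.
  have c1 : nsq (fun x => F x - S n x) @[n --> \oo] --> nsq (fun x => F x - G0 x).
    apply: nsq_cvg; [by move=> n; exact: L2B|exact: L2B|].
    apply: cvg_trans Sy; apply: near_eq_cvg; apply: nearW => n.
    by rewrite nsq_distC; congr nsq; apply/funext => x; ring.
  pose U := cut D (fun x => m x * (1 - B x)).
  have LU' : L2 U by exact: LU.
  pose Un n := cut D (fun x => m x - sm n x).
  have LUn n : L2 (Un n) by apply: L2_trig_cut; exact: tB.
  have c2 : nsq (fun x => r x * Un n x) @[n --> \oo] --> nsq (fun x => r x * U x).
    apply: nsq_cvg; [by move=> n; exact: Lr|exact: Lr|].
    apply: (@squeeze_cvgr _ _ _ _ (fun=> 0)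
      (fun n => beta * nsq (fun x => fsum (- (1 / 2)) 1 c n x - w x))).
    - apply: nearW => n; rewrite nsq_ge0 /=.
      have -> : (fun x => r x * Un n x - r x * U x) =
          (fun x => r x * (- (fsum (- (1 / 2)) 1 c n x - w x))).
        by apply/funext => x; rewrite -smE /Un /U /w /cut; ring.
      apply: le_trans (nr_le _ (L2N (L2B (Lfs n) Lw))) _.
      by rewrite nsqN.
    - exact: cvg_cst.
    by rewrite -[X in _ --> X](mulr0 beta); exact: cvgMr.
  (* [F - S n] has symbol [m - sm n], so the limit in L^2(R) and the weighted limit on the period
     are limits of one sequence. *)
  have E n : nsq (fun x => F x - S n x) = nsq (fun x => r x * Un n x).
    exact: nsqr (tB _ _ tm (tsm n)) (FB _ _ _ _ Fm (FS n)).
  rewrite (funext E) in c1.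
  have UE := cvg_unique (@Rhausdorff R) c1 c2.
  rewrite -[leLHS]nr -/U -UE; apply: le_trans FG _.
  by rewrite -nsqP// (is_fourier_nsq Fm).
have rU m : trigpoly 1 m -> rint (fun x => sqn (cut D (fun x => m x * (1 - B x)) x) * Ph x).
  move=> tm; have := L2_rint (Lr _ (LU m tm)); congr rint; apply/funext => x.
  by rewrite sqnM sqr_r mulrC.
have rP m : trigpoly 1 m -> rint (fun x => sqn (m x) * Ph x).
  move=> tm; have [rm _] := nsq_trigM tm Lp; have [mm _] := trig_bounded tm.
  apply: ae_eq_rint rm; first by apply: ae_imp PhE => x ->.
  by apply: measurable_funM => //; exact: measurable_sqn.
have t1 := trig_cst 1 1 : trigpoly 1 (fun=> 1 : R[i]).
(* The weight under test is written with the symbol 1, so that [rP] and [rU] give its integrability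
   directly. *)
have pos : {ae mu, forall x, 0 <= eps ^+ 2 * (sqn (1 : R[i]) * Ph x) -
    sqn (cut D (fun x => 1 * (1 - B x)) x) * Ph x}.
  apply: (trig_test_ge0 L1 (a := - (1 / 2))).
  - by apply: rintB; [exact/rintZ/rP|exact: rU].
  - by move=> x Dx; rewrite PhN// !mulr0 subr0.
  move=> m tm.
  have -> : (fun x => sqn (m x) * (eps ^+ 2 * (sqn (1 : R[i]) * Ph x) -
        sqn (cut D (fun x => 1 * (1 - B x)) x) * Ph x)) =
      (fun x => eps ^+ 2 * (sqn (m x) * Ph x) -
        sqn (cut D (fun x => m x * (1 - B x)) x) * Ph x).
    by apply/funext => x; rewrite !sqn_cut !sqnM sqn1; ring.
  rewrite RintB; [|exact/rintZ/rP|exact: rU].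
  by rewrite RintZ ?subr_ge0; [exact: test|exact: rP].
apply: ae_imp (ae_and pos PhE) => x [+ Px] Dx P0.
rewrite cutE// [1 * (1 - B x)]mul1r sqn1 [1 * Ph x]mul1r -mulrBl.
rewrite -Px indicE mem_set// [1%:R * _]mul1r pmulr_lge0//.
by rewrite subr_ge0.
Qed.

End DualFrames.

(** * From one period to the line and to the stated brackets *)

Section Statements.
Context {R : realType}.
Local Notation mu := (@lebesgue_measure R).

Lemma int_periodic (H : R -> R[i]) (x : R) (k : int) :
  (forall x, H (x + 1) = H x) -> H (x + k%:~R) = H x.
Proof.
move=> H1; have nat_case (n : nat) y : H (y + n%:R) = H y.
  by elim: n => [|n IH]; rewrite ?addr0// -(natr1 n) addrA H1.
case: (intP k) => [|n|n]; first by rewrite addr0.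
  by rewrite -pmulrn nat_case.
by rewrite mulrNz -pmulrn -(nat_case n.+1) subrK.
Qed.

Lemma ae_int_shift (P : R -> Prop) : {ae mu, forall x, P x} ->
  {ae mu, forall x, forall k : int, P (x + k%:~R)}.
Proof.
move=> aP.
have h1 : {ae mu, forall x, forall n : nat, P (x + n%:R)}.
  by apply: ae_foralln => n; exact: (ae_shift n%:R aP).
have h2 : {ae mu, forall x, forall n : nat, P (x - n%:R)}.
  by apply: ae_foralln => n; exact: (ae_shift (- n%:R) aP).
apply: ae_imp (ae_and h1 h2) => x [px nx] k.
case: (intP k) => [|n|n]; [exact: (px 0%N)|exact: (px n.+1)|].
by rewrite mulrNz; exact: (nx n.+1).
Qed.

Lemma int_shiftD (F : R -> R[i]) x (k : int) :
  int_shift F (x + k%:~R) = (fun j => int_shift F x (k + j)).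
Proof. by apply/funext => j; rewrite /int_shift intrD addrA. Qed.

(** If every term vanished, so would the extended sum; one positive term bounds the sum of
    nonnegative terms from below. *)
Lemma periodization_neq0 (p : R -> R[i]) (x : R) :
  abs_summable (int_shift (fun y => p y * conjc (p y)) x) ->
  (~` zero_set (periodization p)) x ->
  0 < complex.Re (csum (int_shift (fun y => p y * conjc (p y)) x)).
Proof.
move=> sx nz; have cr := Re_csum_cvg sx.
have zE k : complex.Re (int_shift (fun y => p y * conjc (p y)) x k) = sqn (p (x + k%:~R)).
  by rewrite /int_shift mulJ_sqn.
have [k pk] : exists k : int, sqn (p (x + k%:~R)) != 0.
  apply: contrapT => nk; apply: nz; rewrite /zero_set /= /periodization.
  apply: esum1 => k _; rewrite cnorm_sqr; congr EFin.
  by apply/eqP/negPn/negP => pk; apply: nk; exists k.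
have k0 : 0 < sqn (p (x + k%:~R)) by rewrite lt_neqAle eq_sym pk sqn_ge0.
apply: lt_le_trans k0 _.
have pos j : 0 <= complex.Re (int_shift (fun y => p y * conjc (p y)) x j).
  by rewrite zE sqn_ge0.
apply: le_trans (ssum_le_lim `|k|%N pos cr).
rewrite -zE ssumE (bigD1_seq k) ?srange_uniq ?mem_srange//= lerDl.
exact: sumr_ge0.
Qed.

End Statements.

Theorem theorem8p6 (R : realType) (W V : set (R -> R[i]))
    (hW : closed_subspace W) (hV : closed_subspace V)
    (hWV : direct_sum W (orthocompl V))
    (phi phi1 : R -> R[i]) (hphi : L2 phi) (hphi1 : L2 phi1)
    (hFphi : frame_for W (translates phi))
    (hFphi1 : frame_for V (translates phi1))
    (phit : R -> R[i]) (hphit : V phit)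
    (Ht : R -> R[i]) (hHt : Cper 2%:E Ht)
    (hphitH : {ae lebesgue_measure, forall xi : R,
       fourier phit xi = Ht xi * fourier phi1 xi})
    (eps : R) (heps : 0 <= eps)
    (hdual : approx_oblique_dual_frames W V
               (translates phi) (translates phit) eps) :
  {ae lebesgue_measure, forall xi : R,
     (~` zero_set (periodization (fourier phi))) xi ->
     cnorm (conjc (Ht xi) * bracket (fourier phi) (fourier phi1) xi - 1)
       <= eps}.
Proof.
have Lphit : L2 phit by have [VL2 _ _ _] := hV; exact: VL2.
have fp := fourierP hphi; have fp1 := fourierP hphi1; have fq := fourierP Lphit.
set p := fourier phi in fp *; set p1 := fourier phi1 in fp1 hphitH *.
set q := fourier phit in fq hphitH.
have [_ Lp _] := fp; have [_ Lp1 _] := fp1; have [_ Lq _] := fq.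
pose pp := int_shift (fun y => p y * conjc (p y)).
pose pq := int_shift (fun y => p y * conjc (q y)).
(* Stated with [csum] under its convergence conditions, the property passes exactly from x to x + k,
   as [ae_periodic] requires. *)
have dual : {ae lebesgue_measure, forall x : R, abs_summable (pp x) ->
    abs_summable (pq x) -> 0 < complex.Re (csum (pp x)) ->
    sqn (1 - csum (pq x)) <= eps ^+ 2}.
  apply: ae_periodic => [x k Px|].
    rewrite /pp /pq !int_shiftD => s1 s2.
    have back F : abs_summable (fun j => int_shift F x (k + j)) ->
        abs_summable (int_shift F x).
      move=> /(@abs_summable_shift _ _ (- k)); congr abs_summable.
      by apply/funext => j; rewrite addNKr.
    have {}s1 := back _ s1; have {}s2 := back _ s2.
    by rewrite !csum_shift//; exact: Px.
  apply: ae_imp (dual_frame_bracket hW hV hWV fp fq heps hdual) => x Hx Dx s1 s2 h.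
  have := Hx Dx; rewrite /Phi /brk pzE// pzE// -/(pp x) -/(pq x).
  exact.
have a1 := unfold_abs_summable (L2_cint Lp Lp).
have a2 := unfold_abs_summable (L2_cint Lp Lq).
have a3 := unfold_abs_summable (L2_cint Lp Lp1).
have := ae_and dual (ae_and (ae_and a1 a2) (ae_and a3 (ae_int_shift hphitH))).
apply: ae_imp => x [dx [[s1 s2] [s3 qx]]] nz.
have HE : csum (pq x) = conjc (Ht x) * bracket p p1 x.
  rewrite /bracket -csumZ; last exact: s3.
  (* The relation between the transforms is needed at every x + k; periodicity of [Ht] then makes
     its conjugate a common factor of all the terms. *)
  congr csum; apply/funext => k; rewrite /pq /int_shift qx conjcM mulrCA.
  by have [H1 _] := hHt; rewrite (@int_periodic R Ht x k H1).
have := dx s1 s2 (periodization_neq0 s1 nz); rewrite HE => le.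
rewrite -ler_sqr ?nnegrE ?cnorm_ge0// cnorm_sqr.
by rewrite -sqnN opprB.
Qed.
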